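(* Let $L\colon TM\to\mathbb{R}$ be a Lagrangian satisfying conditions (S) and (G). Then $L$ admits a stationary product type local structure.
   Context: $M$ is a smooth connected manifold of dimension $m+1$, $m\ge 1$, with a fixed auxiliary complete Riemannian metric $g$ and norm $\|v\|=\sqrt{g(v,v)}$. For a function $L$ on $TM$: $\partial_vL(x,v)[w]:=\frac{d}{ds}L(x,v+sw)|_{s=0}$; in natural coordinates $(x^i,v^i)$ of $TM$, $\partial_xL(x,v)[w]:=\sum_i\frac{\partial L}{\partial x^i}(x,v)w^i$; $\|\partial_vL(x,v)\|$, $\|\partial_xL(x,v)\|$ are the norms of these linear forms with respect to $g_x$. Since $\partial_xL$ depends on coordinates, bounds on $\|\partial_xL\|$ are read in local charts (the locally bounded function in the bound may depend on the chart). The same notation is used for Lagrangians on other manifolds. Condition (S): (i) $L\in C^1(TM)$; (ii) there is a $C^1$ vector field $K$ on $M$ such that $L$ is invariant under the local flow $\psi$ of $K$, i.e. $L(\psi(t,x),\partial_x\psi(t,x)[v])=L(x,v)$ whenever defined, and the Noether charge $N(x,v):=\partial_vL(x,v)[K_x]$ has the form $N(x,v)=Q_x(v)+d(x)$ with $Q$ a $C^1$ one-form and $d$ a $C^1$ function on $M$; (iii) $d$ is invariant by the flow of $K$ and $Q_x(K)<0$ for all $x\in M$. Put $L_c(x,v):=L(x,v)-\frac{Q_x(v)^2}{Q_x(K)}$. Condition (G): there are continuous functions $C,\lambda\colon M\to(0,+\infty)$ such that, for all $x\in M$ and $v,v_1,v_2\in T_xM$: $L_c(x,v)\le C(x)(\|v\|^2+1)$;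 $\|\partial_xL_c(x,v)\|\le C(x)(\|v\|^2+1)$; $\|\partial_vL_c(x,v)\|\le C(x)(\|v\|+1)$; $(\partial_vL_c(x,v_2)-\partial_vL_c(x,v_1))[v_2-v_1]\ge\lambda(x)\|v_2-v_1\|^2$. Definition. $L$ admits a stationary product type local structure if for every $p\in M$ there exist an open precompact neighborhood $U_p\subset M$ of $p$, a manifold $S_p$ (with possibly empty boundary), an open interval $I_p=(-\epsilon_p,\epsilon_p)$ and a ($C^1$) diffeomorphism $\phi\colon S_p\times I_p\to U_p$ such that, $t$ being the natural coordinate of $I_p$, $\phi_*(\partial_t)=K|_{U_p}$ and, for all $((x,t),(\nu,\tau))\in T(S_p\times I_p)$, $$L\circ\phi_*\big((x,t),(\nu,\tau)\big)=L_0(x,\nu)+2\big(\omega(\nu)+d(x)/2\big)\tau-\beta(x)\tau^2,$$ where: $L_0\in C^1(TS_p)$ and, with $\|\cdot\|_{S_p}$ the norm of the metric induced on $S_p$ (seen as the hypersurface $\phi(S_p\times\{0\})$) by $g$, there is a continuous function $\ell\colon S_p\to(0,+\infty)$ with $L_0(x,\nu)\le\ell(x)(\|\nu\|_{S_p}^2+1)$, $\|\partial_xL_0(x,\nu)\|_{S_p}\le\ell(x)(\|\nu\|_{S_p}^2+1)$, $\|\partial_\nu L_0(x,\nu)\|_{S_p}\le\ell(x)(\|\nu\|_{S_p}+1)$, and there is a continuous function $\lambda_0\colon S_p\to(0,+\infty)$ with $(\partial_\nu L_0(x,\nu_2)-\partial_\nu L_0(x,\nu_1))[\nu_2-\nu_1]\ge\lambda_0(x)\|\nu_2-\nu_1\|_{S_p}^2$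 for all $x\in S_p$, $\nu_1,\nu_2\in T_xS_p$; $\omega$ is a $C^1$ one-form on $S_p$; $d\colon S_p\to\mathbb{R}$ is a $C^1$ function; $\beta\colon S_p\to(0,+\infty)$ is a $C^1$ function. *)

(* Defs.v *)
From mathcomp Require Import all_boot all_order all_algebra.
From mathcomp Require Import all_classical all_reals all_analysis.

Set Implicit Arguments.
Unset Strict Implicit.
Unset Printing Implicit Defensive.
Import Order.TTheory GRing.Theory Num.Theory numFieldNormedType.Exports.
Local Open Scope classical_set_scope.
Local Open Scope ring_scope.

(* [C_on k U f]: f is of class C^k on U.  Only meaningful for U open and V
   finite-dimensional, where f is C^(k+1) iff it is differentiable and all its
   directional derivatives are C^k. *)
Fixpoint C_on (R : realType) (V W : normedModType R) (k : nat) (U : set V)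
    (f : V -> W) {struct k} : Prop :=
  match k with
  | 0%N => forall x, U x -> {for x, continuous f}
  | k'.+1 => (forall x, U x -> differentiable f x) /\
             (forall v, C_on k' U ('D_v f))
  end.

(* A chart is a homeomorphism [cmap] from an open [cdom] onto an open [ccod] of
   R^n; [cmap] and [cinv] have arbitrary values outside these sets. *)
Record chart (R : realType) (n : nat) (T : topologicalType) := Chart {
  cdom : set T;
  ccod : set 'rV[R]_n;
  cmap : T -> 'rV[R]_n;
  cinv : 'rV[R]_n -> T;
  cdom_open : open cdom;
  ccod_open : open ccod;
  cmap_cod : forall x, cdom x -> ccod (cmap x);
  cinv_dom : forall y, ccod y -> cdom (cinv y);
  cmapK : forall x, cdom x -> cinv (cmap x) = x;
  cinvK : forall y, ccod y -> cmap (cinv y) = y;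
  cmap_continuous : {within cdom, continuous cmap};
  cinv_continuous : {within ccod, continuous cinv} }.

(* Smooth manifolds without boundary.  The atlas need not be maximal.  Each
   point x has a preferred chart [chart_at x], through which the tangent space
   T_xM is identified with 'rV[R]_n: a tangent vector at x is represented by its
   components in [chart_at x].  Hence functions on TM are functions
   M -> 'rV[R]_n -> R, and vector fields are functions M -> 'rV[R]_n. *)
Record manifold (R : realType) (n : nat) := Manifold {
  carrier :> topologicalType;
  atlas : set (chart R n carrier);
  chart_at : carrier -> chart R n carrier;
  chart_at_atlas : forall x, atlas (chart_at x);
  chart_at_dom : forall x, cdom (chart_at x) x;
  transition_smooth : forall c c', atlas c -> atlas c' -> forall k,
    C_on k (ccod c `&` cinv c @^-1` cdom c') (cmap c' \o cinv c);
  carrier_hausdorff : hausdorff_space carrier;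
  carrier_second_countable : @second_countable carrier }.

Section Manifolds.
Context {R : realType} {n : nat} {M : manifold R n}.
Implicit Types (c : chart R n M) (x : M) (v w : 'rV[R]_n).

(* Components in the chart c of the tangent vector v at x. *)
Definition to_chart c x v : 'rV[R]_n :=
  'd (cmap c \o cinv (chart_at x)) (cmap (chart_at x) x) v.

(* Tangent vector at the point of coordinates y with components w in c. *)
Definition of_chart c (y w : 'rV[R]_n) : 'rV[R]_n :=
  'd (cmap (chart_at (cinv c y)) \o cinv c) y w.

(* Tangent vector at f x, image of v in T_xM by the differential of f. *)
Definition tangent_map (f : M -> M) x v : 'rV[R]_n :=
  'd (cmap (chart_at (f x)) \o f \o cinv (chart_at x)) (cmap (chart_at x) x) v.

Definition C1_function (f : M -> R) : Prop :=
  forall c, atlas c -> C_on 1 (ccod c) (f \o cinv c).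

Definition C1_vector_field (K : M -> 'rV[R]_n) : Prop :=
  forall c, atlas c ->
    C_on 1 (ccod c) (fun y => to_chart c (cinv c y) (K (cinv c y))).

Definition C1_one_form (Q : M -> {scalar 'rV[R]_n}) : Prop :=
  forall c, atlas c -> forall w,
    C_on 1 (ccod c) (fun y => Q (cinv c y) (of_chart c y w)).

(* A function on TM, in the natural coordinates of TM associated with c. *)
Definition in_natural_coord (L : M -> 'rV[R]_n -> R) c
    (z : 'rV[R]_n * 'rV[R]_n) : R :=
  L (cinv c z.1) (of_chart c z.1 z.2).

Definition C1_TM (L : M -> 'rV[R]_n -> R) : Prop :=
  forall c, atlas c ->
    C_on 1 (ccod c `*` [set: 'rV[R]_n]) (in_natural_coord L c).

Definition partial_v (L : M -> 'rV[R]_n -> R) x v w : R := 'D_w (L x) v.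

Definition partial_x (L : M -> 'rV[R]_n -> R) c x v w : R :=
  \sum_(i < n) 'D_((delta_mx 0 i, 0)) (in_natural_coord L c)
                 (cmap c x, to_chart c x v)
               * to_chart c x w 0 i.

Definition form_norm (nrm : M -> 'rV[R]_n -> R) x (A : 'rV[R]_n -> R) : R :=
  sup [set `|A w| | w in [set w | nrm x w <= 1]].

(* Growth and fibrewise convexity bounds with respect to a family of norms on
   the tangent spaces.  Since partial_x depends on coordinates, the function
   bounding it may depend on the chart. *)
Definition growth_condition (nrm : M -> 'rV[R]_n -> R)
    (L : M -> 'rV[R]_n -> R) : Prop :=
  exists C lambda : M -> R,
  [/\ continuous C /\ (forall x, 0 < C x),
      continuous lambda /\ (forall x, 0 < lambda x)
    & [/\ forall x v, L x v <= C x * (nrm x v ^+ 2 + 1),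
          forall c, atlas c -> exists Cc : M -> R,
            [/\ {within cdom c, continuous Cc},
                forall x, cdom c x -> 0 < Cc x
              & forall x v, cdom c x ->
                  form_norm nrm x (partial_x L c x v)
                    <= Cc x * (nrm x v ^+ 2 + 1)],
          forall x v,
            form_norm nrm x (partial_v L x v) <= C x * (nrm x v + 1)
        & forall x v1 v2,
            lambda x * nrm x (v2 - v1) ^+ 2
              <= partial_v L x v2 (v2 - v1) - partial_v L x v1 (v2 - v1)]].

Definition velocity (gamma : R -> M) (t : R) : 'rV[R]_n :=
  'D_1 (cmap (chart_at (gamma t)) \o gamma) t.

Definition C1_curve (gamma : R -> M) : Prop :=
  continuous gamma /\
  forall c, atlas c -> C_on 1 (gamma @^-1` cdom c) (cmap c \o gamma).

Definition integral_curve (K : M -> 'rV[R]_n) (a b : R) (gamma : R -> M) :=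
  forall t, a < t < b ->
    {for t, continuous gamma} /\
    is_derive t 1 (cmap (chart_at (gamma t)) \o gamma) (K (gamma t)).

(* y is reached at time t by an integral curve of K starting at x. *)
Definition flow_reaches (K : M -> 'rV[R]_n) (t : R) x (y : M) : Prop :=
  exists (a b : R) (gamma : R -> M),
    [/\ a < 0 < b, a < t < b, integral_curve K a b gamma,
        gamma 0 = x & gamma t = y].

Definition flow_defined (K : M -> 'rV[R]_n) (t : R) x : Prop :=
  exists y, flow_reaches K t x y.

(* The maximal local flow of K; its value is x where it is not defined. *)
Definition flow (K : M -> 'rV[R]_n) (t : R) x : M :=
  xget x [set y | flow_reaches K t x y].

End Manifolds.

Record riemannian_metric (R : realType) (n : nat) (M : manifold R n) := Metric {
  metric :> M -> 'rV[R]_n -> 'rV[R]_n -> R;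
  metric_linear : forall x w, scalar (fun v => metric x v w);
  metric_sym : forall x v w, metric x v w = metric x w v;
  metric_pos : forall x v, v != 0 -> 0 < metric x v v;
  metric_smooth : forall c, atlas c -> forall v w k,
    C_on k (ccod c)
      (fun y => metric (cinv c y) (of_chart c y v) (of_chart c y w)) }.

Section Riemannian.
Context {R : realType} {n : nat} {M : manifold R n} (g : riemannian_metric M).

Definition gnorm (x : M) (v : 'rV[R]_n) : R := Num.sqrt (g x v v).

Definition curve_length (gamma : R -> M) : \bar R :=
  (\int[lebesgue_measure]_(t in `[0%R, 1%R])
     (gnorm (gamma t) (velocity gamma t))%:E)%E.

(* The infimum is the same over piecewise C^1 curves, which can be
   reparametrized to be C^1 with zero velocity at the corners and ends. *)
Definition riemannian_dist (x y : M) : \bar R :=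
  ereal_inf [set curve_length gamma | gamma in
    [set gamma | [/\ C1_curve gamma, gamma 0 = x & gamma 1 = y]]].

Definition complete_metric : Prop :=
  forall u : nat -> M,
    (forall e : R, 0 < e -> exists N : nat, forall i j : nat,
       (N <= i)%N -> (N <= j)%N -> (riemannian_dist (u i) (u j) < e%:E)%E) ->
    exists l : M, u @ \oo --> l.

End Riemannian.

Section Lagrangian.
Context {R : realType} {n : nat} {M : manifold R n}.

Definition flow_invariant_function (K : M -> 'rV[R]_n) (d : M -> R) : Prop :=
  forall t x, flow_defined K t x -> d (flow K t x) = d x.

Definition flow_invariant_lagrangian (K : M -> 'rV[R]_n)
    (L : M -> 'rV[R]_n -> R) : Prop :=
  forall t x v, flow_defined K t x ->
    L (flow K t x) (tangent_map (flow K t) x v) = L x v.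

Definition noether_charge (K : M -> 'rV[R]_n) (L : M -> 'rV[R]_n -> R)
    (x : M) (v : 'rV[R]_n) : R := partial_v L x v (K x).

Definition condition_S (L : M -> 'rV[R]_n -> R) (K : M -> 'rV[R]_n)
    (Q : M -> {scalar 'rV[R]_n}) (d : M -> R) : Prop :=
  [/\ C1_TM L,
      C1_vector_field K /\ flow_invariant_lagrangian K L,
      [/\ C1_one_form Q, C1_function d
        & forall x v, noether_charge K L x v = Q x v + d x]
    & flow_invariant_function K d /\ forall x, Q x (K x) < 0].

Definition L_c (L : M -> 'rV[R]_n -> R) (K : M -> 'rV[R]_n)
    (Q : M -> {scalar 'rV[R]_n}) (x : M) (v : 'rV[R]_n) : R :=
  L x v - Q x v ^+ 2 / Q x (K x).

Definition condition_G (g : riemannian_metric M) (L : M -> 'rV[R]_n -> R)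
    (K : M -> 'rV[R]_n) (Q : M -> {scalar 'rV[R]_n}) : Prop :=
  growth_condition (gnorm g) (L_c L K Q).

End Lagrangian.

Section LocalStructure.
Context {R : realType} {m n : nat} {S : manifold R m} {M : manifold R n}.

(* The product manifold S x I, with I an open interval, is handled through
   S * R: its charts are (chart of S) x id, and its tangent space at (x, t) is
   'rV[R]_m * R. *)
Definition product_tangent_map (phi : S * R -> M) (x : S) (t : R)
    (nu : 'rV[R]_m) (tau : R) : 'rV[R]_n :=
  'd (fun z : 'rV[R]_m * R =>
        cmap (chart_at (phi (x, t))) (phi (cinv (chart_at x) z.1, z.2)))
     (cmap (chart_at x) x, t) (nu, tau).

(* phi restricts to a C^1 diffeomorphism from S x I onto the open set U. *)
Definition C1_diffeo_onto (I : set R) (U : set M) (phi : S * R -> M) : Prop :=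
  exists theta : M -> S * R,
  [/\ forall z, I z.2 -> U (phi z) /\ theta (phi z) = z,
      forall y, U y -> I (theta y).2 /\ phi (theta y) = y,
      {within [set z : S * R | I z.2], continuous phi} /\
        {within U, continuous theta}
    & forall s c, atlas s -> atlas c ->
      C_on 1 [set z : 'rV[R]_m * R |
               [/\ ccod s z.1, I z.2 & cdom c (phi (cinv s z.1, z.2))]]
        (fun z : 'rV[R]_m * R => cmap c (phi (cinv s z.1, z.2)))
      /\
      C_on 1 [set y : 'rV[R]_n |
               [/\ ccod c y, U (cinv c y) & cdom s (theta (cinv c y)).1]]
        (fun y : 'rV[R]_n =>
           (cmap s (theta (cinv c y)).1, (theta (cinv c y)).2))].

(* Norm of the metric induced by g on S, seen as the hypersurface
   phi (S x {0}). *)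
Definition induced_norm (g : riemannian_metric M) (phi : S * R -> M)
    (x : S) (nu : 'rV[R]_m) : R :=
  gnorm g (phi (x, 0)) (product_tangent_map phi x 0 nu 0).

End LocalStructure.

Definition stationary_product_type_local_structure (R : realType) (m : nat)
    (M : manifold R m.+1) (g : riemannian_metric M) (K : M -> 'rV[R]_m.+1)
    (L : M -> 'rV[R]_m.+1 -> R) : Prop :=
  forall p : M,
  exists (U : set M) (S : manifold R m) (eps : R) (phi : S * R -> M),
  [/\ [/\ open U, precompact U & U p],
      0 < eps /\ C1_diffeo_onto `]- eps, eps[ U phi,
      forall x t, - eps < t < eps ->
        product_tangent_map phi x t 0 1 = K (phi (x, t))
    & exists (L0 : S -> 'rV[R]_m -> R) (omega : S -> {scalar 'rV[R]_m})
             (d beta : S -> R),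
      [/\ C1_TM L0 /\ growth_condition (induced_norm g phi) L0,
          C1_one_form omega,
          C1_function d,
          C1_function beta /\ (forall x, 0 < beta x)
        & forall x t nu tau, - eps < t < eps ->
            L (phi (x, t)) (product_tangent_map phi x t nu tau) =
            L0 x nu + 2 * (omega x nu + d x / 2) * tau - beta x * tau ^+ 2]].

(* Main.v *)
(* In a chart around p, let A parametrize the kernel of Q at p, and send (x, t)
   to the point reached at time t by the flow of K from p + xA.  Since
   Q(K) < 0, the differential of this map at 0 is invertible; hence it is a C^1
   diffeomorphism near 0, which sends d/dt to K.  By invariance of L it is enough
   to expand L at t = 0, and there s |-> L(w + s K) has derivative
   N(w + s K) = Q(w) + d + s Q(K), so it is a quadratic polynomial:
   L(w + s K) = L(w) + (Q(w) + d) s + Q(K) s^2 / 2.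

   On the slice t = 0, L = L_c + Q^2 / Q(K) with Q^2 / Q(K) concave.  But Q
   vanishes on the vectors xA at p, hence is small on them near p, so that this
   term costs at most half of the convexity constant of L_c; the upper bounds of
   (G) are not affected.

   C^1 dependence of the flow on the initial point comes from Picard iteration
   for the linearized equation, combined with a Gronwall estimate. *)
Require Import Defs.
From HB Require Import structures.
From mathcomp Require Import all_boot all_order all_algebra.
From mathcomp Require Import all_classical all_reals all_analysis.
From mathcomp Require Import ring lra.
Import Order.TTheory GRing.Theory Num.Theory numFieldNormedType.Exports.
Set Implicit Arguments.
Unset Strict Implicit.
Unset Printing Implicit Defensive.
Local Open Scope classical_set_scope.
Local Open Scope ring_scope.

(** Tangent vectors are stored by their components in [chart_at x], which may change abruptly with
    [x]; computations are therefore made in the single chart [chart_at p] and carried to and from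
    [M] by [to_chart] and [of_chart]. Likewise [flow] is a choice among the points reached by
    integral curves, so invariance of [L] says nothing about the flow constructed by Picard
    iteration until integral curves on [M] are known to be unique. The slice cannot be an arbitrary
    hypersurface transverse to [K]: [L] is strictly concave along [K], so convexity of [L0] can fail
    when the slice contains directions close to [K]. That no coefficient depends on [t] rests on one
    identity: the differential of the flow carries the field to itself. A vector [(nu, tau)] at time
    [t] is thus the image of [nu *m A + tau *: X] at time 0, and invariance removes the flow. *)

HB.instance Definition _ (R : realType) (m n : nat) := Complete.on 'M[R]_(m, n).

(** * Differentials and C^1 maps *)

Section Calculus.
Context {R : realType}.
Implicit Types (V W : normedModType R).

Lemma row_norm_coord n (x : 'rV[R]_n) i : `|x 0 i| <= `|x|.
Proof. by rewrite [leRHS]/Num.norm/= mx_normrE (le_bigmax _ _ (0, i)). Qed.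

Lemma row_norm_le n (x : 'rV[R]_n) (e : R) :
  0 <= e -> (forall i, `|x 0 i| <= e) -> `|x| <= e.
Proof.
move=> e0 xe; rewrite /Num.norm/= mx_normrE; apply: bigmax_le => // -[i j] _ /=.
by rewrite ord1.
Qed.

(** Differentiability in the epsilon form that Gronwall and mean value estimates deliver. *)
Lemma is_diff_near V W (f : V -> W) x (D : {linear V -> W}) :
  continuous D ->
  (forall e, 0 < e ->
     \forall h \near 0, `|f (h + x) - f x - D h| <= e * `|h|) ->
  is_diff x f D.
Proof.
move=> Dc fD.
have loc : f \o shift x = cst (f x) + D +o_ 0 id.
  apply/eqaddoP => e e0; near=> h.
  rewrite /= /cst opprD addrA.
  by near: h; exact: fD.
have dfD := diff_unique Dc loc.
split=> //; apply/diff_locallyP; rewrite dfD; split => //.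
Unshelve. all: by end_near. Qed.

Lemma near_diff V W (f : V -> W) x : differentiable f x ->
  forall e, 0 < e ->
    \forall h \near 0, `|f (h + x) - f x - 'd f x h| <= e * `|h|.
Proof.
move=> /diff_locally /eqaddoP fx e e0; have := fx _ e0.
by apply: filterS => h /=; rewrite !fctE /= opprD addrA.
Qed.

Lemma derive_coord V n (f : V -> 'rV[R]_n) x v df i :
  is_derive x v f df -> is_derive x v (fun y => f y 0 i) (df 0 i).
Proof.
move=> [fx <-]; split; first exact: (derivable_mxP f x v).1.
by rewrite derive_mx// mxE.
Qed.

Lemma derivable1_continuous V (f : R -> V) (x : R) df :
  is_derive x 1 f df -> {for x, continuous f}.
Proof.
by move=> [/derivable1_diffP fx _]; exact: differentiable_continuous.
Qed.

(** Rows carry the maximum norm, so the scalar mean value theorem applied to each coordinate gives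
    the bound with no loss depending on [n]. *)
Lemma mvt_interval n (A : set R) (f df : R -> 'rV[R]_n) (B : R) :
  is_interval A ->
  (forall t, A t -> is_derive t 1 f (df t)) ->
  (forall t, A t -> `|df t| <= B) ->
  forall s t, A s -> A t -> `|f t - f s| <= B * `|t - s|.
Proof.
move=> Aitv fdf dfB s t.
wlog st : s t / s <= t.
  move=> H As At; have [/H|/ltW/H] := leP s t; first exact.
  by rewrite distrC [X in _ * X]distrC; exact.
move=> As At.
have Au u : u \in `[s, t] -> A u.
  by rewrite in_itv /= => sut; apply: Aitv sut.
apply: row_norm_le => [|i].
  by rewrite mulr_ge0// (le_trans _ (dfB _ As)).
have [||c cst mvt] := @MVT_segment R (fun u => f u 0 i) (fun u => df u 0 i) s t st.
- by move=> u /subset_itv_oo_cc ust; exact/derive_coord/fdf/Au.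
- apply: derivable_within_continuous => u /= ust.
  by have [] := derive_coord i (fdf _ (Au _ ust)).
rewrite !mxE mvt normrM ler_wpM2r//.
by rewrite (le_trans (row_norm_coord _ _))//; exact/dfB/Au.
Qed.

Lemma diff_line V W (f : V -> W) (a v : V) (s : R) :
  differentiable f (a + s *: v) ->
  is_derive s 1 (fun u => f (a + u *: v)) ('d f (a + s *: v) v).
Proof.
move=> fd.
have gd : is_diff s (fun u : R => a + u *: v) (fun u => u *: v).
  have : is_diff s (cst a + (fun u : R => u *: v)) (0 + (fun u : R => u *: v)).
    exact: is_diffD.
  by rewrite add0r.
have cd : differentiable (f \o (fun u : R => a + u *: v)) s.
  by apply: differentiable_comp => //; exact: ex_diff gd.
split; first exact/derivable1_diffP.
transitivity ('D_1 (f \o (fun u : R => a + u *: v)) s) => //; rewrite deriveE//.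
rewrite diff_comp//=.
by rewrite diff_val scale1r.
Qed.

(** The mean value inequality on [[0, 1]] for [f (x + s *: (y - x)) - s *: D (y - x)]. Leaving [D]
    arbitrary allows [D = 'd f a], which is how strict differentiability is obtained. *)
Lemma mvt_ball V n (f : V -> 'rV[R]_n) (D : {linear V -> 'rV[R]_n}) (a : V) (r B : R) :
  (forall x, ball a r x -> differentiable f x) ->
  (forall x v, ball a r x -> `|'d f x v - D v| <= B * `|v|) ->
  forall x y, ball a r x -> ball a r y ->
    `|f y - f x - D (y - x)| <= B * `|y - x|.
Proof.
move=> fd fD x y ax ay.
have inb (s : R) : 0 <= s <= 1 -> ball a r (x + s *: (y - x)).
  move=> /andP[s0 s1]; move: ax ay; rewrite -ball_normE /= => ax ay.
  have -> : a - (x + s *: (y - x)) = (1 - s) *: (a - x) + s *: (a - y).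
    have E : - (a - x) + (a - y) = x - y by rewrite opprB addrA subrK.
    by rewrite scalerBl scale1r -addrA -scalerN -scalerDr E opprD -scalerN opprB addrA.
  rewrite (le_lt_trans (ler_normD _ _))// !normrZ ger0_norm ?subr_ge0//.
  rewrite ger0_norm//; have [->|sn0] := eqVneq s 0.
    by rewrite subr0 mul1r mul0r addr0.
  have sp : 0 < s by rewrite lt0r sn0.
  rewrite (@lt_le_trans _ _ ((1 - s) * r + s * r))// ?ler_ltD//.
    by rewrite ler_wpM2l ?subr_ge0// ltW.
    by rewrite ltr_pM2l.
  by rewrite -mulrDl subrK mul1r.
have I01 : is_interval `[0, 1 : R]%classic by exact: interval_is_interval.
have := @mvt_interval n `[0, 1]%classic (fun s : R => f (x + s *: (y - x)) - s *: D (y - x))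
  (fun s => 'd f (x + s *: (y - x)) (y - x) - D (y - x)) (B * `|y - x|) I01.
move=> /(_ _ _ 0 1) /=; rewrite !in_itv /= !lexx ler01 => /(_ _ _ isT isT).
rewrite subr0 normr1 mulr1 !scale1r [x + (y - x)]addrC subrK
  !scale0r addr0 subr0.
rewrite addrAC; apply.
- move=> s; rewrite in_itv /= => s01.
  have fl := diff_line (fd _ (inb s s01)).
  have sl : is_derive s 1 (fun u : R => u *: D (y - x)) (D (y - x)).
    have sd : differentiable (fun u : R => u *: D (y - x)) s by exact: ex_diff.
    by split; [exact/derivable1_diffP|rewrite deriveE// diff_val scale1r].
  exact: is_deriveB.
- by move=> s; rewrite in_itv /= => s01; exact: fD (inb s s01).
Qed.

End Calculus.

Section C1.
Context {R : realType}.
Implicit Types (V W : normedModType R).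

Lemma near_eq_continuous (T T' : topologicalType) (f g : T -> T') (x : T) :
  (\forall y \near x, f y = g y) -> {for x, continuous f} ->
  {for x, continuous g}.
Proof.
move=> fg fx; have gx := nbhs_singleton fg.
rewrite /prop_for /continuous_at -gx.
by apply: cvg_trans fx; apply: near_eq_cvg; apply: filterS fg.
Qed.

Lemma continuous_pair (T T1 T2 : topologicalType) (f : T -> T1) (g : T -> T2) x :
  {for x, continuous f} -> {for x, continuous g} ->
  {for x, continuous (fun y => (f y, g y))}.
Proof. by move=> fx gx; apply: cvg_pair. Qed.

Lemma near_norm_lt V (x : V) (d : R) :
  `|x| < d -> \forall y \near x, `|y| < d.
Proof.
move=> xd; have := @norm_continuous _ V x [set r | r < d].
by apply; exact: lt_nbhsl.
Qed.

Lemma continuous_distP (T : topologicalType) V (f : T -> V) x :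
  {for x, continuous f} <->
  forall e, 0 < e -> \forall y \near x, `|f x - f y| <= e.
Proof. exact: cvgrPdist_le. Qed.

Lemma near_translate V (x : V) (P : set V) :
  (\forall y \near x, P y) -> \forall h \near (0 : V), P (x + h).
Proof.
rewrite (near_shift 0 x) subr0; apply: filterS => h /=; by rewrite addrC.
Qed.

Lemma near_eq_differentiable V W (f g : V -> W) (x : V) :
  (\forall y \near x, f y = g y) -> differentiable f x ->
  is_diff x g ('d f x).
Proof.
move=> fg fx; apply: is_diff_near; first exact: diff_continuous.
move=> e e0; have fx0 := nbhs_singleton fg.
move: (fg); rewrite (near_shift 0 x) subr0 => fg0.
by near=> h; rewrite -fx0 -(near fg0 h)//; near: h; exact: near_diff.
Unshelve. all: by end_near. Qed.

Lemma open_near (T : topologicalType) (U : set T) x :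
  open U -> U x -> \forall y \near x, U y.
Proof. by move=> oU Ux; exact: open_nbhs_nbhs. Qed.

Lemma C1P V W (U : set V) (f : V -> W) : open U ->
  C_on 1 U f <-> (forall x, U x -> differentiable f x) /\
    (forall v x, U x -> {for x, continuous (fun y => 'd f y v)}).
Proof.
move=> oU; split=> -[fd fc]; split=> // v x Ux.
- apply: near_eq_continuous (fc v x Ux).
  by apply: filterS (open_near oU Ux) => y /fd; exact: deriveE.
- apply: near_eq_continuous (fc v x Ux).
  by apply: filterS (open_near oU Ux) => y /fd fdy; rewrite deriveE.
Qed.

Lemma C_on_congr V W k (U : set V) (f g : V -> W) : open U ->
  (forall x, U x -> f x = g x) -> C_on k U f -> C_on k U g.
Proof.
move=> oU; elim: k f g => [|k IH] f g fg.
  move=> fc x Ux; apply: near_eq_continuous (fc x Ux).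
  by apply: filterS (open_near oU Ux).
have fgn x : U x -> \forall y \near x, f y = g y.
  by move=> Ux; apply: filterS (open_near oU Ux).
move=> [fd fc]; split=> [x Ux|v].
  by have [] := near_eq_differentiable (fgn x Ux) (fd x Ux).
by apply: IH (fc v) => x Ux; apply: near_eq_derive; exact: fgn.
Qed.

Lemma C_on_sub V W k (U U' : set V) (f : V -> W) :
  U' `<=` U -> C_on k U f -> C_on k U' f.
Proof.
move=> U'U; elim: k f => [|k IH] f /=; first by move=> fc x /U'U; exact: fc.
by move=> [fd fc]; split=> [x /U'U|v]; [exact: fd|exact: IH].
Qed.

Lemma C_on_cst V W k (U : set V) (a : W) : C_on k U (cst a).
Proof.
elim: k a => [|k IH] a /=; first by move=> x _; exact: cst_continuous.
split=> [x _|v]; first exact: differentiable_cst.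
by rewrite (_ : 'D_v _ = cst 0)//; apply/funext => x; exact: derive_cst.
Qed.

Lemma C_on_id V k (U : set V) : C_on k U (id : V -> V).
Proof.
case: k => [|k] /=; first by move=> x _; exact: cvg_id.
split=> [x _|v]; first by have [] := is_diff_id x.
rewrite (_ : 'D_v _ = cst v); first exact: C_on_cst.
by apply/funext => x; exact: derive_id.
Qed.

Lemma C1_linear V W (U : set V) (f : {linear V -> W}) : continuous f ->
  C_on 1 U f.
Proof.
move=> fc; split=> [x _|v x _]; first exact: linear_differentiable.
rewrite (_ : 'D_v _ = cst (f v)); first exact: cst_continuous.
apply/funext => y; rewrite deriveE; last exact: linear_differentiable.
by rewrite diff_lin.
Qed.

(** Finite dimension in the weak form that is needed: a finite spanning family with continuous
    coefficients, neither free nor linear. [C_on] controls one direction at a time, and finitely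
    many directions are what turns this into joint continuity. *)
Definition fin_basis V := exists k (e : 'I_k -> V) (c : 'I_k -> V -> R),
  (forall i, continuous (c i)) /\ forall v, v = \sum_i c i v *: e i.

Lemma fin_basis_row n : fin_basis 'rV[R]_n.
Proof.
exists n, (fun i => delta_mx 0 i), (fun i (v : 'rV[R]_n) => v 0 i); split=> [i v|v].
  exact: coord_continuous.
exact: row_sum_delta.
Qed.

Lemma fin_basis_scalar : fin_basis R.
Proof.
exists 1%N, (fun=> 1), (fun=> id); split=> [i v|v]; first exact: cvg_id.
by rewrite big_ord1; exact/esym/mulr1.
Qed.

Lemma fin_basis_prod V W : fin_basis V -> fin_basis W -> fin_basis (V * W)%type.
Proof.
move=> [k [e [c [cc vE]]]] [k' [e' [c' [cc' vE']]]].
exists (k + k')%N, (fun i : 'I_(k + k') => match fintype.split i with inl j => (e j, 0) | inr j => (0, e' j) end),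
  (fun i (v : V * W) => match fintype.split i with inl j => c j v.1 | inr j => c' j v.2 end).
split=> [i v|[v w]].
  case: (fintype.split i) => j; apply: continuous_comp;
    [exact: cvg_fst|exact: cc|exact: cvg_snd|exact: cc'].
rewrite big_split_ord /=.
under eq_bigr do rewrite (unsplitK (inl _)).
under [X in _ + X]eq_bigr do rewrite (unsplitK (inr _)).
rewrite [X in X = _]surjective_pairing; congr pair.
- rewrite /= !(raddf_sum fst)/= -vE.
  by rewrite big1 ?addr0// => i _; rewrite scaler0.
- rewrite /= !(raddf_sum snd)/= -vE'.
  by rewrite big1 ?add0r// => i _; rewrite scaler0.
Qed.

(** The vector is expanded along the finite family, which leaves finitely many terms, each a
    continuous coefficient times a directional differential continuous in the point. *)
Lemma C1_diff_continuous V W (U : set V) (f : V -> W) y w : fin_basis V ->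
  open U -> C_on 1 U f -> U y ->
  {for (y, w), continuous (fun z : V * V => 'd f (z.1) z.2)}.
Proof.
move=> [k [e [c [cc vE]]]] oU /(C1P _ oU)[fd fc] Uy.
rewrite (_ : (fun z : V * V => _) =
    \sum_i (fun z : V * V => c i z.2 *: 'd f (z.1) (e i))); last first.
  apply/funext => -[a b]/=; rewrite fct_sumE {1}[b]vE linear_sum.
  by apply: eq_bigr => i _; rewrite linearZ.
elim/big_ind : _ => [|g h|i _]; first exact: cst_continuous.
  exact: continuousD.
apply: continuousZ.
  by apply: continuous_comp; [exact: cvg_snd|exact: cc].
apply: (@continuous_comp _ _ _ fst (fun a : V => 'd f a (e i))).
  exact: cvg_fst.
exact: fc.
Qed.

Lemma C1_comp V1 V2 W (U1 : set V1) (U2 : set V2) (f : V1 -> V2) (g : V2 -> W) :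
  fin_basis V2 -> open U1 -> open U2 -> C_on 1 U1 f -> C_on 1 U2 g ->
  C_on 1 (U1 `&` f @^-1` U2) (g \o f).
Proof.
move=> bV oU1 oU2 Cf Cg.
have [fd fc] := (C1P f oU1).1 Cf.
have [gd gc] := (C1P g oU2).1 Cg.
split=> [x [Ux Ufx]|v x [Ux Ufx]].
  by apply: differentiable_comp; [exact: fd|exact: gd].
have fcont : {for x, continuous f} by exact/differentiable_continuous/fd.
apply: (@near_eq_continuous _ _ (fun y => 'd g (f y) ('d f y v))).
  near=> y; have Uy : U1 y by near: y; exact: open_near.
  have Ufy : U2 (f y) by near: y; exact: (fcont _ (open_near oU2 Ufx)).
  rewrite deriveE; last by apply: differentiable_comp; [exact: fd|exact: gd].
  by rewrite (diff_comp (fd _ Uy) (gd _ Ufy)).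
apply: (@continuous_comp _ _ _ (fun y => (f y, 'd f y v)) (fun z : V2 * V2 => 'd g (z.1) z.2)).
  by apply: cvg_pair; [exact: fcont|exact: fc].
exact: C1_diff_continuous bV oU2 Cg Ufx.
Unshelve. all: by end_near. Qed.

(** Continuity of the differential on basis vectors makes it nearly constant on a small ball, and
    the mean value inequality turns this into strict differentiability at [a]. The Lipschitz bounds,
    the remainders in the flow estimates and the inverse function theorem all start from it. *)
Lemma C1_strict n p (U : set 'rV[R]_n) (f : 'rV[R]_n -> 'rV[R]_p) a (e : R) :
  open U -> C_on 1 U f -> U a -> 0 < e -> exists2 r : R, 0 < r &
  [/\ ball a r `<=` U,
      forall x v, ball a r x -> `|'d f x v - 'd f a v| <= e * `|v|
    & forall x y, ball a r x -> ball a r y ->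
        `|f y - f x - 'd f a (y - x)| <= e * `|y - x|].
Proof.
move=> oU Cf Ua e0; have [fd fc] := (C1P f oU).1 Cf.
have n0 : 0 < (n%:R + 1 : R) by rewrite ltr_wpDl.
(* A vector is a sum of [n] coordinate vectors, each allowed an error [e / (n + 1)]; the [+ 1]
   covers [n = 0]. *)
have en0 : 0 < e / (n%:R + 1) by rewrite divr_gt0.
have : \forall x \near a, U x /\
    forall i, `|'d f a (delta_mx 0 i) - 'd f x (delta_mx 0 i)| <= e / (n%:R + 1).
  near=> x; split; first by near: x; exact: open_near oU Ua.
  near: x; apply: filter_forall => i.
  by have /cvgrPdist_le/(_ _ en0) := fc (delta_mx 0 i) a Ua.
move=> /nbhs_ballP[r /= r0 ar]; exists r => //.
have fdr x v : ball a r x -> `|'d f x v - 'd f a v| <= e * `|v|.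
  have dE z : 'd f z v = \sum_i v 0 i *: 'd f z (delta_mx 0 i).
    rewrite {1}(row_sum_delta v) linear_sum.
    by apply: eq_bigr => i _; rewrite linearZ.
  move=> /ar[_ xi].
  have -> : 'd f x v - 'd f a v =
      \sum_i v 0 i *: ('d f x (delta_mx 0 i) - 'd f a (delta_mx 0 i)).
    under eq_bigr do rewrite scalerBr.
    by rewrite sumrB; congr (_ - _); exact: dE.
  apply: (le_trans (ler_norm_sum _ _ _)).
  rewrite (@le_trans _ _ (\sum_(i < n) (e / (n%:R + 1) * `|v|)))//.
    apply: ler_sum => i _; rewrite normrZ mulrC.
    apply: ler_pM; [exact: normr_ge0|exact: normr_ge0| |exact: row_norm_coord].
    by rewrite distrC; exact: xi.
  rewrite sumr_const card_ord -[_ *+ n]mulr_natr mulrAC ler_wpM2r//.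
  by rewrite mulrAC ler_pdivrMr// ler_pM2l// lerDl.
split=> //; first by move=> x /ar[].
apply: mvt_ball => // x /ar[Ux _]; exact: fd.
Unshelve. all: by end_near. Qed.

End C1.

(** * Flows of C^1 vector fields *)

Section Estimates.
Context {R : realType}.

(** Since [k < 2 ^ k], some [k] makes [C / 2 ^+ k] smaller than a given [e]; the archimedean bound
    is applied to [C / e], hence the separate case of a nonpositive [C]. *)
Lemma le_halving (x b C : R) : (forall k, x <= C / 2 ^+ k + b) -> x <= b.
Proof.
move=> xk; apply/ler_addgt0Pr => e e0.
have [C0|C0] := lerP C 0.
  rewrite (le_trans (xk 0%N))// addrC lerD2l expr0 divr1.
  by rewrite (le_trans C0)// ltW.
have Ce : 0 <= C / e by rewrite divr_ge0// ltW.
rewrite (le_trans (xk (Num.bound (C / e))))// addrC lerD2l.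
rewrite ler_pdivrMr ?exprn_gt0// mulrC -ler_pdivrMr//.
rewrite (le_trans (ltW (archi_boundP Ce)))// -natrX ler_nat.
by rewrite ltnW// ltn_expl.
Qed.

Lemma is_interval_norm_lt (d : R) : is_interval [set t : R | `|t| < d].
Proof.
move=> a b /=; rewrite !ltr_norml => /andP[a1 _] /andP[_ b1] c /andP[ac cb].
by rewrite ltr_norml (lt_le_trans a1)//= (le_lt_trans cb).
Qed.

Lemma is_interval_norm_le (d : R) : is_interval [set t : R | `|t| <= d].
Proof.
move=> a b /=; rewrite !ler_norml => /andP[a1 _] /andP[_ b1] c /andP[ac cb].
by rewrite ler_norml (le_trans a1)//= (le_trans cb).
Qed.

(* On an interval of length at most 1/(2l), halving the a priori bound
   iteratively replaces the exponential of the usual Gronwall estimate. *)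
Lemma short_gronwall n (e de : R -> 'rV[R]_n) (l d c C : R) :
  0 <= l -> l * d <= 2^-1 -> 0 <= c -> e 0 = 0 ->
  (forall s : R, `|s| < d -> is_derive s 1 e (de s)) ->
  (forall s : R, `|s| < d -> `|de s| <= l * `|e s| + c) ->
  (forall s, `|s| < d -> `|e s| <= C) ->
  forall s : R, `|s| < d -> `|e s| <= 2 * d * c.
Proof.
move=> l0 ld c0 e0 eD deb eC s sd.
have d0 : 0 < d by rewrite (le_lt_trans _ sd).
apply: (@le_halving _ _ C) => k; move: s sd; elim: k => [|k IH] s sd.
  by rewrite expr0 divr1 (le_trans (eC s sd))// lerDl !mulr_ge0// ltW.
have C0 : 0 <= C by rewrite (le_trans _ (eC s sd)).
have Ck0 : 0 <= C / 2 ^+ k by rewrite divr_ge0// exprn_ge0.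
have B t : `|t| < d -> `|de t| <= l * (C / 2 ^+ k + 2 * d * c) + c.
  by move=> td; rewrite (le_trans (deb t td))// lerD2r ler_wpM2l// IH.
have := mvt_interval (@is_interval_norm_lt d) eD B (s := 0) (t := s).
rewrite /= normr0 e0 !subr0 => /(_ d0 sd)/le_trans; apply.
apply: (@le_trans _ _ ((l * (C / 2 ^+ k + 2 * d * c) + c) * d)).
  apply: ler_wpM2l; last exact: ltW.
  by rewrite addr_ge0// mulr_ge0// addr_ge0// !mulr_ge0// ltW.
have -> : C / 2 ^+ k.+1 = 2^-1 * (C / 2 ^+ k) by rewrite exprS invfM mulrCA.
have -> : (l * (C / 2 ^+ k + 2 * d * c) + c) * d =
   (l * d) * (C / 2 ^+ k) + (l * d) * (2 * d * c) + c * d by ring.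
(* [2 * d * c] is the fixed point of [x |-> x / 2 + c * d], the recursion that [l * d <= 1/2]
   produces; the constant of the conclusion comes from here. *)
rewrite [X in _ <= _ + X](_ : _ = 2^-1 * (2 * d * c) + c * d); last by field.
have cd0 : 0 <= 2 * d * c by rewrite !mulr_ge0// ltW.
by rewrite addrA lerD2r lerD// ler_wpM2r.
Qed.

End Estimates.

(** * Primitives of continuous curves, and truncation of time *)

Section Primitive.
Context {R : realType}.

Lemma scalar_primitive (D : R) (g : R -> R) : continuous g ->
  exists G : R -> R, forall t : R, `|t| < D -> is_derive t 1 G (g t).
Proof.
move=> gc.
exists (fun x => \int[lebesgue_measure]_(t in `[- D, x]) g t)%R => t.
rewrite ltr_norml => /andP[Dt tD].
have [] := @continuous_FTC1 R g (BLeft (- D)) t D tD _ _ (gc t).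
- apply: continuous_compact_integrable; first exact: segment_compact.
  exact: continuous_subspaceT.
- by rewrite lte_fin.
- by move=> dF EF; split => //; rewrite -derive1E.
Qed.

(** Chosen by its properties, hence determined only for [|t| < D]. Picard iteration calls it with
    [D = d + 1] at times truncated to [[-d, d]], where it is safe. *)
Definition primitive n (D : R) (g : R -> 'rV[R]_n) : R -> 'rV[R]_n :=
  xget 0 [set G | G 0 = 0 /\ forall t : R, `|t| < D -> is_derive t 1 G (g t)].

Lemma is_derive_row (V : normedModType R) n (f : V -> 'rV[R]_n) (x v : V) (df : 'rV[R]_n) :
  (forall i, is_derive x v (fun y => f y 0 i) (df 0 i)) -> is_derive x v f df.
Proof.
move=> fi; have fd : derivable f x v.
  by apply/derivable_mxP => i j; rewrite ord1; have [] := fi j.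
split=> //; rewrite derive_mx//; apply/rowP => i; rewrite mxE.
by have [_ ->] := fi i.
Qed.

Lemma primitiveP n (D : R) (g : R -> 'rV[R]_n) : continuous g ->
  primitive D g 0 = 0 /\
  forall t : R, `|t| < D -> is_derive t 1 (primitive D g) (g t).
Proof.
move=> gc; rewrite /primitive; set P := [set G | _].
suff : P (xget 0 P) by []; apply: xgetPex.
have gic i : continuous (fun t => g t 0 i).
  move=> t; apply: (@continuous_comp _ _ _ g (fun x : 'rV[R]_n => x 0 i)).
    exact: gc.
  exact: coord_continuous.
have /choice[G GP] := fun i => scalar_primitive D (gic i).
exists (fun t => \row_i (G i t - G i 0)); split.
  by apply/rowP => i; rewrite !mxE subrr.
move=> t tD; apply: is_derive_row => i.
rewrite (_ : (fun y => _) = G i - cst (G i 0)); last first.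
  by apply/funext => y; rewrite mxE.
by rewrite -[g t 0 i]subr0; apply: is_deriveB; [exact: GP].
Qed.

(** For [0 <= d], the retraction of the line onto [[-d, d]]. Composition with it makes functions
    controlled only for short times total and continuous. *)
Definition clamp (d t : R) := Num.max (- d) (Num.min t d).

Lemma clamp_id (d t : R) : `|t| <= d -> clamp d t = t.
Proof.
by rewrite ler_norml /clamp => /andP[dt td]; rewrite min_l// max_r.
Qed.

Lemma clamp_norm (d t : R) : 0 <= d -> `|clamp d t| <= d.
Proof.
move=> d0; rewrite ler_norml /clamp le_max lexx /= ge_max ge_min lexx orbT.
by rewrite (le_trans _ d0)// oppr_le0.
Qed.

Lemma clamp_lipschitz (d s t : R) : `|clamp d s - clamp d t| <= `|s - t|.
Proof.
wlog st : s t / s <= t.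
  by move=> H; have [/H//|/ltW/H] := leP s t; rewrite distrC [leRHS]distrC.
rewrite distrC [leRHS]distrC (ger0_norm (_ : 0 <= t - s)) ?subr_ge0//.
by rewrite ger0_norm /clamp !maxEle !minEle; repeat case: ifPn;
  rewrite -?ltNge => *; lra.
Qed.

Lemma nonexpansive_continuous (V W : normedModType R) (f : V -> W) :
  (forall x y, `|f x - f y| <= `|x - y|) -> continuous f.
Proof.
move=> fL x; apply/cvgrPdist_le => e e0.
have /cvgrPdist_le/(_ _ e0) := @cvg_id _ (nbhs x).
by apply: filterS => y; apply: le_trans.
Qed.

Lemma clamp_continuous (d : R) : continuous (clamp d).
Proof. exact/nonexpansive_continuous/clamp_lipschitz. Qed.

End Primitive.

Section Halving.
Context {R : realType} {n : nat}.

Lemma halving_dist (u : nat -> 'rV[R]_n) (C : R) :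
  (forall k, `|u k.+1 - u k| <= C / 2 ^+ k) ->
  forall k j, `|u (k + j)%N - u k| <= 2 * C / 2 ^+ k.
Proof.
move=> uC k j.
have C0 : 0 <= C by have := uC 0%N; rewrite expr0 divr1; exact: le_trans.
(* The right-hand side is the exact sum of [C / 2 ^+ i] for [i] from [k] to [k + j - 1], which the
   induction on [j] preserves. *)
suff : `|u (k + j)%N - u k| <= C / 2 ^+ k * (2 - 2 / 2 ^+ j).
  move/le_trans; apply.
  rewrite [leRHS](_ : _ = C / 2 ^+ k * 2); last by ring.
  rewrite ler_wpM2l ?divr_ge0 ?exprn_ge0//.
  by rewrite gerBl divr_ge0// exprn_ge0.
elim: j => [|j IH].
  by rewrite addn0 subrr normr0 expr0 divr1 subrr mulr0.
rewrite addnS (_ : _ - _ = (u (k + j).+1 - u (k + j)%N) + (u (k + j)%N - u k)).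
  rewrite (le_trans (ler_normD _ _))//.
  apply: le_trans (lerD (uC (k + j)%N) IH) _.
  rewrite exprD exprS.
  have k0 : (2 : R) ^+ k != 0 by rewrite expf_neq0.
  have j0 : (2 : R) ^+ j != 0 by rewrite expf_neq0.
  rewrite le_eqVlt; apply/orP; left; apply/eqP; field.
  by rewrite k0 j0.
by rewrite addrA subrK.
Qed.

Lemma halving_limit (u : nat -> 'rV[R]_n) (C : R) :
  (forall k, `|u k.+1 - u k| <= C / 2 ^+ k) ->
  exists l, forall k, `|l - u k| <= 2 * C / 2 ^+ k.
Proof.
move=> uC; have uB := halving_dist uC.
have C0 : 0 <= C by have := uC 0%N; rewrite expr0 divr1; exact: le_trans.
have /cvg_ex[l ul] : cvg (u @ \oo).
  apply/cauchy_cvgP; apply: cauchy_exP => e e0.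
  have Ce : 0 <= 2 * C / e by rewrite divr_ge0 ?mulr_ge0// ltW.
  exists (u (Num.bound (2 * C / e))); exists (Num.bound (2 * C / e)) => // k /= kN.
  rewrite -ball_normE /= distrC -(subnKC kN) (le_lt_trans (uB _ _))//.
  rewrite ltr_pdivrMr ?exprn_gt0// [ltRHS]mulrC -ltr_pdivrMr//.
  rewrite (lt_trans (archi_boundP Ce))// -natrX ltr_nat.
  exact: ltn_expl.
exists l => k; apply/ler_addgt0Pr => e e0.
have /cvgrPdist_le/(_ _ e0)[N _ lN] := ul.
have := lN (k + N)%N (leq_addl _ _) => /= lkN.
rewrite (_ : l - u k = (u (k + N)%N - u k) + (l - u (k + N)%N)).
  by rewrite (le_trans (ler_normD _ _))// lerD.
by rewrite [RHS]addrC addrA subrK.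
Qed.

(** The rate is the same at all points, so this is the usual [e / 3] argument for a uniform
    limit. *)
Lemma halving_continuous (T : topologicalType) (u : nat -> T -> 'rV[R]_n)
    (w : T -> 'rV[R]_n) (C : R) :
  (forall k, continuous (u k)) ->
  (forall k x, `|w x - u k x| <= C / 2 ^+ k) -> continuous w.
Proof.
move=> uc wu x; apply/cvgrPdist_le => e e0.
have [C0|C0] := lerP C 0.
  near=> y.
  have eq z : w z = u 0%N z.
    apply/eqP; rewrite -subr_eq0 -normr_le0 (le_trans (wu 0%N z))//.
    by rewrite expr0 divr1.
  rewrite !eq; near: y; apply: (cvgrPdist_le _ _).1 => //; exact: uc.
have Ce : 0 <= C / (e / 3) by rewrite divr_ge0 ?ltW// divr_gt0.
pose k := Num.bound (C / (e / 3)).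
have ke : C / 2 ^+ k <= e / 3.
  rewrite ler_pdivrMr ?exprn_gt0// mulrC -ler_pdivrMr ?divr_gt0//.
  rewrite (le_trans (ltW (archi_boundP Ce)))// -natrX ler_nat ltnW//.
  exact: ltn_expl.
have e3 : 0 < e / 3 by rewrite divr_gt0.
near=> y.
rewrite (_ : w x - w y = (w x - u k x) + (u k x - u k y) + (u k y - w y)).
  rewrite (le_trans (ler_normD _ _))// (_ : e = e / 3 + e / 3 + e / 3); last by field.
  rewrite lerD//; last by rewrite distrC (le_trans (wu k y)).
  rewrite (le_trans (ler_normD _ _))// lerD//; first by rewrite (le_trans (wu k x)).
  near: y; apply: (cvgrPdist_le _ _).1 => //; exact: uc.
by rewrite -addrA [X in _ = _ + X]addrA subrK addrA subrK.
Unshelve. all: by end_near. Qed.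

End Halving.

(** * Picard iteration with a parameter *)

Section Picard.
Context {R : realType} {n : nat}.
Local Notation E := 'rV[R]_n.

Lemma continuous_slice (A B C : topologicalType) (f : A * B -> C) (a : A) :
  continuous f -> continuous (fun b => f (a, b)).
Proof.
move=> fc b; apply: (@continuous_comp _ _ _ (fun b => (a, b)) f); last exact: fc.
by apply: cvg_pair; [exact: cvg_cst|exact: cvg_id].
Qed.

Lemma primitive_dist (D d B : R) (g h : R -> E) : d < D ->
  continuous g -> continuous h ->
  (forall s : R, `|s| <= d -> `|g s - h s| <= B) ->
  forall t : R, `|t| <= d ->
    `|primitive D g t - primitive D h t| <= B * `|t|.
Proof.
move=> dD gc hc ghB t td.
have [g0 gP] := primitiveP D gc; have [h0 hP] := primitiveP D hc.
have := @mvt_interval R n [set s : R | `|s| <= d]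
  (primitive D g - primitive D h) (g \- h) B (@is_interval_norm_le _ d).
move=> /(_ _ _ 0 t); rewrite /= !fctE g0 h0 !subr0; apply.
- by move=> s /= sd; apply: is_deriveB; [apply: gP|apply: hP];
    exact: le_lt_trans dD.
- by move=> s /ghB.
- by rewrite normr0 (le_trans _ td).
- exact: td.
Qed.

Lemma primitive_continuous (X : topologicalType) (G : X -> R -> E) (d : R) :
  0 < d -> continuous (fun z : X * R => G z.1 z.2) ->
  continuous (fun z : X * R => primitive (d + 1) (G z.1) (clamp d z.2)).
Proof.
move=> d0 Gc [x0 t0]; apply/cvgrPdist_le => /= e e0.
have dd1 : d < d + 1 by rewrite ltrDl.
have Gxc x : continuous (G x) by exact: (continuous_slice (a := x) Gc).
have e2 : 0 < e / 2 by rewrite divr_gt0.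
(* Integrands within [h] of each other have primitives within [h * d = e / 2] on [[-d, d]]; the
   other [e / 2] is spent on the variation in time. *)
pose h := e / 2 / d.
have h0 : 0 < h by rewrite divr_gt0.
have h2 : 0 < h / 2 by rewrite divr_gt0.
(* Compactness of [[-d, d]] makes the closeness of [G x] to [G x0] uniform in time. *)
have unif : \forall x \near x0, `[- d, d]%classic `<=` (fun s => `|G x0 s - G x s| <= h).
  apply: (@compact_near_coveringP _ `[- d, d]%classic).1 => [|s _].
    exact: segment_compact.
  have /cvgrPdist_le/(_ _ h2)[[P Q] /= [Ps Qs] PQ] := Gc (x0, s).
  exists (Q, P) => //= -[s' x'] /= [Qs' Px'].
  have Gs' : `|G x0 s - G x0 s'| <= h / 2.
    by apply: (PQ (x0, s')); split => //=; exact: nbhs_singleton.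
  have Gxs' : `|G x0 s - G x' s'| <= h / 2 by apply: (PQ (x', s')); split.
  rewrite (_ : _ - _ = (G x0 s - G x' s') - (G x0 s - G x0 s')).
    by rewrite (le_trans (ler_normB _ _))// (splitr h) lerD.
  by rewrite opprB [RHS]addrC addrA subrK.
have pc : {for t0, continuous (fun t => primitive (d + 1) (G x0) (clamp d t))}.
  apply: (@continuous_comp _ _ _ (clamp d) (primitive (d + 1) (G x0))).
    exact: clamp_continuous.
  apply: derivable1_continuous; apply: (primitiveP (d + 1) (Gxc x0)).2.
  by rewrite (le_lt_trans (clamp_norm _ (ltW d0))).
have /cvgrPdist_le/(_ _ e2) pct := pc.
near=> z.
have G1 : `[- d, d]%classic `<=` (fun s => `|G x0 s - G z.1 s| <= h).
  by near: z; exact: (cvg_fst unif).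
have G2 : `|primitive (d + 1) (G x0) (clamp d t0) - primitive (d + 1) (G x0) (clamp d z.2)| <= e / 2.
  by near: z; exact: (cvg_snd pct).
rewrite (_ : _ - _ =
   (primitive (d + 1) (G x0) (clamp d t0) - primitive (d + 1) (G x0) (clamp d z.2)) +
   (primitive (d + 1) (G x0) (clamp d z.2) - primitive (d + 1) (G z.1) (clamp d z.2))); last first.
  by rewrite addrA subrK.
rewrite (le_trans (ler_normD _ _))// (splitr e) lerD//.
have cd := clamp_norm z.2 (ltW d0).
have := @primitive_dist (d + 1) d h _ _ dd1 (Gxc x0) (Gxc z.1) _ _ cd.
move=> /(_ _)/le_trans; apply => [s sd|].
  by apply: G1; rewrite /= in_itv /= -ler_norml.
by rewrite (le_trans (ler_wpM2l (ltW h0) cd))// /h divfK// gt_eqF.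
Unshelve. all: by end_near. Qed.

Fixpoint picard_iterate (X : Type) (f : X -> R -> E -> E) (d : R) (k : nat)
    (x : X) (t : R) : E :=
  if k is k'.+1
  then primitive (d + 1) (fun s => f x s (picard_iterate f d k' x s)) (clamp d t)
  else 0.

(** As [l * d <= 1/2], successive iterates get twice closer at each step, uniformly in the
    parameter, so the limit is jointly continuous in [(x, t)]. The parameter will be the starting
    point, for the flow and for its linearization alike; the final bound is the sum of the series
    [B * d / 2 ^+ k]. *)
Lemma picard (X : topologicalType) (f : X -> R -> E -> E) (l B d : R) :
  0 < d -> 0 <= l -> l * d <= 2^-1 ->
  continuous (fun z : X * R * E => f z.1.1 z.1.2 z.2) ->
  (forall x s a b, `|f x s a - f x s b| <= l * `|a - b|) ->
  (forall x s, `|f x s 0| <= B) ->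
  exists u : X -> R -> E,
  [/\ continuous (fun z : X * R => u z.1 z.2),
      forall x, u x 0 = 0,
      forall x (t : R), `|t| < d -> is_derive t 1 (u x) (f x t (u x t))
    & forall x t, `|u x t| <= 2 * (B * d)].
Proof.
move=> d0 l0 ld fc fl fB; pose v := picard_iterate f d.
have dd1 : d < d + 1 by rewrite ltrDl.
have subc (w : X -> R -> E) : continuous (fun z : X * R => w z.1 z.2) ->
    continuous (fun z : X * R => f z.1 z.2 (w z.1 z.2)).
  move=> wc z.
  apply: (@continuous_comp _ _ _ (fun z : X * R => (z, w z.1 z.2))
    (fun z : X * R * E => f z.1.1 z.1.2 z.2)); last exact: fc.
  by apply: continuous_pair; [exact: cvg_id|exact: wc].
have subc1 (w : X -> R -> E) x : continuous (fun z : X * R => w z.1 z.2) ->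
    continuous (fun s => f x s (w x s)).
  by move=> /subc/(continuous_slice (a := x)).
have vc k : continuous (fun z : X * R => v k z.1 z.2).
  elim: k => [|k IH]; first exact: cst_continuous.
  exact: (@primitive_continuous X (fun x s => f x s (v k x s)) d d0 (subc _ IH)).
(* [X] may be empty, so the sign of [B] is only available in the presence of a point. *)
have B0 (x : X) : 0 <= B by rewrite (le_trans _ (fB x 0)).
have vstep k x t : `|v k.+1 x t - v k x t| <= B * d / 2 ^+ k.
  elim: k x t => [|k IH] x t.
    have := @primitive_dist (d + 1) d B (fun s => f x s (v 0%N x s)) (cst 0) dd1
      (subc1 _ x (vc 0%N)) (@cst_continuous _ _ 0).
    move=> /(_ _ (clamp d t) (clamp_norm t (ltW d0))) H.
    (* [primitive] is a mere choice, so even the primitive of 0 has to be identified, by the mean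
       value inequality. *)
    have P0 : primitive (d + 1) (cst 0 : R -> E) (clamp d t) = 0.
      have [p0 pD] := primitiveP (d + 1) (@cst_continuous R E 0).
      have := @mvt_interval R n [set s : R | `|s| < d + 1] _ _ 0 (@is_interval_norm_lt _ _) pD.
      move=> /(_ _ 0 (clamp d t)); rewrite p0 subr0 mul0r => q.
      apply/eqP; rewrite -normr_le0. apply: q => /=.
      - by move=> *; rewrite normr0.
      - by rewrite normr0 addr_gt0.
      - by rewrite (le_lt_trans (clamp_norm _ (ltW d0))).
    rewrite P0 in H.
    rewrite expr0 divr1 (le_trans (H _))//.
      by move=> s _; rewrite subr0 /v /= fB.
    by rewrite ler_wpM2l ?(B0 x)// clamp_norm// ltW.
  have := @primitive_dist (d + 1) d (l * (B * d / 2 ^+ k)) _ _ dd1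
    (subc1 _ x (vc k.+1)) (subc1 _ x (vc k)).
  move=> /(_ _ (clamp d t) (clamp_norm t (ltW d0)))/le_trans; apply.
    by move=> s _; rewrite (le_trans (fl _ _ _ _))// ler_wpM2l.
  have Bk : 0 <= B * d / 2 ^+ k by rewrite !mulr_ge0 ?(B0 x)// ?invr_ge0 ?exprn_ge0 ?ltW.
  apply: (@le_trans _ _ (l * (B * d / 2 ^+ k) * d)).
    by apply: ler_wpM2l; [exact: mulr_ge0|exact/clamp_norm/ltW].
  rewrite mulrAC (_ : B * d / 2 ^+ k.+1 = 2^-1 * (B * d / 2 ^+ k)).
    by rewrite ler_wpM2r.
  by rewrite exprS invfM mulrCA.
have /choice[u uv] : forall z : X * R, exists a : E, forall k,
    `|a - v k z.1 z.2| <= 2 * (B * d) / 2 ^+ k.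
  by move=> z; apply: halving_limit => k; exact: vstep.
have uc : continuous u.
  by apply: (halving_continuous vc) => k z; exact: uv.
pose w x t := u (x, t).
have wc : continuous (fun z : X * R => w z.1 z.2).
  by rewrite (_ : (fun z => _) = u)//; apply/funext => -[].
(* The fixed-point equation: [w] and its image under the Picard operator are each within half of
   [2 * (B * d) / 2 ^+ k] of the iterate [k.+1], for every [k]. *)
have wE x t : w x t = primitive (d + 1) (fun s => f x s (w x s)) (clamp d t).
  apply/eqP; rewrite -subr_eq0 -normr_le0.
  apply: (@le_halving _ _ _ (2 * (B * d))) => k; rewrite addr0.
  set p := primitive _ _ _.
  have -> : w x t - p = (w x t - v k.+1 x t) + (v k.+1 x t - p) by rewrite addrA subrK.
  have half : 2 * (B * d) / 2 ^+ k.+1 = 2^-1 * (2 * (B * d) / 2 ^+ k).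
    by rewrite exprS invfM mulrCA.
  rewrite (le_trans (ler_normD _ _))//.
  rewrite [leRHS](_ : _ = 2^-1 * (2 * (B * d) / 2 ^+ k) + 2^-1 * (2 * (B * d) / 2 ^+ k)); last first.
    by field; rewrite expf_neq0.
  apply: lerD; first by rewrite -half; exact: (uv (x, t) k.+1).
  have := @primitive_dist (d + 1) d (l * (2 * (B * d) / 2 ^+ k)) _ _ dd1
    (subc1 _ x (vc k)) (subc1 _ x wc).
  move=> /(_ _ (clamp d t) (clamp_norm t (ltW d0)))/le_trans; apply.
    move=> s _; rewrite (le_trans (fl _ _ _ _))// ler_wpM2l// distrC.
    exact: (uv (x, s) k).
  have Bk : 0 <= 2 * (B * d) / 2 ^+ k.
    by rewrite !mulr_ge0 ?(B0 x)// ?invr_ge0 ?exprn_ge0 ?ltW.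
  apply: (@le_trans _ _ (l * (2 * (B * d) / 2 ^+ k) * d)).
    by apply: ler_wpM2l; [exact: mulr_ge0|exact/clamp_norm/ltW].
  by rewrite mulrAC ler_wpM2r.
exists w; split=> //.
- move=> x; rewrite wE clamp_id ?normr0 ?ltW//.
  exact: (primitiveP _ (subc1 _ x wc)).1.
- move=> x t td.
  apply: (near_eq_is_derive (f := primitive (d + 1) (fun s => f x s (w x s)))).
    near=> s; rewrite wE clamp_id// ltW//; near: s.
    exact: (@near_norm_lt R R t d td).
  by apply: (primitiveP _ (subc1 _ x wc)).2; rewrite (lt_trans td).
- by move=> x t; have := uv (x, t) 0%N; rewrite /= subr0 expr0 divr1.
Unshelve. all: by end_near. Qed.

End Picard.

Section Clamp.
Context {R : realType} {n : nat}.
Local Notation E := 'rV[R]_n.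

(** Coordinatewise retraction onto the closed ball of radius [r] about [a]. For the maximum norm it
    is 1-Lipschitz, so composition with it extends a field that is Lipschitz on a ball to a globally
    Lipschitz one. *)
Definition row_clamp (a : E) (r : R) (x : E) : E :=
  a + \row_i clamp r ((x - a) 0 i).

Lemma row_clamp_id a r x : `|x - a| <= r -> row_clamp a r x = x.
Proof.
move=> xa; rewrite /row_clamp; apply/rowP => i.
rewrite [in LHS]mxE [(\row__ _) 0 i]mxE clamp_id.
  by rewrite !mxE addrC subrK.
exact: le_trans (row_norm_coord _ _) xa.
Qed.

Lemma row_clamp_norm a r x : 0 <= r -> `|row_clamp a r x - a| <= r.
Proof.
move=> r0; rewrite /row_clamp addrC addKr; apply: row_norm_le => // i.
by rewrite mxE; exact: clamp_norm.
Qed.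

Lemma row_clamp_lipschitz a r x y :
  `|row_clamp a r x - row_clamp a r y| <= `|x - y|.
Proof.
rewrite /row_clamp opprD addrACA subrr add0r; apply: row_norm_le => // i.
rewrite !mxE.
apply: (le_trans (clamp_lipschitz _ _ _)).
rewrite (_ : _ - _ = (x - y) 0 i); first exact: row_norm_coord.
by rewrite !mxE; ring.
Qed.

Lemma row_clamp_continuous a r : continuous (row_clamp a r).
Proof. exact/nonexpansive_continuous/row_clamp_lipschitz. Qed.

End Clamp.

Section Derivation.
Context {R : realType}.

Lemma is_derive_chain (V W : normedModType R) (f : R -> V) (g : V -> W) (t : R) v :
  is_derive t 1 f v -> differentiable g (f t) ->
  is_derive t 1 (g \o f) ('d g (f t) v).
Proof.
move=> [fd <-] gd; have fd' : differentiable f t by exact/derivable1_diffP.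
have cd : differentiable (g \o f) t by exact: differentiable_comp.
split; first exact/derivable1_diffP.
by rewrite deriveE// deriveE// diff_comp.
Qed.

Lemma is_derive_translate (W : normedModType R) (f : R -> W) (a t : R) (v : W) :
  is_derive (a + t) 1 f v -> is_derive t 1 (fun s => f (a + s)) v.
Proof.
move=> [fd <-]; have fd' : differentiable f (a + t) by exact/derivable1_diffP.
have sd : is_derive t 1 (fun s : R => a + s) 1.
  rewrite -[X in is_derive _ _ _ X]add0r.
  exact: is_deriveD (is_derive_cst a t 1) (is_derive_id t 1).
by rewrite deriveE//; exact: (is_derive_chain (f := fun s => a + s) (g := f)).
Qed.

Lemma is_derive_line (W : normedModType R) (w : W) (t : R) :
  is_derive t 1 (fun s : R => s *: w) w.
Proof.
have sd : differentiable (fun s : R => s *: w) t by exact: ex_diff.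
by split; [exact/derivable1_diffP|rewrite deriveE// diff_val scale1r].
Qed.

End Derivation.

(** * The local flow of a C^1 field in R^n and its C^1 dependence on the starting point *)

Section LocalFlow.
Context {R : realType} {n : nat}.
Local Notation E := 'rV[R]_n.
Context (X : E -> E) (y0 : E) (r l : R) (r0 : 0 < r) (l0 : 0 < l)
  (XC : C_on 1 (ball y0 r) X)
  (XL : forall x y, ball y0 r x -> ball y0 r y -> `|X x - X y| <= l * `|x - y|)
  (XD : forall x v, ball y0 r x -> `|'d X x v| <= l * `|v|).

(** [B] bounds [X] on the ball. In [d], the term [2^-1 / l] is the contraction condition, and
    [r / (8 * (B + 1))] keeps the displacement bound [2 * (B * d)] of [picard] below [r / 4]. Orbits
    issued from the ball of radius [r / 4] then stay within [r / 2] of [y0], where the truncation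
    [rho] is the identity. *)
Let B := `|X y0| + l * r.
Let d := Num.min (2^-1 / l) (r / (8 * (B + 1))).
Let rho := row_clamp y0 (r / 2).

Let B0 : 0 <= B. Proof. by rewrite addr_ge0// mulr_ge0// ltW. Qed.

Let B1 : 0 < 8 * (B + 1). Proof. by rewrite mulr_gt0// ltr_wpDl. Qed.

Let d0 : 0 < d.
Proof. by rewrite lt_min !divr_gt0. Qed.

Let ld : l * d <= 2^-1.
Proof. by rewrite mulrC -ler_pdivlMr// /d ge_min lexx. Qed.

Let Bd : 2 * (B * d) <= r / 4.
Proof.
have : d <= r / (8 * (B + 1)) by rewrite /d ge_min lexx orbT.
rewrite ler_pdivlMr// => dB.
have := mulr_ge0 B0 (ltW d0); have := d0; lra.
Qed.

Let rho_ball x : ball y0 r (rho x).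
Proof.
rewrite -ball_normE /= distrC.
rewrite (le_lt_trans (row_clamp_norm _ _ _))// ?divr_ge0// ?ltW//.
by rewrite ltr_pdivrMr// ltr_pMr// ltr1n.
Qed.

Let oB : open (ball y0 r).
Proof. exact: ball_open. Qed.

Let Xd x : ball y0 r x -> differentiable X x.
Proof. by move=> xr; have [+ _] := XC; apply. Qed.

Let Xc : continuous (X \o rho).
Proof.
move=> x; apply: continuous_comp; first exact: row_clamp_continuous.
exact/differentiable_continuous/Xd.
Qed.

(** The unknown given to [picard] is the displacement [Phi y t - y], for the truncated field, which
    makes sense from every starting point. *)
Lemma flow_exists : exists Phi : E -> R -> E,
  [/\ continuous (fun z : E * R => Phi z.1 z.2),
      forall y, Phi y 0 = y,
      forall y (t : R), `|t| < d -> is_derive t 1 (Phi y) (X (rho (Phi y t)))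
    & forall y t, `|Phi y t - y| <= r / 4].
Proof.
have [|||y t a b|y t|u [uc u00 uD uB]] :=
  @picard R n E (fun y _ x => X (rho (y + x))) l B d d0.
- exact: ltW.
- exact: ld.
- move=> z.
  apply: (@continuous_comp _ _ _ (fun z : E * R * E => z.1.1 + z.2) (X \o rho)).
    apply: continuousD; last exact: cvg_snd.
    apply: (@continuous_comp _ _ _ (fun z : E * R * E => z.1) fst); exact: cvg_fst.
  exact: Xc.
- rewrite (le_trans (XL (rho_ball _) (rho_ball _)))// ler_pM2l//.
  rewrite (le_trans (row_clamp_lipschitz _ _ _ _))//.
  by rewrite opprD addrACA subrr add0r.
- have -> : X (rho (y + 0)) = X y0 + (X (rho (y + 0)) - X y0).
    by rewrite [RHS]addrC subrK.
  rewrite (le_trans (ler_normD _ _))// lerD2l.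
  rewrite (le_trans (XL (rho_ball _) (ballxx _ r0)))// ler_pM2l//.
  have := rho_ball (y + 0); rewrite -ball_normE /= distrC; exact: ltW.
exists (fun y t => y + u y t); split.
- by move=> z; apply: continuousD; [exact: cvg_fst|exact: uc].
- by move=> y; rewrite u00 addr0.
- move=> y t td; rewrite -[X (rho _)]add0r.
  exact: is_deriveD (is_derive_cst _ _ _) (uD y t td).
- by move=> y t; rewrite addrC addrA addNr add0r (le_trans (uB y t)).
Qed.

(** The equation is solved for each basis vector, with unknown [W y t (e i) - e i], and extended
    linearly in [k]: linearity of [W y t] is built in and needs no uniqueness argument. *)
Lemma linearized_flow_exists (Phi : E -> R -> E) :
  continuous (fun z : E * R => Phi z.1 z.2) ->
  exists W : E -> R -> E -> E,
  [/\ forall k, continuous (fun z : E * R => W z.1 z.2 k),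
      forall y t, linear (W y t),
      forall y k, W y 0 k = k,
      forall y k (t : R), `|t| < d ->
        is_derive t 1 (fun s => W y s k) ('d X (rho (Phi y t)) (W y t k))
    & exists M, 0 <= M /\ forall y t k, `|W y t k| <= M * `|k|].
Proof.
move=> Phic; pose e i : E := delta_mx 0 i.
have /choice[w wP] : forall i : 'I_n, exists u : E -> R -> E,
  [/\ continuous (fun z : E * R => u z.1 z.2),
      forall x, u x 0 = 0,
      forall x (t : R), `|t| < d ->
        is_derive t 1 (u x) ('d X (rho (Phi x t)) (e i + u x t))
    & forall x t, `|u x t| <= 2 * (l * `|e i| * d)].
  move=> i.
  apply: (@picard R n E (fun y s x => 'd X (rho (Phi y s)) (e i + x)) l
    (l * `|e i|) d d0).
  - exact: ltW.
  - exact: ld.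
  - move=> z.
    apply: (@continuous_comp _ _ _ (fun z : E * R * E => (rho (Phi z.1.1 z.1.2), e i + z.2))
      (fun q : E * E => 'd X (q.1) q.2)).
      apply: continuous_pair.
        apply: (@continuous_comp _ _ _ (fun z : E * R * E => Phi z.1.1 z.1.2) rho).
          apply: (@continuous_comp _ _ _ fst (fun z : E * R => Phi z.1 z.2)).
            exact: cvg_fst.
          exact: Phic.
        exact: row_clamp_continuous.
      by apply: continuousD; [exact: cst_continuous|exact: cvg_snd].
    exact: (C1_diff_continuous (fin_basis_row n) oB XC (rho_ball _)).
  - move=> y s a b; rewrite -linearB opprD addrACA subrr add0r.
    exact: XD.
  - by move=> y s; rewrite addr0; exact: XD.
exists (fun y t k => \sum_i k 0 i *: (e i + w i y t)); split.
- move=> k z; rewrite (_ : (fun z : E * R => _) =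
    \sum_i (fun z : E * R => k 0 i *: (e i + w i z.1 z.2))); last first.
    by apply/funext => q; rewrite fct_sumE.
  elim/big_ind : _ => [|g h|i _]; first exact: cst_continuous.
    exact: continuousD.
  apply: (continuousZ (s := fun _ : E * R => k 0 i)
    (f := fun q : E * R => e i + w i q.1 q.2)); first exact: cst_continuous.
  apply: continuousD; first exact: cst_continuous.
  by have [+ _ _ _] := wP i; apply.
- move=> y t a u v; rewrite scaler_sumr -big_split; apply: eq_bigr => i _ /=.
  by rewrite !mxE scalerA -scalerDl.
- move=> y k; rewrite [RHS]row_sum_delta; apply: eq_bigr => i _.
  by have [_ -> _ _] := wP i; rewrite addr0.
- move=> y k t td.
  have -> : 'd X (rho (Phi y t)) (\sum_i k 0 i *: (e i + w i y t)) =
      \sum_i k 0 i *: (0 + 'd X (rho (Phi y t)) (e i + w i y t)).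
    by rewrite linear_sum; apply: eq_bigr => i _; rewrite linearZ add0r.
  rewrite (_ : (fun s => _) = \sum_i k 0 i *: (cst (e i) + w i y)); last first.
    by apply/funext => s; rewrite fct_sumE.
  have wiD i : is_derive t 1 (k 0 i *: (cst (e i) + w i y))
      (k 0 i *: (0 + 'd X (rho (Phi y t)) (e i + w i y t))).
    have [_ _ /(_ y t td) wD _] := wP i.
    exact: (is_deriveZ (k 0 i) (is_deriveD (is_derive_cst (e i) t 1) wD)).
  exact: (is_derive_sum wiD).
- exists (\sum_i (`|e i| + 2 * (l * `|e i| * d))); split.
    by apply: sumr_ge0 => i _; rewrite addr_ge0// !mulr_ge0// ltW.
  move=> y t k; rewrite mulr_suml (le_trans (ler_norm_sum _ _ _))//.
  apply: ler_sum => i _; rewrite normrZ mulrC ler_pM ?row_norm_coord//.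
  rewrite (le_trans (ler_normD _ _))// lerD2l.
  by have [_ _ _ ->] := wP i.
Qed.

(** The differential at [(y, t)] is [(k, s) |-> W y t k + s *: X (Phi y t)], proved by comparing
    [Phi (y + k) - Phi y] with [W y t k]. The last clause is what later converts a time component
    into a tangent vector at time 0. *)
Lemma flow_differentiable : exists Phi : E -> R -> E,
  [/\ forall y, Phi y 0 = y,
      forall y (t : R), ball y0 (r / 4) y -> `|t| < d ->
        ball y0 r (Phi y t) /\ is_derive t 1 (Phi y) (X (Phi y t)),
      C_on 1 [set z : E * R | ball y0 (r / 4) z.1 /\ `|z.2| < d]
        (fun z => Phi z.1 z.2)
    & forall y (t : R), ball y0 (r / 4) y -> `|t| < d ->
        'd (fun z : E * R => Phi z.1 z.2) (y, t) (X y, 0) = X (Phi y t)].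
Proof.
have [Phi [Phic Phi0 PhiD Phib]] := flow_exists.
have [W [Wc Wlin W0 WD [M [M0 WM]]]] := linearized_flow_exists Phic.
have r42 : r / 4 + r / 4 = r / 2 by field.
have Phir y t : ball y0 (r / 4) y -> `|Phi y t - y0| <= r / 2.
  rewrite -ball_normE /= distrC => yr.
  rewrite -(subrK y (Phi y t)) -addrA (le_trans (ler_normD _ _))//.
  by rewrite -r42 lerD// ltW.
have rhoP y t : ball y0 (r / 4) y -> rho (Phi y t) = Phi y t.
  by move=> yr; rewrite /rho row_clamp_id//; exact: Phir.
have Phiball y t : ball y0 (r / 4) y -> ball y0 r (Phi y t).
  by move=> yr; rewrite -rhoP//; exact: rho_ball.
have PhiX y (t : R) : ball y0 (r / 4) y -> `|t| < d -> is_derive t 1 (Phi y) (X (Phi y t)).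
  by move=> yr td; rewrite -(rhoP y t yr); exact: PhiD.
have WX y k (t : R) : ball y0 (r / 4) y -> `|t| < d ->
    is_derive t 1 (fun s => W y s k) ('d X (Phi y t) (W y t k)).
  by move=> yr td; rewrite -(rhoP y t yr); exact: WD.
(* The factor 2 is [1 + 2 * d * l] at worst: Gronwall bounds the deviation
   [Phi (y + k) - Phi y - k], with an a priori bound given by the two displacements. *)
have PhiL y k t : `|t| < d -> `|Phi (y + k) t - Phi y t| <= 2 * `|k|.
  move=> td.
  have := @short_gronwall R n (fun s => Phi (y + k) s - Phi y s - k)
    (fun s => X (rho (Phi (y + k) s)) - X (rho (Phi y s)) - 0) l d (l * `|k|)
    (r / 4 + r / 4) (ltW l0) ld.
  move=> /(_ _ _ _ _ _ t td) H.
  have {}H : `|Phi (y + k) t - Phi y t - k| <= 2 * d * (l * `|k|).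
    apply: H.
    - by rewrite mulr_ge0// ltW.
    - by rewrite !Phi0 [y + k]addrC addrK subrr.
    - move=> s sd.
      exact: (is_deriveB (is_deriveB (PhiD _ _ sd) (PhiD _ _ sd)) (is_derive_cst k s 1)).
    - move=> s sd; rewrite subr0 (le_trans (XL (rho_ball _) (rho_ball _)))//.
      rewrite -mulrDr ler_pM2l// (le_trans (row_clamp_lipschitz _ _ _ _))//.
      by rewrite -{1}(subrK k (Phi (y + k) s - Phi y s)) ler_normD.
    - move=> s sd.
      have -> : Phi (y + k) s - Phi y s - k =
          (Phi (y + k) s - (y + k)) - (Phi y s - y).
        rewrite opprB opprD -!addrA; congr (_ + _).
        by rewrite (addrCA (- k)) addKr addrC.
      by rewrite (le_trans (ler_normB _ _))// lerD.
  rewrite -(subrK k (Phi (y + k) t - Phi y t)) (le_trans (ler_normD _ _))//.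
  rewrite mulrDl mul1r lerD2r (le_trans H)// -[leRHS]mul1r mulrA ler_wpM2r//.
  by rewrite (_ : 2 * d * l = 2 * (l * d)); [have := ld; lra|ring].
have Phidiff y (h : R) : ball y0 (r / 4) y -> 0 < h -> \forall k \near (0 : E),
    forall t : R, `|t| < d -> `|Phi (y + k) t - Phi y t - W y t k| <= 4 * d * h * `|k|.
  move=> yr h0.
  have h2 : 0 < h / 2 by rewrite divr_gt0.
  (* First-order expansion of [X] along the orbit of [y], uniform in time by compactness. Half of
     [h] bounds the remainder for the differential frozen at [Phi y s], the other half the change of
     the differential from [Phi y s] to [Phi y s']. *)
  have unif : \forall k \near (0 : E), `[- d, d]%classic `<=` (fun s : R =>
     `|X (Phi (y + k) s) - X (Phi y s) - 'd X (Phi y s) (Phi (y + k) s - Phi y s)|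
       <= h * `|Phi (y + k) s - Phi y s|).
    apply: ((@compact_near_coveringP _ _).1 (@segment_compact R (- d) d) E (nbhs (0 : E))
      (fun k s => `|X (Phi (y + k) s) - X (Phi y s) -
        'd X (Phi y s) (Phi (y + k) s - Phi y s)| <= h * `|Phi (y + k) s - Phi y s|)
      (@nbhs_filter _ (0 : E))) => s _.
    have [e e0 [_ eD eX]] := C1_strict oB XC (Phiball _ s yr) h2.
    have Pn : \forall s' \near s & k \near (0 : E), ball (Phi y s) e (Phi (y + k) s').
      have [[P Q] /= [Py Qs] PQ] : \forall z \near (y, s), ball (Phi y s) e (Phi z.1 z.2).
        exact: (Phic (y, s) _ (nbhsx_ballx (Phi y s) e e0)).
      have P0 : \forall k \near (0 : E), P (y + k).
        exact: near_translate Py.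
      by exists (Q, (fun k => P (y + k))) => //= -[s' k] /= [Qs' Pk]; exact: (PQ (y + k, s')).
    have Pn0 : \forall s' \near s & k \near (0 : E), ball (Phi y s) e (Phi y s').
      have Q0 : \forall s' \near s, ball (Phi y s) e (Phi y s').
        have cs : {for s, continuous (fun b : R => Phi y b)}.
          exact: (continuous_slice (a := y) Phic).
        exact: (cs _ (nbhsx_ballx (Phi y s) e e0)).
      exists ((fun s' => ball (Phi y s) e (Phi y s')), setT); first by split => //; exact: filterT.
      by move=> -[s' k] /= [].
    apply: filterS2 Pn Pn0 => -[s' k] /= b1 b0.
    set u := Phi (y + k) s' - Phi y s'.
    have E1 := eX _ _ b0 b1; have E2 := eD _ u b0.
    have -> : X (Phi (y + k) s') - X (Phi y s') - 'd X (Phi y s') u =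
      (X (Phi (y + k) s') - X (Phi y s') - 'd X (Phi y s) u) -
      ('d X (Phi y s') u - 'd X (Phi y s) u).
      by rewrite opprB [X in _ = _ + X]addrC addrA [in RHS]addrAC subrK.
    by rewrite (le_trans (ler_normB _ _))// [h](splitr h) mulrDl lerD.
  have yk : \forall k \near (0 : E), ball y0 (r / 4) (y + k).
    have : \forall x \near y, ball y0 (r / 4) x by apply: open_near => //; exact: ball_open.
    exact: near_translate.
  apply: filterS2 unif yk => k un ykr t td.
  have := @short_gronwall R n (fun s => Phi (y + k) s - Phi y s - W y s k)
    (fun s => X (Phi (y + k) s) - X (Phi y s) - 'd X (Phi y s) (W y s k)) l d
    (h * (2 * `|k|)) (2 * `|k| + M * `|k|) (ltW l0) ld.
  move=> /(_ _ _ _ _ _ t td) H.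
  rewrite (_ : 4 * d * h * `|k| = 2 * d * (h * (2 * `|k|))); last by ring.
  apply: H.
  - by rewrite !mulr_ge0// ltW.
  - by rewrite !Phi0 W0 [y + k]addrC addrK subrr.
  - move=> s sd.
    exact: (is_deriveB (is_deriveB (PhiX _ _ ykr sd) (PhiX _ _ yr sd)) (WX y k s yr sd)).
  - move=> s sd.
    set u := Phi (y + k) s - Phi y s.
    have -> : X (Phi (y + k) s) - X (Phi y s) - 'd X (Phi y s) (W y s k) =
      'd X (Phi y s) (u - W y s k) +
      (X (Phi (y + k) s) - X (Phi y s) - 'd X (Phi y s) u).
      by rewrite linearB [RHS]addrC addrA subrK.
    rewrite (le_trans (ler_normD _ _))// lerD//; first by apply: XD; exact: Phiball.
    have sI : `[- d, d]%classic s by rewrite /= in_itv /= -ler_norml ltW.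
    rewrite (le_trans (un s sI))// ler_pM2l//.
    exact: PhiL.
  - move=> s sd; rewrite (le_trans (ler_normB _ _))// lerD//.
    exact: PhiL.
pose F (z : E * R) := Phi z.1 z.2.
pose O := [set z : E * R | ball y0 (r / 4) z.1 /\ `|z.2| < d].
have On (z : E * R) : O z -> \forall z' \near z, O z'.
  move=> [zr zd].
  have n1 : \forall y \near z.1, ball y0 (r / 4) y by apply: open_near => //; exact: ball_open.
  have n2 : \forall s \near z.2, `|s| < d by exact: (@near_norm_lt R R).
  by exists (ball y0 (r / 4), [set s | `|s| < d]) => //= -[].
have oO : open O by rewrite openE => z /On.
have Fdiff (y : E) (t : R) : ball y0 (r / 4) y -> `|t| < d ->
    differentiable F (y, t) /\
    forall v, 'd F (y, t) v = W y t v.1 + v.2 *: X (Phi y t).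
  move=> yr td; pose D (v : E * R) := W y t v.1 + v.2 *: X (Phi y t).
  have Dlin : linear D.
    move=> a u v; rewrite /D /= Wlin scalerDl scalerDr scalerA.
    by rewrite -!addrA; congr (_ + _); rewrite addrCA.
  pose DL : {linear (E * R)%type -> E} := HB.pack D (GRing.isLinear.Build _ _ _ _ D Dlin).
  have DLc : continuous DL.
    apply: bounded_linear_continuous; apply/linear_boundedP.
    exists (M + `|X (Phi y t)|); split; first exact: num_real.
    move=> C MC v; apply: le_trans (_ : (M + `|X (Phi y t)|) * `|v| <= _); last first.
      by rewrite ler_wpM2r// ltW.
    rewrite /DL /= /D (le_trans (ler_normD _ _))// mulrDl lerD//.
      rewrite (le_trans (WM _ _ _))// ler_wpM2l//.
      by rewrite prod_normE le_max lexx.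
    by rewrite normrZ mulrC ler_wpM2l// prod_normE le_max lexx orbT.
  suff [Fd FD] : is_diff (y, t) F DL by split=> // v; rewrite FD.
  apply: is_diff_near => // e e0.
  have d4 : 0 < 4 * d + 1 by rewrite addr_gt0// mulr_gt0.
  (* The time increment costs [h * |s|] and the space increment [4 * d * h * |k|]; [|s|] and [|k|]
     are at most the norm of [(k, s)], so the total is [e] times that norm. *)
  pose h := e / (4 * d + 1).
  have h0 : 0 < h by rewrite divr_gt0.
  have XPc : {for (y, t), continuous (X \o F)}.
    apply: continuous_comp; first exact: Phic.
    by apply: differentiable_continuous; apply: Xd; exact: Phiball.
  have /cvgrPdist_le/(_ _ h0) XPh := XPc.
  have nt := near_translate (filterI (On (y, t) (conj yr td)) XPh).
  have [r1 /= r10 hr1] := (nbhs_ballP _ _).1 (nt _).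
  have := Phidiff y h yr h0; move=> /nbhs_ballP[r2 /= r20 hr2].
  apply/nbhs_ballP; exists (Num.min r1 r2) => /=; first by rewrite lt_min r10.
  move=> -[k s]; rewrite -ball_normE /= sub0r normrN lt_min => /andP[ks1 ks2].
  have kle : `|k| <= `|(k, s)| by rewrite prod_normE le_max lexx.
  have sle : `|s| <= `|(k, s)| by rewrite prod_normE le_max lexx orbT.
  have near1 (u : R) : `|u| <= `|s| -> O (y + k, t + u) /\
      `|X (Phi y t) - X (Phi (y + k) (t + u))| <= h.
    move=> us; apply: (hr1 (k, u)); rewrite -ball_normE /= sub0r normrN.
    apply: le_lt_trans ks1; rewrite !prod_normE /= ge_max !le_max lexx /=.
    by rewrite us orbT.
  have E1 : `|Phi (y + k) (t + s) - Phi (y + k) t - s *: X (Phi y t)| <= h * `|s|.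
    have := @mvt_interval R n [set u : R | `|u| <= `|s|]
      (fun u => Phi (y + k) (t + u) - u *: X (Phi y t))
      (fun u => X (Phi (y + k) (t + u)) - X (Phi y t)) h (@is_interval_norm_le _ _).
    move=> /(_ _ _ 0 s); rewrite /= addr0 scale0r !subr0 normr0.
    move=> H; rewrite addrAC.
    apply: H => //.
      move=> u us; have [[ykr tu] _] := near1 u us.
      apply: (is_deriveB (is_derive_translate (PhiX _ _ ykr tu))).
      exact: is_derive_line.
    by move=> u us; rewrite distrC; have [_] := near1 u us.
  have E2 : `|Phi (y + k) t - Phi y t - W y t k| <= 4 * d * h * `|k|.
    apply: hr2 => //; rewrite -ball_normE /= sub0r normrN.
    exact: le_lt_trans ks2.
  rewrite /F /DL /= /D /= [k + y]addrC [s + t]addrC.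
  have -> : Phi (y + k) (t + s) - Phi y t - (W y t k + s *: X (Phi y t)) =
    (Phi (y + k) (t + s) - Phi (y + k) t - s *: X (Phi y t)) +
    (Phi (y + k) t - Phi y t - W y t k).
    rewrite addrACA [_ + (_ - Phi y t)]addrA subrK -opprD [s *: _ + _]addrC.
    by [].
  rewrite (le_trans (ler_normD _ _))//.
  apply: le_trans (lerD E1 E2) _.
  apply: (@le_trans _ _ (h * `|(k, s)| + 4 * d * h * `|(k, s)|)).
    have h40 : 0 <= 4 * d * h by rewrite mulr_ge0 ?(ltW h0)// mulr_ge0 ?(ltW d0).
    by apply: lerD; apply: ler_wpM2l => //; exact: ltW.
  rewrite -mulrDl ler_wpM2r// /h.
  by rewrite le_eqVlt; apply/orP; left; apply/eqP; field; rewrite gt_eqF.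
exists Phi; split => //.
- move=> y t yr td; split; [exact: Phiball|exact: PhiX].
- split=> [[y t] [yr td]|v [y t] [yr td]]; first exact: (Fdiff y t yr td).1.
  apply: (@near_eq_continuous _ _ (fun z => W z.1 z.2 v.1 + v.2 *: X (F z))).
    apply: filterS (On (y, t) (conj yr td)) => -[y' t'] [yr' td'].
    have [Fd FE] := Fdiff y' t' yr' td'.
    by rewrite deriveE//; exact/esym/FE.
  apply: continuousD; first exact: Wc.
  apply: (continuousZ (s := fun _ : E * R => v.2) (f := X \o F)).
    exact: cst_continuous.
  apply: continuous_comp; first exact: Phic.
  by apply: differentiable_continuous; apply: Xd; exact: Phiball.
- move=> y t yr td; have [_ ->] := Fdiff y t yr td.
  rewrite scale0r addr0 /=.
  (* [X (Phi y s)] and [W y s (X y)] solve the same linearized equation with the same value [X y] at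
     time 0; Gronwall with [c = 0] makes them equal. *)
  have := @short_gronwall R n (fun s => X (Phi y s) - W y s (X y))
    (fun s => 'd X (Phi y s) (X (Phi y s)) - 'd X (Phi y s) (W y s (X y)))
    l d 0 (l * r + `|X y0| + M * `|X y|) (ltW l0) ld (lexx _).
  rewrite mulr0 => /(_ _ _ _ _ t td) H.
  apply/eqP; rewrite eq_sym -subr_eq0 -normr_le0; apply: H.
  + by rewrite Phi0 W0 subrr.
  + move=> s sd.
    have XPhi := is_derive_chain (PhiX y s yr sd) (Xd (Phiball y s yr)).
    exact: (is_deriveB XPhi (WX y (X y) s yr sd)).
  + move=> s sd; rewrite addr0 -linearB; apply: XD; exact: Phiball.
  + move=> s sd; rewrite (le_trans (ler_normB _ _))// lerD//.
    rewrite -(subrK (X y0) (X (Phi y s))) (le_trans (ler_normD _ _))// lerD2r.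
    have Pb := Phiball y s yr.
    rewrite (le_trans (XL Pb (ballxx _ r0)))// ler_pM2l//.
    by move: Pb; rewrite -ball_normE /= distrC; exact: ltW.
Qed.

End LocalFlow.

(** * Local existence and uniqueness of integral curves in R^n *)

Section FlowUnique.
Context {R : realType} {n : nat}.
Local Notation E := 'rV[R]_n.

(** Strict differentiability with tolerance 1: near [a] the field differs from its linear part by a
    1-Lipschitz map, hence [l = 1 + k] with [k] a Lipschitz constant of ['d X a]. *)
Lemma C1_lipschitz (U : set E) (X : E -> E) (a : E) : open U -> U a ->
  C_on 1 U X -> exists r l : R,
  [/\ 0 < r, 0 < l, ball a r `<=` U,
      forall x y, ball a r x -> ball a r y -> `|X x - X y| <= l * `|x - y|
    & forall x v, ball a r x -> `|'d X x v| <= l * `|v|].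
Proof.
move=> oU Ua XC; have [r r0 [rU rD rX]] := C1_strict oU XC Ua (ltr01).
have Xd : differentiable X a by case: XC => XC _; exact: XC.
have [k k0 kb] := linear_lipschitz (diff_continuous Xd).
exists r, (1 + k); split; [exact: r0|exact: addr_gt0|exact: rU| |].
- move=> x y xr yr; rewrite -(subrK ('d X a (x - y)) (X x - X y)).
  by rewrite (le_trans (ler_normD _ _))// mulrDl lerD//; exact: rX.
- move=> x v xr; rewrite -(subrK ('d X a v) ('d X x v)).
  by rewrite (le_trans (ler_normD _ _))// mulrDl lerD//; exact: rD.
Qed.

Lemma local_flow (U : set E) (X : E -> E) (a : E) : open U -> U a ->
  C_on 1 U X -> exists (r d : R) (Phi : E -> R -> E),
  [/\ 0 < r /\ 0 < d,
      forall y, Phi y 0 = y,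
      forall y (t : R), ball a r y -> `|t| < d ->
        U (Phi y t) /\ is_derive t 1 (Phi y) (X (Phi y t)),
      C_on 1 [set z : E * R | ball a r z.1 /\ `|z.2| < d]
        (fun z => Phi z.1 z.2)
    & forall y (t : R), ball a r y -> `|t| < d ->
        'd (fun z : E * R => Phi z.1 z.2) (y, t) (X y, 0) = X (Phi y t)].
Proof.
move=> oU Ua XC; have [r [l [r0 l0 rU XL XD]]] := C1_lipschitz oU Ua XC.
have XC' : C_on 1 (ball a r) X by exact: C_on_sub XC.
have [Phi [P0 P1 P2 P3]] := flow_differentiable r0 l0 XC' XL XD.
exists (r / 4), (Num.min (2^-1 / l) (r / (8 * (`|X a| + l * r + 1)))), Phi.
split=> //.
  split; first by rewrite divr_gt0.
  rewrite lt_min !divr_gt0// mulr_gt0//.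
  by rewrite ltr_wpDl// addr_ge0// mulr_ge0// ltW.
by move=> y t yr td; have [/rU ? ?] := P1 y t yr td.
Qed.

(** Gronwall with [c = 0] for the difference of the curves, over a time span short enough to keep
    both in a ball where [X] is Lipschitz. *)
Lemma integral_curve_unique (U : set E) (X : E -> E) (f g : R -> E) (t0 : R) :
  open U -> C_on 1 U X -> U (f t0) -> f t0 = g t0 ->
  (\forall t \near t0, is_derive (t : R) 1 f (X (f t))) ->
  (\forall t \near t0, is_derive (t : R) 1 g (X (g t))) ->
  \forall t \near t0, f t = g t.
Proof.
move=> oU XC Uf fg fD gD.
have [r [l [r0 l0 rU XL XD]]] := C1_lipschitz oU Uf XC.
have fc := derivable1_continuous (nbhs_singleton fD).
have gc := derivable1_continuous (nbhs_singleton gD).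
have fr : \forall t \near t0, ball (f t0) r (f t) by exact: (fc _ (nbhsx_ballx _ _ r0)).
have gr : \forall t \near t0, ball (f t0) r (g t).
  by rewrite fg; exact: (gc _ (nbhsx_ballx _ _ r0)).
have [d1 /= d10 h] := (nbhs_ballP _ _).1 (filterI (filterI fD gD) (filterI fr gr)).
pose d := Num.min d1 (2^-1 / l).
have d0 : 0 < d by rewrite lt_min d10 divr_gt0.
have hd (s : R) : `|s| < d -> [/\ is_derive (t0 + s) 1 f (X (f (t0 + s))),
   is_derive (t0 + s) 1 g (X (g (t0 + s))), ball (f t0) r (f (t0 + s))
   & ball (f t0) r (g (t0 + s))].
  rewrite lt_min => /andP[sd _].
  have [|[? ?] [? ?]] := h (t0 + s); last by split.
  by rewrite -ball_normE /= opprD addrA subrr sub0r normrN.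
have ld : l * d <= 2^-1 by rewrite mulrC -ler_pdivlMr// /d ge_min lexx orbT.
have key (s : R) : `|s| < d -> f (t0 + s) = g (t0 + s).
  move=> sd; apply/eqP; rewrite -subr_eq0 -normr_le0.
  have := @short_gronwall R n (fun s => f (t0 + s) - g (t0 + s))
    (fun s => X (f (t0 + s)) - X (g (t0 + s))) l d 0 (r + r) (ltW l0) ld (lexx _).
  rewrite mulr0; apply => //.
  - by rewrite addr0 fg subrr.
  - move=> u /hd[fu gu _ _].
    exact: (is_deriveB (is_derive_translate fu) (is_derive_translate gu)).
  - by move=> u /hd[_ _ fu gu]; rewrite addr0; exact: XL.
  - move=> u /hd[_ _]; rewrite -!ball_normE /= => fu gu.
    rewrite (_ : _ - _ = (f t0 - g (t0 + u)) - (f t0 - f (t0 + u))).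
      by rewrite (le_trans (ler_normB _ _))// lerD// ltW.
    by rewrite opprB [RHS]addrC addrA subrK.
apply/nbhs_ballP; exists d => //= t; rewrite -ball_normE /= distrC => td.
by have := key _ td; rewrite addrC subrK.
Qed.

End FlowUnique.

(** * The inverse function theorem *)

Section LocalInverse.
Context {R : realType} {n : nat}.
Local Notation E := 'rV[R]_n.
Context (G : E -> E) (O : set E) (oO : open O)
  (GO : forall a b, O a -> O b -> `|G b - G a - (b - a)| <= 2^-1 * `|b - a|).

Lemma near_id_expanding a b : O a -> O b -> `|b - a| <= 2 * `|G b - G a|.
Proof.
move=> Oa Ob; have := GO Oa Ob => H.
have : `|b - a| <= `|G b - G a| + `|G b - G a - (b - a)|.
  rewrite -[X in `|X| <= _](subKr (G b - G a)).
  by rewrite (le_trans (ler_normB _ _)).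
by lra.
Qed.

Lemma near_id_injective a b : O a -> O b -> G a = G b -> a = b.
Proof.
move=> Oa Ob ab; have := near_id_expanding Oa Ob.
by rewrite ab subrr normr0 mulr0 normr_le0 subr_eq0 => /eqP.
Qed.

(** A solution is a fixed point of [x |-> x + (y - G x)], which contracts distances by 1/2 because
    [G] is close to the identity. *)
Lemma near_id_surjective a (r : R) y : 0 < r ->
  (forall x, `|x - a| <= r -> O x) -> `|y - G a| <= r / 2 ->
  exists2 x, `|x - a| <= r & G x = y.
Proof.
move=> r0 rO yr; pose U := [set x | `|x - a| <= r]; pose f x := x + (y - G x).
have fU : {homo f : x / U x >-> U x}.
  move=> x Ux; rewrite /U /= /f.
  (* Each of the two terms has norm at most [r / 2]: the first by hypothesis, the second by the
     estimate on [G]. *)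
  have -> : x + (y - G x) - a = (y - G a) - (G x - G a - (x - a)).
    by apply/rowP => i; rewrite !mxE; ring.
  rewrite (le_trans (ler_normB _ _))// [leRHS]splitr lerD//.
  have Oa : O a by apply: rO; rewrite subrr normr0 ltW.
  rewrite (le_trans (GO Oa (rO _ Ux)))// mulrC ler_pdivrMr// divfK//.
pose F : {fun U >-> U} := HB.pack f (isFun.Build _ _ U U f fU).
have Fc : is_contraction F.
  exists (2^-1)%:nng; split => /=; first by lra.
  move=> [u v] /= [Uu Uv]; rewrite /f.
  have -> : u + (y - G u) - (v + (y - G v)) = - (G u - G v - (u - v)).
    by apply/rowP => i; rewrite !mxE; ring.
  by rewrite normrN; apply: GO; exact: rO.
have cU : closed U.
  rewrite (_ : U = (fun x => `|x - a|) @^-1` [set t | t <= r])//.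
  apply: closed_comp; last exact: closed_le.
  move=> x _; apply: (@continuous_comp _ _ _ (fun x => x - a)); last exact: norm_continuous.
  by apply: continuousB; [exact: cvg_id|exact: cst_continuous].
have [|x Ux xE] := banach_fixed_point Fc cU.
  by exists a; rewrite /U /= subrr normr0 ltW.
exists x => //; move: xE; rewrite /F /= /f => /eqP.
by rewrite eq_sym -subr_eq0 addrC addrA addNr add0r subr_eq0 => /eqP.
Qed.

End LocalInverse.

Section InverseFunction.
Context {R : realType} {n : nat}.
Local Notation E := 'rV[R]_n.
Context (G : E -> E) (O : set E) (oO : open O)
  (GO : forall a b, O a -> O b -> `|G b - G a - (b - a)| <= 2^-1 * `|b - a|)
  (GC : C_on 1 O G).

Let Gd a : O a -> differentiable G a.
Proof. by move=> Oa; case: GC => h _; exact: h. Qed.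

(** The estimate on finite increments passes to the differential, by testing it on a small multiple
    of [v] and dividing by the scale. *)
Lemma near_id_diff a v : O a -> `|'d G a v - v| <= 2^-1 * `|v|.
Proof.
move=> Oa; have [->|v0] := eqVneq v 0.
  by rewrite linear0 subrr normr0 mulr0.
have vp : 0 < `|v| by rewrite normr_gt0.
rewrite -ler_pdivrMr//; apply/ler_addgt0Pr => e e0; rewrite ler_pdivrMr//.
have H := filterI (near_translate (open_near oO Oa)) (near_diff (Gd Oa) e0).
have [d /= d0 Hd] := (nbhs_ballP _ _).1 (H _).
(* Scales [v] to norm [d / 2], inside the radius where the first-order expansion is valid. *)
pose s := d / 2 / `|v|.
have s0 : 0 < s by rewrite !divr_gt0.
have [|Os Ds] := Hd (s *: v).
  rewrite -ball_normE /= sub0r normrN normrZ gtr0_norm// divfK ?gt_eqF//.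
  by rewrite ltr_pdivrMr// ltr_pMr// ltr1n.
have Gs := GO Oa Os.
rewrite -(ler_pM2l s0) -{1}(gtr0_norm s0) -normrZ scalerBr -linearZ.
rewrite (_ : _ - _ = (G (a + s *: v) - G a - (a + s *: v - a)) -
    (G (s *: v + a) - G a - 'd G a (s *: v))).
  rewrite (le_trans (ler_normB _ _))//.
  apply: le_trans (lerD Gs Ds) _.
  rewrite [a + _]addrC addrK normrZ gtr0_norm//.
  by rewrite -mulrDl mulrCA.
rewrite [s *: v + a]addrC; set g := G _ - G a; set w := 'd G a (s *: v).
rewrite [a + _]addrC addrK.
by apply/rowP => i; rewrite !mxE; ring.
Qed.

(** ['d G a] satisfies the same near-identity estimate on the whole space, so its bijectivity
    follows from the fixed-point argument and its inverse is 2-Lipschitz; no determinant occurs. *)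
Lemma diff_inverse a : O a -> exists S : {linear E -> E},
  (forall w, 'd G a (S w) = w) /\ forall w, `|S w| <= 2 * `|w|.
Proof.
move=> Oa; pose L := 'd G a.
have LO u v : setT u -> setT v -> `|L v - L u - (v - u)| <= 2^-1 * `|v - u|.
  by move=> _ _; rewrite /L -linearB; exact: near_id_diff.
have /choice[S SP] : forall w, exists v, L v = w.
  move=> w.
  have [|||v _ vw] := near_id_surjective LO (a := 0) (r := 2 * `|w| + 1) (y := w).
  - by rewrite ltr_wpDl// mulr_ge0.
  - by [].
  - by rewrite /L linear0 subr0 mulrDl mul1r mulrAC divff ?mul1r ?lerDl.
  by exists v.
have Slin : linear S.
  move=> k u v; apply: (near_id_injective LO) => //.
  by rewrite SP /L linearP -/L !SP.
pose SL : {linear E -> E} := HB.pack S (GRing.isLinear.Build _ _ _ _ S Slin).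
exists SL; split; first exact: SP.
move=> w; have := near_id_expanding (a := 0) (b := S w) LO I I.
by rewrite !subr0 SP /L linear0 subr0.
Qed.

Lemma inverse_function : exists th : E -> E,
  [/\ open (G @` O), forall a, O a -> th (G a) = a & C_on 1 (G @` O) th].
Proof.
pose th y := xget 0 [set a | O a /\ G a = y].
have thG a : O a -> th (G a) = a.
  move=> Oa; have [|Ob ab] := @xgetPex _ 0 [set b | O b /\ G b = G a].
    by exists a.
  exact: (near_id_injective GO Ob Oa).
have oG : open (G @` O).
  rewrite openE => _ [a Oa <-].
  have /nbhs_ballP[r /= r0 rO] := open_near oO Oa.
  apply/nbhs_ballP; exists (r / 2 / 2) => /=; first by rewrite !divr_gt0.
  move=> y; rewrite -ball_normE /= distrC => yr.
  have [|||x xr xy] := @near_id_surjective R n G O GO a (r / 2) y.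
  - by rewrite divr_gt0.
  - move=> x xr; apply: rO; rewrite -ball_normE /= distrC.
    by rewrite (le_lt_trans xr)// ltr_pdivrMr// ltr_pMr// ltr1n.
  - exact: ltW.
  exists x => //; apply: rO; rewrite -ball_normE /= distrC.
  by rewrite (le_lt_trans xr)// ltr_pdivrMr// ltr_pMr// ltr1n.
have thL y y' : (G @` O) y -> (G @` O) y' -> `|th y' - th y| <= 2 * `|y' - y|.
  by move=> [a Oa <-] [b Ob <-]; rewrite !thG//; exact: (near_id_expanding GO).
have thO y : (G @` O) y -> O (th y) /\ G (th y) = y.
  by move=> [a Oa <-]; rewrite thG.
have thD y : (G @` O) y -> differentiable th y /\
    forall w, 'd G (th y) ('d th y w) = w.
  move=> Gy; have [Oa Ga] := thO y Gy.
  have [S [GS SB]] := diff_inverse Oa.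
  have Sc : continuous S.
    apply: bounded_linear_continuous; apply/linear_boundedP.
    exists 2; split; first exact: num_real.
    by move=> C C2 w; rewrite (le_trans (SB w))// ler_wpM2r// ltW.
  suff [td tE] : is_diff y th S.
    split; first exact: td.
    move=> w; exact: (etrans (congr1 ('d G (th y)) (congr1 (fun f => f w) tE)) (GS w)).
  apply: is_diff_near; first exact: Sc.
  move=> e e0.
  (* Two factors 2 will be lost: the bound on [S] and the Lipschitz constant of [th]. *)
  have e4 : 0 < e / 4 by rewrite divr_gt0.
  have [r /= r0 hr] := (nbhs_ballP _ _).1 (near_diff (Gd Oa) e4).
  have [r' /= r'0 hr'] := (nbhs_ballP _ _).1 (near_translate (open_near oG Gy)).
  apply/nbhs_ballP; exists (Num.min (r / 2) r') => /=.
    by rewrite lt_min divr_gt0.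
  move=> h; rewrite -ball_normE /= sub0r normrN lt_min => /andP[h1 h2].
  have Gyh : (G @` O) (y + h) by apply: hr'; rewrite -ball_normE /= sub0r normrN.
  have [Ob Gb] := thO _ Gyh.
  have th1 : `|th (y + h) - th y| <= 2 * `|h|.
    by have := thL _ _ Gy Gyh; rewrite [y + h]addrC addrK.
  have := hr (th (y + h) - th y); rewrite -ball_normE /= sub0r normrN subrK.
  have hr2 : `|th (y + h) - th y| < r.
    by rewrite (le_lt_trans th1)// mulrC -ltr_pdivlMr.
  move=> /(_ hr2) D.
  have E1 : th (y + h) - th y - S h =
      - S (G (th (y + h)) - G (th y) - 'd G (th y) (th (y + h) - th y)).
    have hE : h = G (th (y + h)) - G (th y) by rewrite Gb Ga [y + h]addrC addrK.
    rewrite linearB -hE opprB; congr (_ - _).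
    apply: (near_id_injective (G := 'd G (th y)) (O := setT)) => //.
      by move=> u v _ _; rewrite -linearB; exact: near_id_diff.
  rewrite [h + y]addrC E1 normrN (le_trans (SB _))//.
  apply: (@le_trans _ _ (2 * (e / 4 * `|th (y + h) - th y|))).
    by rewrite ler_pM2l.
  apply: (@le_trans _ _ (2 * (e / 4 * (2 * `|h|)))).
    by rewrite ler_pM2l// ler_pM2l.
  by rewrite le_eqVlt; apply/orP; left; apply/eqP; field.
exists th; split=> //; split=> [y /thD[]//|v y Gy].
apply: (@near_eq_continuous _ _ (fun z => 'd th z v)).
  by apply: filterS (open_near oG Gy) => z /thD[td _]; rewrite deriveE.
have [Oa Ga] := thO y Gy.
have [_ yE] := thD y Gy.
have thc : {for y, continuous th} by exact/differentiable_continuous/(thD y Gy).1.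
have [_ Gc] := (C1P G oO).1 GC.
(* Continuity of ['d th] without inverting matrices: ['d G (th z)] shrinks distances at most by
   half, so ['d th z v] is within twice the distance from ['d G (th z) ('d th y v)] to [v], measured
   from ['d th y v]. In that expression only the base point moves, and at [z = y] it equals [v]. *)
have dc : {for y, continuous (fun z => 'd G (th z) ('d th y v))}.
  exact: (continuous_comp thc (Gc ('d th y v) (th y) Oa)).
apply/continuous_distP => e e0.
have e2 : 0 < e / 2 by rewrite divr_gt0.
have dce := (continuous_distP _ _).1 dc _ e2.
apply: (@filterS2 _ (nbhs y) _ _ _ _ _ dce (open_near oG Gy)) => z /= zE Gz.
have [Oz _] := thO z Gz; have [_ zD] := thD z Gz.
have LO u w : setT u -> setT w ->
    `|'d G (th z) w - 'd G (th z) u - (w - u)| <= 2^-1 * `|w - u|.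
  by move=> _ _; rewrite -linearB; exact: near_id_diff.
apply: (le_trans (near_id_expanding (a := 'd th z v) (b := 'd th y v) LO I I)).
have zE' : `|v - 'd G (th z) ('d th y v)| <= e / 2 :=
  eq_ind _ (fun q => `|q - 'd G (th z) ('d th y v)| <= e / 2) zE _ (yE v).
apply: (eq_ind_r (fun q => 2 * `|'d G (th z) ('d th y v) - q| <= e) _ (zD v)).
by move: zE'; rewrite distrC; lra.
Qed.

End InverseFunction.

(** * Charts and flows on a manifold *)

Lemma within_open_continuous (T T' : topologicalType) (A : set T) (f : T -> T') x :
  open A -> {within A, continuous f} -> A x -> {for x, continuous f}.
Proof.
move=> oA + Ax; rewrite continuous_open_subspace// => /(_ x); apply.
by rewrite inE.
Qed.

Lemma near_preimage (T T' : topologicalType) (f : T -> T') x (U : set T') :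
  {for x, continuous f} -> open U -> U (f x) -> \forall y \near x, U (f y).
Proof. by move=> fc oU Ufx; apply: fc; exact: open_nbhs_nbhs. Qed.

Lemma open_near_sub (T : topologicalType) (U P : set T) x :
  open U -> U x -> (forall y, U y -> P y) -> \forall y \near x, P y.
Proof. by move=> oU Ux UP; apply: filterS (open_near oU Ux). Qed.

Section Charts.
Context {R : realType} {n : nat} {M : manifold R n}.
Implicit Types (c : chart R n M) (x : M) (v w y : 'rV[R]_n).

Lemma cmap_cts c x : cdom c x -> {for x, continuous (cmap c)}.
Proof.
apply: within_open_continuous; first exact: cdom_open.
exact: cmap_continuous.
Qed.

Lemma cinv_cts c y : ccod c y -> {for y, continuous (cinv c)}.
Proof.
apply: within_open_continuous; first exact: ccod_open.
exact: cinv_continuous.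
Qed.

Lemma transition_dom_open c c' : open (ccod c `&` cinv c @^-1` cdom c').
Proof.
rewrite openE => y [cy c'y]; apply: filterI.
  by apply: open_nbhs_nbhs; split => //; exact: ccod_open.
exact: near_preimage (cinv_cts cy) (cdom_open c') c'y.
Qed.

Lemma transition_diff c c' y : atlas c -> atlas c' -> ccod c y ->
  cdom c' (cinv c y) -> differentiable (cmap c' \o cinv c) y.
Proof.
move=> ac ac' cy c'y; have [H _] := transition_smooth ac ac' 1%N.
exact: H.
Qed.

(** [chart_at] need not be locally constant, so a differential can only be studied near a point
    after passage to a fixed chart; this chain rule performs the passage on the target side. *)
Lemma chart_change (V : normedModType R) (f : V -> M) (z : V) c c' :
  atlas c -> atlas c' -> cdom c (f z) -> cdom c' (f z) ->
  {for z, continuous f} -> differentiable (cmap c \o f) z ->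
  differentiable (cmap c' \o f) z /\
  forall v : V, 'd (cmap c' \o f) z v =
    'd (cmap c' \o cinv c) (cmap c (f z)) ('d (cmap c \o f) z v).
Proof.
move=> ac ac' cf c'f fc fd.
have td : differentiable (cmap c' \o cinv c) ((cmap c \o f) z).
  apply: transition_diff => //=; first exact: cmap_cod.
  by rewrite cmapK.
have near_eq : \forall z' \near z,
    ((cmap c' \o cinv c) \o (cmap c \o f)) z' = (cmap c' \o f) z'.
  by apply: filterS (near_preimage fc (cdom_open c) cf) => z' /= cz'; rewrite cmapK.
have compd : differentiable ((cmap c' \o cinv c) \o (cmap c \o f)) z.
  exact: differentiable_comp.
have [d1 d2] := near_eq_differentiable near_eq compd.
split; [exact: d1|move=> v].
have E : 'd ((cmap c' \o cinv c) \o (cmap c \o f)) z v =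
    'd (cmap c' \o cinv c) (cmap c (f z)) ('d (cmap c \o f) z v).
  exact: (congr1 (fun h => h v) (diff_comp fd td)).
exact: (etrans (congr1 (fun h => h v) d2) E).
Qed.

Lemma transition_id c y v : ccod c y -> 'd (cmap c \o cinv c) y v = v.
Proof.
move=> cy.
have near_eq : \forall z \near y, id z = (cmap c \o cinv c) z.
  by apply: (open_near_sub (@ccod_open _ _ _ c) cy) => z cz /=; rewrite cinvK.
have [d1 d2] := near_eq_differentiable near_eq (@ex_diff _ _ _ _ _ _ _ (is_diff_id y)).
have E : 'd (id : 'rV[R]_n -> 'rV[R]_n) y v = v.
  exact: (congr1 (fun h => h v) (@diff_val _ _ _ _ _ _ _ (is_diff_id y))).
exact: (etrans (congr1 (fun h => h v) d2) E).
Qed.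

Lemma of_to_chart c x v : atlas c -> cdom c x ->
  of_chart c (cmap c x) (to_chart c x v) = v.
Proof.
move=> ac cx; rewrite /of_chart /to_chart cmapK//.
have ax := chart_at_atlas x; have dx := chart_at_dom x.
have cx' := cmap_cod dx.
have [||||_ E] := @chart_change _ (cinv (chart_at x)) (cmap (chart_at x) x) c (chart_at x) ac ax.
- by rewrite cmapK.
- by rewrite cmapK.
- exact: cinv_cts.
- by apply: transition_diff; rewrite ?cmapK.
have K : cmap c (cinv (chart_at x) (cmap (chart_at x) x)) = cmap c x by rewrite cmapK.
move: (E v); rewrite K => E'.
exact: (etrans (esym E') (transition_id v cx')).
Qed.

Lemma to_of_chart c y w : atlas c -> ccod c y ->
  to_chart c (cinv c y) (of_chart c y w) = w.
Proof.
move=> ac cy; rewrite /of_chart /to_chart.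
set x := cinv c y; have ax := chart_at_atlas x; have dx := chart_at_dom x.
have [||||_ E] := @chart_change _ (cinv c) y (chart_at x) c ax ac.
- exact: dx.
- exact: cinv_dom.
- exact: cinv_cts.
- by apply: transition_diff.
exact: (etrans (esym (E w)) (transition_id w cy)).
Qed.

Lemma of_chart_linear c y : linear (of_chart c y).
Proof. by move=> a u v; exact: linearP. Qed.

Lemma to_chart_continuous c x : atlas c -> cdom c x -> continuous (to_chart c x).
Proof.
move=> ac cx; apply: diff_continuous; apply: transition_diff => //.
- exact: chart_at_atlas.
- exact/cmap_cod/chart_at_dom.
- by rewrite cmapK//; exact: chart_at_dom.
Qed.

Lemma diff_into_chart_at (V : normedModType R) (f : V -> M) (z : V) c :
  atlas c -> cdom c (f z) ->
  {for z, continuous f} -> differentiable (cmap c \o f) z ->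
  differentiable (cmap (chart_at (f z)) \o f) z /\
  forall v : V, 'd (cmap (chart_at (f z)) \o f) z v =
    of_chart c (cmap c (f z)) ('d (cmap c \o f) z v).
Proof.
move=> ac cf fc fd; rewrite /of_chart cmapK//.
exact: chart_change (chart_at_atlas _) cf (chart_at_dom _) fc fd.
Qed.

Lemma diff_from_chart_at (W : normedModType R) (h : M -> W) x c :
  atlas c -> cdom c x -> differentiable (h \o cinv c) (cmap c x) ->
  forall v, 'd (h \o cinv (chart_at x)) (cmap (chart_at x) x) v =
    'd (h \o cinv c) (cmap c x) (to_chart c x v).
Proof.
move=> ac cx hd v; have dx := chart_at_dom x; have ax := chart_at_atlas x.
set b := chart_at x in dx ax *.
have bx := cmap_cod dx.
have td : differentiable (cmap c \o cinv b) (cmap b x).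
  by apply: transition_diff => //; rewrite cmapK.
have hd' : differentiable (h \o cinv c) ((cmap c \o cinv b) (cmap b x)).
  by rewrite /= cmapK.
have near_eq : \forall y \near cmap b x,
    ((h \o cinv c) \o (cmap c \o cinv b)) y = (h \o cinv b) y.
  have cb : cdom c (cinv b (cmap b x)) by rewrite cmapK.
  by apply: filterS (near_preimage (cinv_cts bx) (cdom_open c) cb) => y /= cy; rewrite cmapK.
have [d1 d2] := near_eq_differentiable near_eq (differentiable_comp td hd').
have E := congr1 (fun k => k v) (diff_comp td hd').
rewrite /= cmapK// in E.
exact: (etrans (congr1 (fun k => k v) d2) E).
Qed.

End Charts.

Section PartialDiff.
Context {R : realType} {V1 V2 W : normedModType R}.

Lemma diff_pairl (F : V1 * V2 -> W) (y : V1) (t : V2) : differentiable F (y, t) ->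
  differentiable (fun x => F (x, t)) y /\
  forall w, 'd (fun x => F (x, t)) y w = 'd F (y, t) (w, 0).
Proof.
move=> Fd.
have pd : is_diff y (fun x : V1 => (x, t)) (fun w => (w, 0)).
  exact: (is_diff_pair (is_diff_id y) (is_diff_cst t y)).
have d1 : differentiable (F \o (fun x => (x, t))) y.
  by apply: differentiable_comp => //; case: pd.
split; [exact: d1|move=> w].
have pd1 : differentiable (fun x : V1 => (x, t)) y by case: pd.
have E := congr1 (fun k => k w) (diff_comp pd1 Fd).
have E2 : 'd (fun x : V1 => (x, t)) y w = (w, 0).
  by case: pd => _ e; exact: (congr1 (fun k => k w) e).
exact: (etrans E (congr1 ('d F (y, t)) E2)).
Qed.

Lemma diff_pairr (F : V1 * V2 -> W) (y : V1) (t : V2) : differentiable F (y, t) ->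
  differentiable (fun x => F (y, x)) t /\
  forall w, 'd (fun x => F (y, x)) t w = 'd F (y, t) (0, w).
Proof.
move=> Fd.
have pd : is_diff t (fun x : V2 => (y, x)) (fun w => (0, w)).
  exact: (is_diff_pair (is_diff_cst y t) (is_diff_id t)).
have d1 : differentiable (F \o (fun x => (y, x))) t.
  by apply: differentiable_comp => //; case: pd.
split; [exact: d1|move=> w].
have pd1 : differentiable (fun x : V2 => (y, x)) t by case: pd.
have E := congr1 (fun k => k w) (diff_comp pd1 Fd).
have E2 : 'd (fun x : V2 => (y, x)) t w = (0, w).
  by case: pd => _ e; exact: (congr1 (fun k => k w) e).
exact: (etrans E (congr1 ('d F (y, t)) E2)).
Qed.

End PartialDiff.

(** * The flow on the manifold, read in one chart *)

Section FlowOnManifold.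
Context {R : realType} {n : nat} {M : manifold R n} (K : M -> 'rV[R]_n)
  (c : chart R n M) (ac : atlas c).
Local Notation E := 'rV[R]_n.

Definition field_in_chart (y : E) : E := to_chart c (cinv c y) (K (cinv c y)).
Local Notation X := field_in_chart.

Lemma derive_at1 (V : normedModType R) (f : R -> V) (t : R) v :
  is_derive t 1 f v -> differentiable f t /\ 'd f t 1 = v.
Proof.
move=> [fd <-]; have fd' : differentiable f t by exact/derivable1_diffP.
by split=> //; rewrite deriveE.
Qed.

Lemma is_derive_of_diff (V : normedModType R) (f : R -> V) (t : R) :
  differentiable f t -> is_derive t 1 f ('d f t 1).
Proof. by move=> fd; split; [exact/derivable1_diffP|rewrite deriveE]. Qed.

Lemma curve_in_chart (gam : R -> M) (t : R) : {for t, continuous gam} ->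
  cdom c (gam t) ->
  is_derive t 1 (cmap (chart_at (gam t)) \o gam) (K (gam t)) ->
  is_derive t 1 (cmap c \o gam) (X (cmap c (gam t))).
Proof.
move=> gc cg /derive_at1[gd gK].
have [d1 d2] := chart_change (chart_at_atlas (gam t)) ac (chart_at_dom (gam t)) cg gc gd.
have E1 := etrans (d2 1) (congr1 ('d (cmap c \o cinv (chart_at (gam t)))
  (cmap (chart_at (gam t)) (gam t))) gK).
rewrite /X cmapK//.
have := is_derive_of_diff d1.
by move=> [? e]; split => //; exact: (etrans e E1).
Qed.

Lemma curve_of_chart (gam : R -> M) (t : R) : {for t, continuous gam} ->
  cdom c (gam t) ->
  is_derive t 1 (cmap c \o gam) (X (cmap c (gam t))) ->
  is_derive t 1 (cmap (chart_at (gam t)) \o gam) (K (gam t)).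
Proof.
move=> gc cg /derive_at1[gd gK].
have [d1 d2] := diff_into_chart_at ac cg gc gd.
have E1 := etrans (d2 1) (congr1 (of_chart c (cmap c (gam t))) gK).
have E2 : of_chart c (cmap c (gam t)) (X (cmap c (gam t))) = K (gam t).
  by rewrite /X cmapK// of_to_chart.
have := is_derive_of_diff d1.
by move=> [? e]; split => //; exact: (etrans e (etrans E1 E2)).
Qed.

Context (XC : C_on 1 (ccod c) X).

(* Two integral curves agree on an interval: the set where they agree is open
   by local uniqueness and closed because [M] is Hausdorff. *)
Lemma integral_curve_eq (gam Gam : R -> M) (a b d : R) :
  integral_curve K a b gam ->
  integral_curve K (- d) d Gam -> (forall t, - d < t < d -> cdom c (Gam t)) ->
  a < 0 < b -> gam 0 = Gam 0 ->
  forall t, a < t < b -> - d < t < d -> gam t = Gam t.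
Proof.
move=> gP GP Gc ab0 g0 t tab td.
have d0 : 0 < d by move: td; lra.
pose A := [set s : R | a < s < b /\ - d < s < d].
pose B := [set s | A s /\ gam s = Gam s].
have oA : open A.
  rewrite (_ : A = [set s | a < s] `&` [set s | s < b] `&` ([set s | - d < s] `&` [set s | s < d])).
    by apply: openI; apply: openI; [exact: open_gt|exact: open_lt|exact: open_gt|exact: open_lt].
  apply/seteqP; split => s.
    by move=> [/andP[? ?] /andP[? ?]].
  by move=> [[? ?] [? ?]]; split; apply/andP.
have cA : connected A.
  apply/connected_intervalP => u v [/andP[u1 u2] /andP[u3 u4]] [/andP[v1 v2] /andP[v3 v4]] w /andP[uw wv].
  by split; apply/andP; split; [exact: lt_le_trans u1 uw|exact: le_lt_trans wv v2|
    exact: lt_le_trans u3 uw|exact: le_lt_trans wv v4].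
have oB : open B.
  rewrite openE => s [[sab sd] gGs].
  have [gsc _] := gP s sab; have [Gsc _] := GP s sd.
  (* Only [Gam] is assumed to stay in the chart; [gam] lies in it near [s] because the curves agree
     at [s]. *)
  have Gs := Gc s sd; have gs : cdom c (gam s) by rewrite gGs.
  have gn := near_preimage gsc (cdom_open c) gs.
  have An := open_near oA (conj sab sd).
  have gD : \forall u \near s, is_derive (u : R) 1 (cmap c \o gam) (X ((cmap c \o gam) u)).
    apply: filterS2 gn An => u gu [uab _].
    by have [uc ud] := gP u uab; exact: curve_in_chart.
  have GD : \forall u \near s, is_derive (u : R) 1 (cmap c \o Gam) (X ((cmap c \o Gam) u)).
    apply: filterS An => u [_ ud].
    by have [uc ue] := GP u ud; apply: curve_in_chart => //; exact: Gc.
  have H : \forall u \near s, (cmap c \o gam) u = (cmap c \o Gam) u.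
    apply: (integral_curve_unique (@ccod_open _ _ _ c) XC _ _ gD GD) => /=.
      exact: cmap_cod.
    by rewrite gGs.
  apply: filterS2 (filterI gn An) H => u [gu Au] /= e; split => //.
  by rewrite -(cmapK gu) e cmapK//; apply: Gc; case: Au.
have oAB : open (A `\` B).
  rewrite openE => s [As nBs].
  have gGs : gam s != Gam s by apply/eqP => e; apply: nBs.
  have [gsc _] := gP s As.1; have [Gsc _] := GP s As.2.
  have := @carrier_hausdorff _ _ M; rewrite open_hausdorff => /(_ _ _ gGs).
  move=> [[P Q] /= [+ +] [oP oQ PQ]]; rewrite !inE => Ps Qs.
  apply: filterS2 (filterI (near_preimage gsc oP Ps) (near_preimage Gsc oQ Qs))
    (open_near oA As) => u [Pu Qu] Au; split => // -[_ e].
  have : (P `&` Q) (gam u) by split => //; rewrite e.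
  by move/eqP : PQ => ->.
have BA : B = A.
  apply: cA.
  - exists 0; split => //; split => //.
    by rewrite oppr_lt0 d0.
  - by exists B => //; apply/seteqP; split => s /= => [Bs|[]//]; split => //; case: Bs.
  - exists (~` (A `\` B)); first exact: open_closedC.
    apply/seteqP; split => s /= => [Bs|[As nABs]]; first by split; [case: Bs|case].
    by apply: contrapT => nBs; apply: nABs.
have Bt : B t by rewrite BA; split.
by case: Bt.
Qed.

Context (r d : R) (Phi : E -> R -> E) (p : E) (d0 : 0 < d)
  (Phi0 : forall y, Phi y 0 = y)
  (PhiD : forall y (t : R), ball p r y -> `|t| < d ->
     ccod c (Phi y t) /\ is_derive t 1 (Phi y) (X (Phi y t)))
  (PhiC : C_on 1 [set z : E * R | ball p r z.1 /\ `|z.2| < d]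
     (fun z => Phi z.1 z.2)).

Lemma flow_ball_cod y : ball p r y -> ccod c y.
Proof.
move=> yr; have [|H _] := @PhiD y 0 yr; first by rewrite normr0.
by rewrite Phi0 in H.
Qed.

Lemma flow_curve y : ball p r y -> integral_curve K (- d) d (fun t => cinv c (Phi y t)).
Proof.
move=> yr t; rewrite -ltr_norml => td; have [Pc PD] := PhiD yr td.
have gc : {for t, continuous (fun t => cinv c (Phi y t))}.
  exact: (continuous_comp (derivable1_continuous PD) (cinv_cts Pc)).
split=> //; apply: curve_of_chart => //; first exact: cinv_dom.
rewrite cinvK//; apply: near_eq_is_derive PD.
have : \forall s \near t, `|s| < d by exact: (@near_norm_lt R R).
by apply: filterS => s sd; rewrite /= cinvK//; case: (PhiD yr sd).
Qed.

(** [flow] returns the end of some integral curve, not known to stay in the chart; uniqueness on [M]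
    identifies that point with the one given by [Phi]. *)
Lemma flow_in_chart y (t : R) : ball p r y -> `|t| < d ->
  flow_defined K t (cinv c y) /\ flow K t (cinv c y) = cinv c (Phi y t).
Proof.
move=> yr td.
have reach : flow_reaches K t (cinv c y) (cinv c (Phi y t)).
  exists (- d), d, (fun t => cinv c (Phi y t)); split => //.
  - by rewrite oppr_lt0 d0.
  - by rewrite -ltr_norml.
  - exact: flow_curve.
  - by rewrite Phi0.
split; first by exists (cinv c (Phi y t)).
rewrite /flow; have := @xgetPex _ (cinv c y) [set z | flow_reaches K t (cinv c y) z].
move=> /(_ (ex_intro _ _ reach)) [a [b [gam [ab tab gP g0 <-]]]].
apply: (integral_curve_eq gP (flow_curve yr)) => //.
- by move=> s; rewrite -ltr_norml => sd; apply: cinv_dom; case: (PhiD yr sd).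
- by rewrite Phi0.
- by rewrite -ltr_norml.
Qed.

Lemma tangent_flow_in_chart y (t : R) v : ball p r y -> `|t| < d ->
  tangent_map (flow K t) (cinv c y) v =
  of_chart c (Phi y t)
    ('d (fun z : E * R => Phi z.1 z.2) (y, t) (to_chart c (cinv c y) v, 0)).
Proof.
move=> yr td; pose x := cinv c y; pose f y' := flow K t (cinv c y').
have [Pc PD] := PhiD yr td.
have yc := flow_ball_cod yr.
have cx : cdom c x by exact: cinv_dom.
(* Agreement on a whole neighbourhood of [y] is needed, since differentials are to be compared. *)
have fE : \forall y' \near y, f y' = cinv c (Phi y' t).
  have := open_near_sub (ball_open p r) yr; apply.
  by move=> y' y'r; exact: (flow_in_chart y'r td).2.
have Fd : differentiable (fun z : E * R => Phi z.1 z.2) (y, t).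
  by case: PhiC => H _; exact: H.
have [Pd PdE] := diff_pairl Fd.
have fyE : f y = cinv c (Phi y t) by exact: (flow_in_chart yr td).2.
have cf : cdom c (f y) by rewrite fyE; exact: cinv_dom.
have PE : \forall y' \near y, Phi y' t = (cmap c \o f) y'.
  have := open_near_sub (ball_open p r) yr; apply.
  move=> y' y'r; rewrite /= /f (flow_in_chart y'r td).2 cinvK//.
  by case: (PhiD y'r td).
have [fd fdE] := near_eq_differentiable PE Pd.
have fc : {for y, continuous f}.
  apply: (@near_eq_continuous _ _ (fun y' => cinv c (Phi y' t))).
    by apply: filterS fE => y' ->.
  exact: (continuous_comp (differentiable_continuous Pd) (cinv_cts Pc)).
have [hd hdE] := diff_into_chart_at ac cf fc fd.
have fyx : f y = flow K t x by [].
have hd' : differentiable ((cmap (chart_at (flow K t x)) \o flow K t) \o cinv c) (cmap c x).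
  by rewrite /x cinvK.
have E1 := diff_from_chart_at ac cx hd' v.
have K1 : cmap c x = y by exact: cinvK.
apply: (etrans E1).
apply: (etrans (congr1 (fun u => 'd ((cmap (chart_at (flow K t x)) \o flow K t) \o cinv c) u
  (to_chart c x v)) K1)).
apply: (etrans (hdE _)).
have E2 : cmap c (f y) = Phi y t by rewrite fyE cinvK.
rewrite E2; congr (of_chart c (Phi y t) _).
by apply: etrans (PdE _); exact: (congr1 (fun k => k _) fdE).
Qed.

Lemma invariance_in_chart (L : M -> E -> R) y (t : R) w :
  flow_invariant_lagrangian K L -> ball p r y -> `|t| < d ->
  in_natural_coord L c (Phi y t, 'd (fun z : E * R => Phi z.1 z.2) (y, t) (w, 0)) =
  in_natural_coord L c (y, w).
Proof.
move=> inv yr td; have [fd fE] := flow_in_chart yr td.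
have := inv t (cinv c y) (of_chart c y w) fd.
rewrite tangent_flow_in_chart// fE to_of_chart//.
exact: flow_ball_cod.
Qed.

End FlowOnManifold.

(** * Open subsets of R^m as manifolds *)

Lemma countable_image (T T' : Type) (f : T -> T') (A : set T) :
  countable A -> countable (f @` A).
Proof. exact/sub_countable/card_image_le. Qed.

Lemma second_countable_row (R : realType) (n : nat) : @second_countable 'rV[R]_n.
Proof.
pose f (qk : 'rV[rat]_n * nat) := ball (map_mx ratr qk.1 : 'rV[R]_n) (qk.2.+1%:R^-1).
exists (range f); first exact/countable_image/countableP.
split=> [_ [qk _ <-]|x V /nbhs_ballP[e /= e0 eV]]; first exact: ball_open.
(* With [h < e / 2], a ball of radius [h] whose rational centre is within [h] of [x] contains [x]
   and lies in the ball of radius [e] about [x]. *)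
have [k] := ltr_add_invr (divr_gt0 e0 (@ltr0n R 2)).
rewrite add0r => ke; set h : R := k.+1%:R^-1 in ke.
have h0 : 0 < h by rewrite invr_gt0.
have /choice[q qP] : forall i, exists q : rat, `|x 0 i - ratr q| < h.
  move=> i; have : x 0 i - h < x 0 i + h by move: h0; lra.
  move=> /rat_in_itvoo[q]; rewrite in_itv /= => /andP[q1 q2].
  by exists q; rewrite ltr_norml; apply/andP; split; lra.
pose a := map_mx ratr (\row_i q i) : 'rV[R]_n.
have ax : ball a h x.
  rewrite /ball /= /mx_ball; split => // i j.
  by rewrite !mxE ord1 /ball /= distrC.
exists (f (\row_i q i, k)); first by split => //; exists (\row_i q i, k).
move=> z az; apply: eV; apply: (@le_ball _ _ _ (h + h)); first by move: ke; lra.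
exact: ball_triangle (ball_sym ax) az.
Qed.

Lemma second_countable_set_type (T : topologicalType) (A : set T) :
  @second_countable T -> @second_countable (set_type A).
Proof.
move=> [B Bc [Bo Bb]]; exists [set (@set_val _ A) @^-1` U | U in B].
  exact: countable_image.
split=> [_ [U BU <-]|x V].
  by exists U => //; exact: Bo.
move=> [_ [[W oW <-] Wx WV]].
have [U [BU Ux] UW] := Bb (set_val x) W (open_nbhs_nbhs (conj oW Wx)).
exists (set_val @^-1` U); first by split => //; exists U.
by move=> z Uz; apply: WV; exact: UW.
Qed.

Lemma hausdorff_set_type (T : topologicalType) (A : set T) :
  hausdorff_space T -> hausdorff_space (set_type A).
Proof.
rewrite !open_hausdorff => hT x y xy.
have xy' : set_val x != set_val y by [].
have [[P Q] /= [+ +] [oP oQ PQ]] := hT _ _ xy'; rewrite !inE => Px Qy.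
exists (set_val @^-1` P, set_val @^-1` Q) => /=; first by rewrite !inE.
split; [by exists P|by exists Q|].
by apply/eqP; rewrite -preimage_setI (eqP PQ) preimage_set0.
Qed.

Section OpenSubset.
Context {R : realType} {m : nat} (A : set 'rV[R]_m) (oA : open A) (x0 : 'rV[R]_m)
  (Ax0 : A x0).

(* The value outside [A] is irrelevant. *)
Definition row_point (y : 'rV[R]_m) : set_type A :=
  match pselect (A y) with
  | left Ay => exist _ y (mem_set Ay)
  | right _ => exist _ x0 (mem_set Ax0)
  end.

Lemma row_pointK y : A y -> set_val (row_point y) = y.
Proof. by rewrite /row_point; case: pselect. Qed.

Lemma set_val_point (s : set_type A) : row_point (set_val s) = s.
Proof. by apply: val_inj; apply: row_pointK; exact: set_valP. Qed.

Lemma row_point_continuous : {within A, continuous row_point}.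
Proof.
rewrite continuous_open_subspace// => y /set_mem Ay U [_ [[W oW <-] /= Wy WU]].
rewrite row_pointK// in Wy.
have : nbhs y (A `&` W) by apply: open_nbhs_nbhs; split=> //; exact: openI.
by apply: (@filterS _ (nbhs y)) => z [Az Wz]; apply: WU; rewrite /= row_pointK.
Qed.

Lemma set_val_within : {within [set: set_type A], continuous set_val}.
Proof. by apply: continuous_subspaceT; exact: initial_continuous. Qed.

Definition open_subset_chart : chart R m (set_type A) :=
  @Chart R m (set_type A) setT A set_val row_point openT oA
    (fun s _ => set_valP s) (fun _ _ => I) (fun s _ => set_val_point s)
    row_pointK set_val_within row_point_continuous.

Lemma open_subset_transition c c' :
  [set open_subset_chart] c -> [set open_subset_chart] c' -> forall k,
    C_on k (ccod c `&` cinv c @^-1` cdom c') (cmap c' \o cinv c).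
Proof.
move=> -> -> k /=; rewrite preimage_setT setIT.
apply: (@C_on_congr _ _ _ k A id); [exact: oA| |exact: C_on_id].
by move=> y Ay /=; rewrite row_pointK.
Qed.

(** One global chart, the inclusion, preferred at every point: tangent vectors of the slice are
    plain rows, equal to their components. *)
Definition open_subset_manifold : manifold R m :=
  @Manifold R m (set_type A) [set open_subset_chart] (fun=> open_subset_chart)
    (fun=> erefl) (fun=> I) open_subset_transition
    (@hausdorff_set_type _ A (@norm_hausdorff _ _))
    (@second_countable_set_type _ A (second_countable_row R m)).

End OpenSubset.

(** * C^1 calculus for scalar functions and for affine maps of rows *)

Section ScalarC1.
Context {R : realType} {V : normedModType R}.
Implicit Types (U : set V) (f g : V -> R).

Lemma C1M U f g : open U -> C_on 1 U f -> C_on 1 U g ->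
  C_on 1 U (fun x => f x * g x).
Proof.
move=> oU [fd fc] [gd gc]; split=> [x Ux|v x Ux].
  exact: differentiableM (fd x Ux) (gd x Ux).
apply: (@near_eq_continuous _ _ (fun y => f y *: 'D_v g y + g y *: 'D_v f y)).
  apply: (open_near_sub oU Ux) => y Uy.
  have [f1 g1] := (diff_derivable (v := v) (fd y Uy), diff_derivable (v := v) (gd y Uy)).
  exact/esym/(deriveM f1 g1).
have fx := differentiable_continuous (fd x Ux).
have gx := differentiable_continuous (gd x Ux).
by apply: continuousD; apply: continuousZ => //; [exact: gc|exact: fc].
Qed.

Lemma C1V U f : open U -> (forall x, U x -> f x != 0) -> C_on 1 U f ->
  C_on 1 U (fun x => (f x)^-1).
Proof.
move=> oU f0 [fd fc]; split=> [x Ux|v x Ux].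
  exact: differentiableV (fd x Ux) (f0 x Ux).
apply: (@near_eq_continuous _ _ (fun y => - (f y ^- 2) *: 'D_v f y)).
  apply: (open_near_sub oU Ux) => y Uy.
  exact/esym/(deriveV (f0 y Uy) (diff_derivable (v := v) (fd y Uy))).
have fx := differentiable_continuous (fd x Ux).
apply: continuousZ; last exact: fc.
apply: continuousN; apply: continuousV; first by rewrite expf_neq0// f0.
exact: (continuousM fx fx).
Qed.

Lemma C1D U f g : open U -> C_on 1 U f -> C_on 1 U g ->
  C_on 1 U (fun x => f x + g x).
Proof.
move=> oU [fd fc] [gd gc]; split=> [x Ux|v x Ux].
  exact: differentiableD (fd x Ux) (gd x Ux).
apply: (@near_eq_continuous _ _ (fun y => 'D_v f y + 'D_v g y)).
  apply: (open_near_sub oU Ux) => y Uy.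
  exact/esym/(deriveD (diff_derivable (v := v) (fd y Uy)) (diff_derivable (v := v) (gd y Uy))).
by apply: continuousD; [exact: fc|exact: gc].
Qed.

Lemma C1_sum (I : finType) U (F : I -> V -> R) : open U ->
  (forall i, C_on 1 U (F i)) -> C_on 1 U (fun x => \sum_i F i x).
Proof.
move=> oU FC; rewrite (_ : (fun x => _) = \sum_i F i); last first.
  by apply/funext => x; rewrite fct_sumE.
elim/big_rec : _ => [|i f _ fC]; first exact: C_on_cst.
exact: C1D (FC i) fC.
Qed.

End ScalarC1.

Section RowCalculus.
Context {R : realType}.

Lemma linear_row_continuous n (W : normedModType R) (f : {linear 'rV[R]_n -> W}) :
  continuous f.
Proof.
apply: bounded_linear_continuous; apply/linear_boundedP.
exists (\sum_(i < n) `|f (delta_mx 0 i)|); split; first exact: num_real.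
move=> C /ltW CM v; apply: le_trans (ler_wpM2r (normr_ge0 v) CM).
rewrite {1}(row_sum_delta v) linear_sum mulr_suml.
apply: (le_trans (ler_norm_sum _ _ _)); apply: ler_sum => i _.
rewrite linearZ normrZ mulrC ler_pM//; exact: row_norm_coord.
Qed.

Lemma norm_le_distD (W : normedModType R) (a b : W) : `|b| <= `|a| + `|a - b|.
Proof. by rewrite -[X in `|X| <= _](subKr a) ler_normB. Qed.

Lemma C1_diff_bound n (W : normedModType R) (U : set 'rV[R]_n) (f : 'rV[R]_n -> W) a :
  open U -> U a -> C_on 1 U f -> exists2 C, 0 < C &
    \forall x \near a, forall v, `|'d f x v| <= C * `|v|.
Proof.
move=> oU Ua fC; have [_ fc] := (C1P f oU).1 fC.
pose e i : 'rV[R]_n := delta_mx 0 i.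
exists (\sum_i (`|'d f a (e i)| + 1) + 1).
  by rewrite ltr_wpDl// sumr_ge0// => i _; rewrite addr_ge0.
have : \forall x \near a, forall i, `|'d f a (e i) - 'd f x (e i)| <= 1.
  near=> x; near: x; apply: filter_forall => i.
  exact: ((continuous_distP _ _).1 (fc (e i) a Ua)).
apply: (@filterS _ (nbhs a)) => x xi v.
have dE : 'd f x v = \sum_i v 0 i *: 'd f x (e i).
  rewrite {1}(row_sum_delta v) linear_sum.
  by apply: eq_bigr => i _; rewrite linearZ.
apply: (eq_ind_r (fun q => `|q| <= _) _ dE).
apply: (le_trans (ler_norm_sum _ _ _)).
rewrite mulrDl mul1r mulr_suml; apply: ler_wpDr => //; apply: ler_sum => i _.
rewrite normrZ mulrC; apply: ler_pM => //; last exact: row_norm_coord.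
apply: (le_trans (norm_le_distD ('d f a (e i)) _)).
by rewrite lerD2l; exact: xi.
Unshelve. all: by end_near. Qed.

Lemma row_linear_sum n (W : normedModType R) (f : {linear 'rV[R]_n -> W}) v :
  f v = \sum_i v 0 i *: f (delta_mx 0 i).
Proof.
rewrite {1}(row_sum_delta v) linear_sum.
by apply: eq_bigr => i _; rewrite linearZ.
Qed.

Lemma C1_coord n (U : set 'rV[R]_n) i : C_on 1 U (fun v : 'rV[R]_n => v 0 i).
Proof.
split=> [x _|v x _]; first exact: differentiable_coord.
rewrite (_ : 'D_v _ = cst (v 0 i)); first exact: cst_continuous.
apply/funext => y; have := derive_coord i (is_derive_id y v).
by case.
Qed.

Lemma diff_affine m n (a : 'rV[R]_n) (B : 'M[R]_(m, n)) (y : 'rV[R]_m) :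
  is_diff y (fun y => a + y *m B) (mulmxr B).
Proof.
pose f : {linear 'rV[R]_m -> 'rV[R]_n} := mulmxr B.
have fc : continuous f by exact: linear_row_continuous.
have fD : is_diff y f f by split; [exact: linear_differentiable|exact: diff_lin].
by have := is_diffD (is_diff_cst a y) fD; rewrite add0r.
Qed.

Lemma C1_affine m n (a : 'rV[R]_n) (B : 'M[R]_(m, n)) U :
  C_on 1 U (fun y => a + y *m B).
Proof.
split=> [x _|v x _]; first by have [] := diff_affine a B x.
rewrite (_ : 'D_v _ = cst (v *m B)); first exact: cst_continuous.
apply/funext => y; have [fd fE] := diff_affine a B y.
by rewrite deriveE// fE.
Qed.

End RowCalculus.

(** * The Lagrangian in a chart *)

Section FormNorm.
Context {R : realType} {n : nat} {M : manifold R n}.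
Implicit Types (nrm : M -> 'rV[R]_n -> R) (A : 'rV[R]_n -> R).

(** [nrm] is arbitrary, so its unit ball may be empty; [sup] is then 0 and [0 <= B] takes over. *)
Lemma form_norm_le nrm x A (B : R) : 0 <= B ->
  (forall w, nrm x w <= 1 -> `|A w| <= B) -> form_norm nrm x A <= B.
Proof.
move=> B0 AB; rewrite /form_norm.
have [ne|e] := pselect ([set `|A w| | w in [set w | nrm x w <= 1]] !=set0).
  by apply: ge_sup => // _ [w /AB ? <-].
rewrite sup_out// => -[? _]; exact: e.
Qed.

(** A bound on the unit ball must be known beforehand: [sup] of an unbounded set is a default value
    and dominates nothing. *)
Lemma le_form_norm nrm x A (B : R) w :
  (forall w, nrm x w <= 1 -> `|A w| <= B) -> nrm x w <= 1 ->
  `|A w| <= form_norm nrm x A.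
Proof.
move=> AB w1; apply: ub_le_sup; last by exists w.
by exists B => _ [u /AB ? <-].
Qed.

End FormNorm.

Section LagrangianInChart.
Context {R : realType} {n : nat} {M : manifold R n} (c : chart R n M) (ac : atlas c).
Local Notation E := 'rV[R]_n.
Implicit Types (L : M -> E -> R) (y v w : E).

Lemma lagrangian_to_chart L y u : ccod c y ->
  L (cinv c y) u = in_natural_coord L c (y, to_chart c (cinv c y) u).
Proof.
move=> cy; have := of_to_chart u ac (cinv_dom cy).
by rewrite cinvK// /in_natural_coord /= => ->.
Qed.

Lemma partial_v_in_chart L y v w : ccod c y ->
  differentiable (in_natural_coord L c) (y, v) ->
  partial_v L (cinv c y) (of_chart c y v) (of_chart c y w) =
  'd (in_natural_coord L c) (y, v) (0, w).
Proof.
move=> cy Ld; have cx := cinv_dom cy.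
have [hd hE] := diff_pairr Ld.
rewrite /partial_v.
have LE : L (cinv c y) = (fun u => in_natural_coord L c (y, u)) \o to_chart c (cinv c y).
  by apply/funext => u; exact: lagrangian_to_chart.
have tc : continuous (to_chart c (cinv c y)) by exact: to_chart_continuous.
have td : differentiable (to_chart c (cinv c y)) (of_chart c y v).
  exact: linear_differentiable.
have tE := to_of_chart v ac cy.
have hd' : differentiable (fun u => in_natural_coord L c (y, u))
    (to_chart c (cinv c y) (of_chart c y v)) by rewrite tE.
rewrite LE deriveE; last exact: differentiable_comp.
apply: (etrans (congr1 (fun k => k _) (diff_comp td hd'))) => /=.
have E1 : 'd (to_chart c (cinv c y)) (of_chart c y v) (of_chart c y w) = w.
  apply: (etrans (congr1 (fun k => k _) (diff_lin (of_chart c y v) tc))).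
  exact: to_of_chart.
apply: (etrans (congr1 ('d (fun u => in_natural_coord L c (y, u))
  (to_chart c (cinv c y) (of_chart c y v))) E1)).
apply: (etrans (congr1 (fun u => 'd (fun u => in_natural_coord L c (y, u)) u w) tE)).
exact: hE.
Qed.

Lemma partial_x_in_chart L y v w : ccod c y ->
  differentiable (in_natural_coord L c) (y, v) ->
  partial_x L c (cinv c y) (of_chart c y v) (of_chart c y w) =
  'd (in_natural_coord L c) (y, v) (w, 0).
Proof.
move=> cy Ld; rewrite /partial_x !to_of_chart// cinvK//.
have [hd hE] := diff_pairl Ld.
transitivity (\sum_i w 0 i *: 'd (in_natural_coord L c) (y, v) (delta_mx 0 i, 0)).
  by apply: eq_bigr => i _; rewrite deriveE//; exact: mulrC.
apply: esym; apply: (etrans (esym (hE w))).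
apply: (etrans (row_linear_sum _ w)).
apply: eq_bigr => i _; congr (_ *: _); exact: hE.
Qed.

End LagrangianInChart.

(** * Comparison of the coordinate norm with the metric *)

Section MetricBound.
Context {R : realType} {n : nat} {M : manifold R n} (g : riemannian_metric M)
  (c : chart R n M) (ac : atlas c).
Local Notation E := 'rV[R]_n.

Let G i j (y : E) : R :=
  g (cinv c y) (of_chart c y (delta_mx 0 i)) (of_chart c y (delta_mx 0 j)).

Let gc (z : E * E) : R := g (cinv c z.1) (of_chart c z.1 z.2) (of_chart c z.1 z.2).

Let gcE z : gc z = \sum_i \sum_j z.2 0 i * z.2 0 j * G i j z.1.
Proof.
rewrite /gc; set x := cinv c z.1.
have lin1 (u : E) : scalar (fun w => g x u (of_chart c z.1 w)).
  move=> a v w; rewrite of_chart_linear Defs.metric_sym metric_linear.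
  by rewrite ![g x _ u]Defs.metric_sym.
have expand (u w : E) : g x u (of_chart c z.1 w) =
    \sum_i w 0 i * g x u (of_chart c z.1 (delta_mx 0 i)).
  pose f : {scalar E} := HB.pack (fun w => g x u (of_chart c z.1 w))
    (GRing.isLinear.Build _ _ _ _ (fun w => g x u (of_chart c z.1 w)) (lin1 u)).
  exact: (row_linear_sum f).
rewrite expand; apply: eq_bigr => i _.
rewrite Defs.metric_sym expand mulr_sumr; apply: eq_bigr => j _.
by rewrite mulrA Defs.metric_sym [X in X = _]mulrC [X in _ = X]mulrC /G Defs.metric_sym.
Qed.

Let gc_continuous z : ccod c z.1 -> {for z, continuous gc}.
Proof.
move=> cz.
have -> : gc = \sum_i \sum_j (fun z : E * E => z.2 0 i * z.2 0 j * G i j z.1).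
  by apply/funext => q; rewrite gcE fct_sumE; apply: eq_bigr => i _; rewrite fct_sumE.
elim/big_ind : _ => [|f h|i _]; [exact: cst_continuous|exact: continuousD|].
elim/big_ind : _ => [|f h|j _]; [exact: cst_continuous|exact: continuousD|].
have cc k : {for z, continuous (fun z : E * E => z.2 0 k)}.
  apply: (@continuous_comp _ _ _ snd (fun v : E => v 0 k)); first exact: cvg_snd.
  exact: coord_continuous.
apply: continuousM; first exact: continuousM.
apply: (@continuous_comp _ _ _ fst (G i j)); first exact: cvg_fst.
exact: (metric_smooth g ac (delta_mx 0 i) (delta_mx 0 j) 0%N z.1 cz).
Qed.

Let gcZ y a w : gc (y, a *: w) = a ^+ 2 * gc (y, w).
Proof.
rewrite !gcE /= mulr_sumr; apply: eq_bigr => i _; rewrite mulr_sumr.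
by apply: eq_bigr => j _; rewrite !mxE; ring.
Qed.

(* Compactness of the unit sphere gives the bound at nearby points for unit
   vectors, with a constant [e] that also ranges over a neighbourhood of [0]. *)
Lemma gnorm_chart_bound y0 : ccod c y0 -> exists2 k : R, 0 < k &
  \forall y \near y0, forall w, `|w| <= k * Defs.gnorm g (cinv c y) (of_chart c y w).
Proof.
move=> cy0; pose K : set E := [set w | `|w| = 1].
have cK : compact K.
  apply: bounded_closed_compact.
    by exists 1; split; [exact: num_real|move=> x x1 w /= ->; exact: ltW].
  rewrite (_ : K = (fun w => `|w|) @^-1` [set 1 : R])//.
  by apply: closed_comp; [move=> x _; exact: norm_continuous|exact: closed_eq].
have pos w : K w -> 0 < gc (y0, w).
  move=> Kw; apply: Defs.metric_pos; apply/eqP => w0.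
  have := to_of_chart w ac cy0; rewrite w0 /to_chart linear0 => w0'.
  by move: Kw; rewrite /K /= -w0' normr0 => /esym/eqP; rewrite oner_eq0.
have : \forall q \near (y0, 0 : R), K `<=` (fun w => q.2 < gc (q.1, w)).
  apply: ((@compact_near_coveringP _ _).1 cK (E * R)%type (nbhs (y0, 0 : R))
    (fun q w => q.2 < gc (q.1, w)) (@nbhs_filter _ _)) => w Kw.
  have cf : {for (w, (y0, 0 : R)), continuous
      (fun q : E * (E * R) => gc (q.2.1, q.1) - q.2.2)}.
    have c2 : {for (w, (y0, 0 : R)), continuous (fun q : E * (E * R) => q.2)}.
      exact: cvg_snd.
    apply: continuousB; last exact: (continuous_comp c2 cvg_snd).
    apply: (@continuous_comp _ _ _ (fun q : E * (E * R) => (q.2.1, q.1)) gc).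
      apply: continuous_pair; last exact: cvg_fst.
      exact: (continuous_comp c2 cvg_fst).
    exact: gc_continuous.
  have := near_preimage cf (@open_gt _ 0) _.
  rewrite /= subr0 => /(_ (pos w Kw)).
  by apply: filterS => q /=; rewrite subr_gt0.
move=> [[P Q] /= [Py0 Q0] PQ].
have [e e0 Qe] : exists2 e : R, 0 < e & Q e.
  have [r /= r0 rQ] := (nbhs_ballP _ _).1 Q0.
  exists (r / 2); first by rewrite divr_gt0.
  apply: rQ; rewrite /ball /= sub0r normrN gtr0_norm ?divr_gt0//.
  by rewrite ltr_pdivrMr// ltr_pMr// ltr1n.
(* By homogeneity, a lower bound [e] for the metric on coordinate unit vectors gives
   [e * |w| ^+ 2 <= g w w], hence this factor. *)
exists (Num.sqrt e)^-1; first by rewrite invr_gt0 sqrtr_gt0.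
apply: (@filterS _ (nbhs y0)) Py0 => y Py w.
have [->|w0] := eqVneq w 0; first by rewrite normr0 mulr_ge0 ?invr_ge0 ?sqrtr_ge0.
have wp : 0 < `|w| by rewrite normr_gt0.
have := PQ (y, e) (conj Py Qe) (`|w|^-1 *: w).
rewrite /K /= normrZ normfV normr_id mulVf ?gt_eqF// => /(_ erefl) H.
rewrite mulrC ler_pdivlMr ?sqrtr_gt0// /Defs.gnorm.
move: H; rewrite gcZ exprVn mulrC ltr_pdivlMr ?exprn_gt0// => H.
rewrite -(normr_id w) -sqrtr_sqr -sqrtrM ?sqr_ge0// ler_wsqrtr// mulrC.
exact: ltW.
Qed.

End MetricBound.

Section FormsInChart.
Context {R : realType} {n : nat} {M : manifold R n} (c : chart R n M) (ac : atlas c)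
  (L : M -> 'rV[R]_n -> R) (K : M -> 'rV[R]_n) (Q : M -> {scalar 'rV[R]_n})
  (dd : M -> R) (hS : condition_S L K Q dd).
Local Notation E := 'rV[R]_n.
Local Notation X := (field_in_chart K c).
Local Notation Lc := (in_natural_coord L c).

Definition form_in_chart (y w : E) : R := Q (cinv c y) (of_chart c y w).
Local Notation q := form_in_chart.
Definition charge_in_chart (y : E) : R := Q (cinv c y) (K (cinv c y)).
Local Notation k := charge_in_chart.

Lemma form_in_chart_linear y : scalar (q y).
Proof. by move=> a u v; rewrite /q of_chart_linear linearP. Qed.

Definition form_in_chart_map y : {scalar E} :=
  HB.pack (q y) (GRing.isLinear.Build _ _ _ _ (q y) (form_in_chart_linear y)).

Lemma form_in_chart_sum y w : q y w = \sum_i w 0 i * q y (delta_mx 0 i).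
Proof. exact: (row_linear_sum (form_in_chart_map y)). Qed.

Lemma form_C1 w : C_on 1 (ccod c) (fun y => q y w).
Proof. by case: hS => _ _ [QC _ _] _; exact: QC. Qed.

Lemma lagrangian_C1 : C_on 1 (ccod c `*` [set: E]) Lc.
Proof. by case: hS => LC _ _ _; exact: LC. Qed.

Lemma phase_open : open (ccod c `*` [set: E]).
Proof.
rewrite (_ : _ `*` _ = fst @^-1` ccod c); last first.
  by apply/seteqP; split => z; [case|split].
by apply: open_comp; [move=> z _; exact: cvg_fst|exact: ccod_open].
Qed.

Lemma lagrangian_diff y w : ccod c y -> differentiable Lc (y, w).
Proof. by move=> cy; have [H _] := lagrangian_C1; exact: H. Qed.

Lemma field_C1 : C_on 1 (ccod c) X.
Proof. by case: hS => _ [KC _] _ _; exact: KC. Qed.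

Lemma of_chart_field y : ccod c y -> of_chart c y (X y) = K (cinv c y).
Proof.
move=> cy; have := of_to_chart (K (cinv c y)) ac (cinv_dom cy).
by rewrite cinvK.
Qed.

Lemma chargeE y : ccod c y -> k y = q y (X y).
Proof. by move=> cy; rewrite /q of_chart_field. Qed.

Lemma charge_lt0 y : k y < 0.
Proof. by case: hS => _ _ _ [_]; exact. Qed.

Lemma charge_C1 : C_on 1 (ccod c) k.
Proof.
apply: (@C_on_congr _ _ _ 1 (ccod c) (fun y => \sum_i X y 0 i * q y (delta_mx 0 i))).
- exact: ccod_open.
- by move=> y cy; rewrite chargeE// form_in_chart_sum.
- apply: C1_sum; first exact: ccod_open.
  move=> i; apply: C1M; [exact: ccod_open| |exact: form_C1].
  have := C1_comp (fin_basis_row n) (@ccod_open _ _ _ c) openT field_C1 (C1_coord setT i).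
  by rewrite preimage_setT setIT.
Qed.

Lemma noether_in_chart y w : ccod c y -> 'd Lc (y, w) (0, X y) = q y w + dd (cinv c y).
Proof.
move=> cy; rewrite -partial_v_in_chart//; last exact: lagrangian_diff.
rewrite of_chart_field//.
by case: hS => _ _ [_ _ NE] _; exact: NE.
Qed.

Lemma lagrangian_expansion y w (t : R) : ccod c y ->
  Lc (y, w + t *: X y) =
  Lc (y, w) + t * (q y w + dd (cinv c y)) + t ^+ 2 / 2 * k y.
Proof.
move=> cy; pose a := q y w + dd (cinv c y).
pose f s := Lc (y, w + s *: X y).
have fD (s : R) : is_derive s 1 f (a + s * k y).
  have [hd hE] := diff_pairr (lagrangian_diff (w + s *: X y) cy).
  have E1 : 'd (fun u => Lc (y, u)) (w + s *: X y) (X y) = a + s * k y.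
    apply: (etrans (hE _)); rewrite noether_in_chart// chargeE//.
    rewrite /a addrAC; congr (_ + _).
    rewrite -[LHS]/(form_in_chart_map y (w + s *: X y)).
    by rewrite linearD linearZ.
  exact: (eq_ind _ (fun v => is_derive s 1 f v) (diff_line hd) _ E1).
(* [f] minus the nonconstant part of the expected polynomial; its derivative vanishes, so it keeps
   its value at 0. *)
pose h := f - (fun s : R => s *: a) - (fun s : R => s * (s *: (k y / 2))).
have hD (s : R) : is_derive s 1 h 0.
  have H := is_deriveB (is_deriveB (fD s) (is_derive_line a s))
    (is_deriveM (is_derive_id s (1 : R)) (is_derive_line (k y / 2) s)).
  have E0 : a + s * k y - a - (s *: (k y / 2) + (s *: (k y / 2)) *: 1) = 0.
    by rewrite /GRing.scale /=; field.
  exact: (eq_ind _ (fun v : R => is_derive s 1 h v) H _ E0).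
have := is_derive_0_is_cst t 0 hD; rewrite /h !fctE /f !scale0r mul0r !subr0 addr0.
rewrite /GRing.scale /= => e.
have -> : Lc (y, w + t *: X y) =
   Lc (y, w + t *: X y) - t * a - t * (t * (k y / 2)) + t * a + t * (t * (k y / 2)) by ring.
by rewrite e /a; field.
Qed.

(** The coordinate form of [L - L_c]. It is quadratic in the vector with C^1 coefficients [Fij],
    which yields both its regularity and its growth. *)
Definition charge_quadratic (z : E * E) : R := q z.1 z.2 ^+ 2 / k z.1.
Local Notation Fq := charge_quadratic.

Let Fij i j (y : E) : R := q y (delta_mx 0 i) * q y (delta_mx 0 j) * (k y)^-1.

Let Fij_C1 i j : C_on 1 (ccod c) (Fij i j).
Proof.
apply: C1M; [exact: ccod_open| |].
  by apply: C1M; [exact: ccod_open|exact: form_C1|exact: form_C1].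
apply: C1V; [exact: ccod_open| |exact: charge_C1].
by move=> y _; rewrite lt_eqF// charge_lt0.
Qed.

Let FqE z : Fq z = \sum_i \sum_j (z.2 0 i * z.2 0 j) * Fij i j z.1.
Proof.
rewrite /Fq form_in_chart_sum expr2 mulr_suml mulr_suml; apply: eq_bigr => i _.
rewrite mulr_sumr mulr_suml; apply: eq_bigr => j _.
by rewrite /Fij; ring.
Qed.

Lemma C1_fst (W : normedModType R) (f : E -> W) : C_on 1 (ccod c) f ->
  C_on 1 (ccod c `*` [set: E]) (fun z : E * E => f z.1).
Proof.
move=> fC.
have C1f : C_on 1 [set: E * E] (fst : E * E -> E).
  by apply: (@C1_linear _ _ _ setT (fst : {linear (E * E)%type -> E})) => z; exact: cvg_fst.
have := C1_comp (fin_basis_row n) openT (@ccod_open _ _ _ c) C1f fC.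
apply: C_on_sub => z [cz _]; by split.
Qed.

Lemma charge_quadratic_C1 : C_on 1 (ccod c `*` [set: E]) Fq.
Proof.
rewrite (_ : Fq = fun z => \sum_i \sum_j (z.2 0 i * z.2 0 j) * Fij i j z.1); last first.
  by apply/funext => z; exact: FqE.
have oP := phase_open.
have cC i : C_on 1 (ccod c `*` [set: E]) (fun z : E * E => z.2 0 i).
  have C1f : C_on 1 [set: E * E] (snd : E * E -> E).
    by apply: (@C1_linear _ _ _ setT (snd : {linear (E * E)%type -> E})) => z; exact: cvg_snd.
  have := C1_comp (fin_basis_row n) openT openT C1f (C1_coord setT i).
  by apply: C_on_sub => z _; split.
apply: C1_sum; [exact: oP|move=> i]; apply: C1_sum; [exact: oP|move=> j].
apply: C1M; [exact: oP| |exact: C1_fst (Fij_C1 i j)].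
by apply: C1M; [exact: oP|exact: cC|exact: cC].
Qed.

Lemma charge_quadratic_diff y w : ccod c y -> differentiable Fq (y, w).
Proof. by move=> cy; have [H _] := charge_quadratic_C1; exact: H. Qed.

Lemma charge_quadratic_diffr y w b : ccod c y ->
  'd Fq (y, w) (0, b) = 2 * q y w * q y b / k y.
Proof.
move=> cy; have [hd hE] := diff_pairr (charge_quadratic_diff w cy).
apply: (etrans (esym (hE b))).
have FE : (fun u => Fq (y, u)) = (k y)^-1 *: ((form_in_chart_map y : E -> R) ^+ 2).
  by apply/funext => u; rewrite /Fq /= mulrC.
have qc : continuous (form_in_chart_map y) by exact: linear_row_continuous.
have qD : is_diff w (form_in_chart_map y) (form_in_chart_map y).
  by split; [exact: linear_differentiable|exact: diff_lin].
have [_ H] := is_diffZ (k y)^-1 (is_diffX 1 qD).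
have := congr1 (fun f => f b) H; rewrite -FE => ->.
rewrite !fctE /GRing.scale /= -/(q y w) -/(q y b) expr1; ring.
Qed.

(** Only the coefficients [Fij] depend on the base point, so a base derivative stays quadratic in
    [w]: exactly the growth that (G) permits. *)
Lemma charge_quadratic_diffl y0 : ccod c y0 -> exists2 C, 0 < C &
  \forall y \near y0, forall a w, `|'d Fq (y, w) (a, 0)| <= C * `|a| * `|w| ^+ 2.
Proof.
move=> cy0.
have bnd i j := C1_diff_bound (@ccod_open _ _ _ c) cy0 (Fij_C1 i j).
have /choice[C CP] : forall ij : 'I_n * 'I_n, exists C : R, 0 < C /\
    \forall y \near y0, forall a, `|'d (Fij ij.1 ij.2) y a| <= C * `|a|.
  by move=> [i j]; have [C C0 CC] := bnd i j; exists C.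
exists (\sum_i \sum_j C (i, j) + 1).
  by rewrite ltr_wpDl// sumr_ge0// => i _; rewrite sumr_ge0// => j _; rewrite ltW//; case: (CP (i, j)).
have H : \forall y \near y0, ccod c y /\ forall ij : 'I_n * 'I_n, forall a,
    `|'d (Fij ij.1 ij.2) y a| <= C ij * `|a|.
  near=> y; split.
    by near: y; exact: (open_near (@ccod_open _ _ _ c) cy0).
  by near: y; apply: filter_forall => ij; case: (CP ij).
apply: (@filterS _ (nbhs y0)) H => y [cy yb] a w.
have [hd hE] := diff_pairl (charge_quadratic_diff w cy).
have Fd i j : derivable (Fij i j) y a.
  by apply: diff_derivable; have [H _] := Fij_C1 i j; exact: H.
have dE : 'd Fq (y, w) (a, 0) =
    \sum_i \sum_j (w 0 i * w 0 j) * 'D_a (Fij i j) y.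
  apply: (etrans (esym (hE a))); rewrite -deriveE//.
  have -> : (fun x => Fq (x, w)) = \sum_i \sum_j (w 0 i * w 0 j) *: Fij i j.
    apply/funext => x; rewrite FqE fct_sumE; apply: eq_bigr => i _.
    by rewrite fct_sumE.
  rewrite derive_sum.
    apply: eq_bigr => i _; rewrite derive_sum.
      by apply: eq_bigr => j _; rewrite deriveZ.
    by move=> j; exact: derivableZ.
  by move=> i; apply: derivable_sum => j; exact: derivableZ.
rewrite dE (le_trans (ler_norm_sum _ _ _))//.
rewrite -mulrA mulrDl mul1r mulr_suml ler_wpDr ?mulr_ge0 ?exprn_ge0//.
apply: ler_sum => i _; rewrite mulr_suml (le_trans (ler_norm_sum _ _ _))//.
apply: ler_sum => j _; rewrite normrM mulrA [leRHS]mulrC ler_pM//.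
  by rewrite normrM expr2 ler_pM// row_norm_coord.
have Fd' : differentiable (Fij i j) y by have [H _] := Fij_C1 i j; exact: H.
by rewrite deriveE//; exact: (yb (i, j)).
Unshelve. all: by end_near. Qed.

Lemma reduced_lagrangian_in_chart :
  in_natural_coord (L_c L K Q) c = Lc \- Fq.
Proof. by []. Qed.

End FormsInChart.

(** In the application [k] and [k0] are Q(K) at a point and at the centre, [s] is the squared norm
    of a slice vector, [b] the square of [q] on it, and [a] is [(eta * kap) ^+ 2]. Since
    [- k > - k0 / 2], replacing [k] by [k0] costs a factor 2, whence the 4 in the condition on
    [a]. *)
Lemma convexity_loss (R : realFieldType) (k k0 mu s b a : R) :
  k < k0 / 2 -> 0 < - k0 -> 0 <= s -> 0 <= mu -> b <= a * s ->
  4 * a <= mu / 2 * - k0 -> - (mu / 2 * s) <= 2 * b / k.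
Proof.
move=> kk k00 s0 mu0 bs a4; have nk : 0 < - k by move: kk k00; lra.
rewrite lerNl -mulrN -invrN ler_pdivrMr//.
have as4 := ler_wpM2r s0 a4.
have ms : 0 <= mu * s by rewrite mulr_ge0.
have := ler_wpM2l ms (_ : - k0 / 2 <= - k); rewrite (_ : - k0 / 2 <= - k); last by move: kk; lra.
move=> /(_ isT) H; move: bs as4 H; lra.
Qed.

(** Along [w2 - w1], the derivatives of the quadratic term at [w2] and [w1] differ by
    [2 * b ^+ 2 / k1] with [b] the value of [q] on [w2 - w1]; the individual values [a1], [a2]
    cancel. So the loss is governed by [q] on the increment alone. *)
Lemma convexity_balance (R : realFieldType) (A1 A2 r1 r2 f1 f2 a1 a2 b k1 l1 m : R) :
  A1 = r1 + f1 -> A2 = r2 + f2 ->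
  f1 = 2 * a1 * b / k1 -> f2 = 2 * a2 * b / k1 -> a2 = a1 + b ->
  l1 <= r2 - r1 -> - m <= 2 * b ^+ 2 / k1 -> m + m <= l1 -> m <= A2 - A1.
Proof.
move=> -> -> -> -> -> Hr Hm Hl.
have E2 : 2 * (a1 + b) * b / k1 = 2 * a1 * b / k1 + 2 * b ^+ 2 / k1 by ring.
by rewrite E2; move: Hr Hm Hl; lra.
Qed.

(** * Uniform bounds for the Lagrangian near a point *)

Section LocalEstimates.
Context {R : realType} {n : nat} {M : manifold R n} (c : chart R n M) (ac : atlas c)
  (g : riemannian_metric M)
  (L : M -> 'rV[R]_n -> R) (K : M -> 'rV[R]_n) (Q : M -> {scalar 'rV[R]_n})
  (dd : M -> R) (hS : condition_S L K Q dd) (hG : condition_G g L K Q).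
Local Notation E := 'rV[R]_n.
Local Notation Lc := (in_natural_coord L c).
Local Notation q := (form_in_chart c Q).
Local Notation k := (charge_in_chart c K Q).
Local Notation Fq := (charge_quadratic c K Q).
Local Notation Lr := (in_natural_coord (L_c L K Q) c).

Definition norm_in_chart (y w : E) : R := Defs.gnorm g (cinv c y) (of_chart c y w).
Local Notation N := norm_in_chart.

Let N0 y w : 0 <= N y w. Proof. exact: sqrtr_ge0. Qed.

Lemma reduced_lagrangian_diff y w : ccod c y -> differentiable Lr (y, w).
Proof.
move=> cy; rewrite (_ : Lr = Lc - Fq); last by apply/funext.
exact: (differentiableB (lagrangian_diff ac hS w cy) (charge_quadratic_diff ac hS w cy)).
Qed.

Lemma lagrangian_diff_split y w v : ccod c y ->
  'd Lc (y, w) v = 'd Lr (y, w) v + 'd Fq (y, w) v.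
Proof.
move=> cy; have Ld := reduced_lagrangian_diff w cy.
have Fd := charge_quadratic_diff ac hS w cy.
have LE : Lc = Lr + Fq.
  by apply/funext => z; rewrite reduced_lagrangian_in_chart /= !fctE subrK.
rewrite LE.
exact: (congr1 (fun f => f v) (diffD Ld Fd)).
Qed.

Lemma near_continuous_le (C : M -> R) y0 : ccod c y0 ->
  {for (cinv c y0), continuous C} ->
  \forall y \near y0, C (cinv c y) <= C (cinv c y0) + 1.
Proof.
move=> cy0 Cc.
have := near_preimage (continuous_comp (cinv_cts cy0) Cc)
  (@open_lt _ (C (cinv c y0) + 1)).
rewrite /= ltrDl => /(_ ltr01).
by apply: (@filterS _ (nbhs y0)) => y; exact: ltW.
Qed.

Lemma form_near y0 (eta : R) : ccod c y0 -> 0 < eta ->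
  \forall y \near y0, forall w, `|q y w - q y0 w| <= eta * `|w|.
Proof.
move=> cy0 eta0; have n0 : 0 < n%:R + 1 :> R by rewrite ltr_wpDl.
have e0 : 0 < eta / (n%:R + 1) by rewrite divr_gt0.
have H : \forall y \near y0, forall i,
    `|q y0 (delta_mx 0 i) - q y (delta_mx 0 i)| <= eta / (n%:R + 1).
  near=> y; near: y; apply: filter_forall => i.
  have cq : {for y0, continuous (fun y => q y (delta_mx 0 i))}.
    by apply: differentiable_continuous; have [H _] := form_C1 ac hS (delta_mx 0 i); exact: H.
  exact: ((continuous_distP _ _).1 cq _ e0).
apply: (@filterS _ (nbhs y0)) H => y yi w.
rewrite !(form_in_chart_sum c Q) -sumrB (le_trans (ler_norm_sum _ _ _))//.
apply: (@le_trans _ _ (\sum_(i < n) (`|w| * (eta / (n%:R + 1))))).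
  apply: ler_sum => i _; rewrite -mulrBr normrM ler_pM//; first exact: row_norm_coord.
  by rewrite distrC; exact: yi.
rewrite sumr_const card_ord -[_ *+ n]mulr_natr -mulrA [leRHS]mulrC ler_wpM2l//.
by rewrite mulrAC ler_pdivrMr// ler_pM2l// lerDl.
Unshelve. all: by end_near. Qed.

Lemma form_bound y0 : exists2 C, 0 < C & forall w, `|q y0 w| <= C * `|w|.
Proof.
have fc : continuous (form_in_chart_map c Q y0) by exact: linear_row_continuous.
exact: (linear_lipschitz fc).
Qed.

(* The bounds (G) only involve [N y], so they may be read off with the form
   norm as soon as [N y] dominates the coordinate norm. *)
Lemma form_norm_in_chart (kap : R) y (A : E -> R) (l : {scalar E}) w : ccod c y ->
  (forall w, `|w| <= kap * N y w) -> 0 <= kap ->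
  (forall w, A (of_chart c y w) = l w) -> N y w <= 1 ->
  `|l w| <= form_norm (Defs.gnorm g) (cinv c y) A.
Proof.
move=> cy kN k0 Al w1; rewrite -Al.
have [C C0 CP] := linear_lipschitz (@linear_row_continuous _ _ _ l).
apply: (@le_form_norm _ _ _ _ _ _ (C * kap)) => // u u1.
have uE : u = of_chart c y (to_chart c (cinv c y) u).
  by have := of_to_chart u ac (cinv_dom cy); rewrite cinvK.
have Au : A u = l (to_chart c (cinv c y) u) by rewrite {1}uE Al.
rewrite Au; apply: (le_trans (CP _)); apply: ler_wpM2l; first exact: ltW.
apply: (le_trans (kN _)); rewrite -[leRHS]mulr1; apply: ler_wpM2l => //.
by rewrite /N -uE.
Qed.

(** Turns (G) for [L_c] into bounds for [L] with constants valid on a neighbourhood. Form norms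
    become bounds on [N]-unit vectors, which restrict well to a slice, and convexity is claimed only
    along the kernel of [q y0], the directions of the slice. *)
Lemma local_estimates y0 : ccod c y0 -> exists C lam : R,
  [/\ 0 < C, 0 < lam & \forall y \near y0,
  [/\ forall w, Lc (y, w) <= C * (N y w ^+ 2 + 1),
      forall a w, N y a <= 1 -> `|'d Lc (y, w) (a, 0)| <= C * (N y w ^+ 2 + 1),
      forall b w, N y b <= 1 -> `|'d Lc (y, w) (0, b)| <= C * (N y w + 1)
    & forall w1 w2, q y0 (w2 - w1) = 0 ->
        lam * N y (w2 - w1) ^+ 2 <=
        'd Lc (y, w2) (0, w2 - w1) - 'd Lc (y, w1) (0, w2 - w1)]].
Proof.
move=> cy0; have [C [lam [[Cc C0] [lc l0] [G1 G2 G3 G4]]]] := hG.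
have [Cx [Cxc Cx0 {}G2]] := G2 c ac.
have [kap kap0 kN] := gnorm_chart_bound g ac cy0.
have [CF CF0 FN] := charge_quadratic_diffl ac hS cy0.
have [Cq Cq0 qN] := form_bound y0.
pose x0 := cinv c y0; have cx0 : cdom c x0 by exact: cinv_dom.
have CN := near_continuous_le cy0 (Cc x0).
have CxN := near_continuous_le cy0 (within_open_continuous (cdom_open c) Cxc cx0).
have k0 : 0 < - k y0 by rewrite oppr_gt0 (charge_lt0 c hS).
have lN : \forall y \near y0, lam x0 / 2 < lam (cinv c y).
  apply: (near_preimage (continuous_comp (cinv_cts cy0) (lc x0)) (@open_gt _ (lam x0 / 2))) => /=.
  by rewrite ltr_pdivrMr// ltr_pMr// ltr1n.
have kNr : \forall y \near y0, k y < k y0 / 2.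
  have kc : {for y0, continuous k}.
    by apply: differentiable_continuous; have [H _] := charge_C1 ac hS; exact: H.
  by apply: (near_preimage kc (@open_lt _ (k y0 / 2))) => /=; move: k0; lra.
(* [eta] is chosen so that the negative term [2 q^2 / k] costs at most half of
   the convexity constant on vectors annihilated by [q y0]. *)
pose mu := lam x0 / 2; have mu0 : 0 < mu by rewrite divr_gt0.
have [eta eta0 etaP] : exists2 eta : R, 0 < eta & 4 * (eta * kap) ^+ 2 <= mu / 2 * - k y0.
  have A0 : 0 < mu / 2 * - k y0 / 4 by rewrite divr_gt0// mulr_gt0// divr_gt0.
  exists (Num.sqrt (mu / 2 * - k y0 / 4) / kap); first by rewrite divr_gt0// sqrtr_gt0.
  by rewrite divfK ?gt_eqF// sqr_sqrtr ?(ltW A0)// mulrC divfK.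
have qN1 := form_near cy0 eta0.
have qN2 := form_near cy0 ltr01.
(* The last summands bound the contribution of Q^2 / Q(K). In [C2], an [N]-unit vector has
   coordinate norm at most [kap], and [w] at most [kap * N y w]. In [C3], [(Cq + 1) * kap] bounds
   [q y] relative to [N], and 4 is the 2 from differentiating a square times the 2 from
   [|k y| > |k y0| / 2]. *)
pose C1 := C x0 + 1; pose C2 := Cx x0 + 1 + CF * kap * kap ^+ 2.
pose C3 := C x0 + 1 + 4 * ((Cq + 1) * kap) ^+ 2 / - k y0.
have C1p : 0 < C1 by rewrite addr_gt0.
have C2p : 0 < C2.
  rewrite /C2 ltr_wpDr//; first by rewrite !mulr_ge0 ?exprn_ge0 ?(ltW CF0) ?(ltW kap0).
  by rewrite addr_gt0//; exact: Cx0.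
have C3p : 0 < C3.
  rewrite /C3 ltr_wpDr//.
  by rewrite divr_ge0 ?(ltW k0)// mulr_ge0// exprn_ge0// mulr_ge0 ?(ltW kap0)// addr_ge0 ?(ltW Cq0).
exists (C1 + C2 + C3), (mu / 2); split; [exact: (addr_gt0 (addr_gt0 C1p C2p) C3p)|exact: divr_gt0|].
have cN : \forall y \near y0, ccod c y by exact: (open_near (@ccod_open _ _ _ c) cy0).
near=> y.
have cy : ccod c y by near: y.
have yC : C (cinv c y) <= C1 by near: y.
have yCx : Cx (cinv c y) <= Cx x0 + 1 by near: y.
have yl : mu < lam (cinv c y) by near: y.
have yk : k y < k y0 / 2 by near: y.
have ykN : forall w, `|w| <= kap * N y w by near: y.
have yF : forall a w, `|'d Fq (y, w) (a, 0)| <= CF * `|a| * `|w| ^+ 2 by near: y.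
have yq1 : forall w, `|q y w - q y0 w| <= eta * `|w| by near: y.
have yq2 : forall w, `|q y w - q y0 w| <= 1 * `|w| by near: y.
have yq w : `|q y w| <= (Cq + 1) * kap * N y w.
  apply: (le_trans (norm_le_distD (q y0 w) _)).
  rewrite -mulrA mulrDl; apply: lerD.
    by apply: (le_trans (qN w)); rewrite ler_pM2l.
  by rewrite distrC; apply: (le_trans (yq2 w)); rewrite !mul1r.
have ky0 : k y < 0 by exact: (charge_lt0 c hS).
have Nsq w : 0 <= N y w ^+ 2 + 1 by rewrite addr_ge0// exprn_ge0.
have N1 w : 0 <= N y w + 1 by rewrite addr_ge0.
have weaken (a x z : R) : 0 <= z -> a <= C1 + C2 + C3 -> x <= a * z ->
    x <= (C1 + C2 + C3) * z.
  by move=> z0 aC /le_trans; apply; rewrite ler_wpM2r.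
have ofB w1 w2 : of_chart c y w2 - of_chart c y w1 = of_chart c y (w2 - w1).
  by apply: esym; exact: linearB.
split.
- move=> w; apply: (weaken C1) => //; first by move: C2p C3p; lra.
  have -> : Lc (y, w) = Lr (y, w) + Fq (y, w).
    by rewrite reduced_lagrangian_in_chart /= subrK.
  have Fle : Fq (y, w) <= 0.
    by rewrite /charge_quadratic mulr_ge0_le0// ?sqr_ge0// invr_le0 ltW.
  have := G1 (cinv c y) (of_chart c y w); rewrite -/(N y w) => H.
  have H2 : C (cinv c y) * (N y w ^+ 2 + 1) <= C1 * (N y w ^+ 2 + 1) by rewrite ler_wpM2r.
  have : Lr (y, w) <= C (cinv c y) * (N y w ^+ 2 + 1) by exact: H.
  by move: Fle H2; lra.
- move=> a w a1; apply: (weaken C2) => //; first by move: C1p C3p; lra.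
  pose f u := 'd Lr (y, w) (u, 0).
  have fl : scalar f.
    by move=> b u v; rewrite /f -linearP; congr ('d Lr (y, w) _); congr pair;
      rewrite /= scaler0 addr0.
  pose l : {scalar E} := HB.pack f (GRing.isLinear.Build _ _ _ _ f fl).
  have H1 : `|l a| <= (Cx x0 + 1) * (N y w ^+ 2 + 1).
    apply: (@le_trans _ _ (Cx (cinv c y) * (N y w ^+ 2 + 1))); last by rewrite ler_wpM2r.
    apply: (le_trans _ (G2 (cinv c y) (of_chart c y w) (cinv_dom cy))).
    apply: (form_norm_in_chart cy ykN (ltW kap0)) => // u.
    exact: (partial_x_in_chart ac u cy (reduced_lagrangian_diff w cy)).
  rewrite lagrangian_diff_split// (le_trans (ler_normD _ _))// mulrDl lerD//.
  rewrite (le_trans (yF a w))//.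
  apply: (@le_trans _ _ (CF * kap * (kap ^+ 2 * N y w ^+ 2))).
    rewrite -exprMn ler_pM ?mulr_ge0 ?exprn_ge0 ?(ltW CF0)//.
      rewrite ler_pM2l// (le_trans (ykN a))// -[leRHS]mulr1.
      by rewrite ler_pM2l.
    by rewrite lerXn2r ?nnegrE ?mulr_ge0// ltW.
  rewrite mulrA ler_wpM2l ?lerDl// !mulr_ge0 ?exprn_ge0// ltW//.
- move=> b w b1; apply: (weaken C3) => //; first by move: C1p C2p; lra.
  pose f u := 'd Lr (y, w) (0, u).
  have fl : scalar f.
    by move=> a u v; rewrite /f -linearP; congr ('d Lr (y, w) _); congr pair;
      rewrite /= scaler0 addr0.
  pose l : {scalar E} := HB.pack f (GRing.isLinear.Build _ _ _ _ f fl).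
  have H1 : `|l b| <= (C x0 + 1) * (N y w + 1).
    apply: (@le_trans _ _ (C (cinv c y) * (N y w + 1))); last by rewrite ler_wpM2r.
    apply: (le_trans _ (G3 (cinv c y) (of_chart c y w))).
    apply: (form_norm_in_chart cy ykN (ltW kap0)) => // u.
    exact: (partial_v_in_chart ac u cy (reduced_lagrangian_diff w cy)).
  rewrite lagrangian_diff_split// (le_trans (ler_normD _ _))// mulrDl lerD//.
  rewrite (charge_quadratic_diffr ac hS w b cy) !normrM normfV (ltr0_norm ky0) gtr0_norm//.
  set D := (Cq + 1) * kap.
  have D0 : 0 <= D by rewrite mulr_ge0 ?addr_ge0 ?ltW.
  have qb : `|q y b| <= D.
    by rewrite (le_trans (yq b))// -[leRHS]mulr1 ler_wpM2l.
  have qw := yq w; rewrite -/D in qw.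
  have kinv : (- k y)^-1 <= 2 / - k y0.
    rewrite -[leRHS]invrK invf_div lef_pV2 ?posrE ?oppr_gt0 ?divr_gt0//.
    by move: yk; lra.
  apply: (@le_trans _ _ (2 * (D * N y w) * D * (2 / - k y0))).
    rewrite ler_pM ?mulr_ge0 ?invr_ge0 ?oppr_ge0 ?(ltW ky0)//.
    by rewrite ler_pM ?mulr_ge0// ler_pM2l.
  have -> : 2 * (D * N y w) * D * (2 / - k y0) = 4 * D ^+ 2 / - k y0 * N y w.
    by field; rewrite lt_eqF// -oppr_gt0.
  apply: ler_wpM2l; last by rewrite lerDl.
  by rewrite divr_ge0 ?(ltW k0)// mulr_ge0// exprn_ge0.
- move=> w1 w2; set w := w2 - w1 => qw0.
  have qwb : `|q y w| <= eta * kap * N y w.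
    have := yq1 w; rewrite qw0 subr0 => /le_trans; apply.
    by rewrite -mulrA ler_pM2l.
  have := G4 (cinv c y) (of_chart c y w1) (of_chart c y w2).
  rewrite ofB -/w -/(N y w).
  rewrite !(partial_v_in_chart ac _ cy (reduced_lagrangian_diff _ cy)) => H4.
  have qB : q y w2 = q y w1 + q y w.
    have := form_in_chart_linear c Q y 1 w1 w; rewrite scale1r mul1r => <-.
    by rewrite /w addrC subrK.
  have sq : q y w ^+ 2 <= (eta * kap) ^+ 2 * N y w ^+ 2.
    by rewrite -exprMn -real_normK ?num_real// lerXn2r ?nnegrE ?mulr_ge0 ?(ltW eta0) ?(ltW kap0).
  have T : - (mu / 2 * N y w ^+ 2) <= 2 * q y w ^+ 2 / k y.
    apply: (convexity_loss yk k0 _ (ltW mu0) sq etaP).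
    exact: exprn_ge0.
  have lN2 : mu * N y w ^+ 2 <= lam (cinv c y) * N y w ^+ 2.
    by rewrite ler_wpM2r ?exprn_ge0// ltW.
  apply: (convexity_balance (lagrangian_diff_split w1 (0, w) cy)
    (lagrangian_diff_split w2 (0, w) cy) (charge_quadratic_diffr ac hS w1 w cy)
    (charge_quadratic_diffr ac hS w2 w cy) qB H4 T).
  by rewrite -mulrDl -splitr.
Unshelve. all: by end_near. Qed.

End LocalEstimates.

(** * The flow box *)

(** The rows of [A] are a basis of the kernel of [f], completed by [v] to a basis of the space
    because [f v != 0]; [S] reads coordinates in this basis. *)
Lemma kernel_splitting (R : realType) (m : nat) (f : {scalar 'rV[R]_m.+1})
    (v : 'rV[R]_m.+1) : f v != 0 ->
  exists (A : 'M[R]_(m, m.+1)) (S : {linear 'rV[R]_m.+1 -> ('rV[R]_m * R)%type}),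
  [/\ forall x, f (x *m A) = 0,
      forall x (t : R), S (x *m A + t *: v) = (x, t)
    & forall w, (S w).1 *m A + (S w).2 *: v = w].
Proof.
move=> fv; pose a : 'cV[R]_m.+1 := \col_i f (delta_mx 0 i).
have fa w : f w = (w *m a) 0 0.
  rewrite row_linear_sum mxE; apply: eq_bigr => i _; by rewrite mxE.
have a0 : a != 0.
  by apply: contraNneq fv => a0; rewrite fa a0 mulmx0 mxE.
have ra : \rank a = 1%N.
  by apply/eqP; rewrite eqn_leq rank_leq_col lt0n mxrank_eq0.
have rk : \rank (kermx a) = m by rewrite mxrank_ker ra subn1.
have [A Af Aa] : exists2 A : 'M[R]_(m, m.+1), row_free A & A *m a = 0.
  have free := row_base_free (kermx a).
  have ker : row_base (kermx a) *m a = 0 by apply/sub_kermxP; rewrite eq_row_base.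
  (* The type of [row_base] mentions the rank, so the matrix is generalized before the rank becomes
     [m]. *)
  by move: (row_base (kermx a)) free ker; rewrite rk => A; exists A.
have fA x : f (x *m A) = 0 by rewrite fa -mulmxA Aa mulmx0 mxE.
pose T : 'M[R]_(1 + m, m.+1) := col_mx v A.
have TE (t : R) (x : 'rV[R]_m) : row_mx (t%:M : 'M[R]_1) x *m T = x *m A + t *: v.
  by rewrite mul_row_col mul_scalar_mx addrC.
have Tu : (T : 'M[R]_m.+1) \in unitmx.
  rewrite -row_free_unit; apply: inj_row_free => u.
  rewrite -[u](@hsubmxK _ 1 1 m) [lsubmx _]mx11_scalar TE => uT.
  have t0 : lsubmx (u : 'rV[R]_(1 + m)) 0 0 = 0.
    have := congr1 f uT; rewrite linearD fA add0r linearZ linear0 => /eqP.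
    by rewrite mulf_eq0 (negPf fv) orbF => /eqP.
  move: uT; rewrite t0 scale0r addr0 => /(congr1 (mulmxr (pinvmx A))) /=.
  rewrite mul0mx -mulmxA mulmxVp// mulmx1 => ->.
  by rewrite (_ : 0%:M = 0) ?row_mx0//; apply/matrixP => i j; rewrite !mxE mul0rn.
pose S0 (w : 'rV[R]_m.+1) : 'rV[R]_m * R :=
  let u : 'rV[R]_(1 + m) := w *m invmx T in (rsubmx u, lsubmx u 0 0).
have S0lin : linear S0.
  move=> k u w; rewrite /S0 mulmxDl -scalemxAl.
  by congr pair; rewrite /= ?linearP// !mxE.
pose S : {linear 'rV[R]_m.+1 -> ('rV[R]_m * R)%type} :=
  HB.pack S0 (GRing.isLinear.Build _ _ _ _ S0 S0lin).
exists A, S; split=> //.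
- move=> x t; rewrite /S /= /S0 -TE mulmxK// row_mxKr row_mxKl.
  by rewrite !mxE eqxx mulr1n.
- move=> w; rewrite /S /= /S0 -TE -mx11_scalar hsubmxK.
  by rewrite mulmxKV.
Qed.

Section AffineMaps.
Context {R : realType} {V W : normedModType R}.

Lemma is_diff_translate (a : W) (l : {linear V -> W}) x : continuous l ->
  is_diff x (fun u => a + l u) l.
Proof.
move=> lc.
have lD : is_diff x l l by split; [exact: linear_differentiable|exact: diff_lin].
by have := is_diffD (is_diff_cst a x) lD; rewrite add0r.
Qed.

Lemma C1_translate (a : W) (l : {linear V -> W}) U : continuous l ->
  C_on 1 U (fun u => a + l u).
Proof.
move=> lc; split=> [x _|v x _]; first by have [] := is_diff_translate a x lc.
rewrite (_ : 'D_v _ = cst (l v)); first exact: cst_continuous.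
apply/funext => y; have [fd fE] := is_diff_translate a y lc.
by rewrite deriveE// fE.
Qed.

End AffineMaps.

Lemma open_preimage_on (T T' : topologicalType) (f : T -> T') (U : set T) (V : set T') :
  open U -> (forall x, U x -> {for x, continuous f}) -> open V ->
  open (U `&` f @^-1` V).
Proof.
move=> oU fc oV; rewrite openE => x [Ux Vfx]; apply: filterI.
  exact: (open_nbhs_nbhs (conj oU Ux)).
exact: (near_preimage (fc x Ux) oV Vfx).
Qed.

Lemma C1_continuous (R : realType) (V W : normedModType R) (U : set V) (f : V -> W) x :
  C_on 1 U f -> U x -> {for x, continuous f}.
Proof. by move=> [fd _] Ux; exact/differentiable_continuous/fd. Qed.

Lemma diff_compE (R : realType) (U V W : normedModType R) (f : U -> V) (h : V -> W) x :
  differentiable f x -> differentiable h (f x) ->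
  differentiable (h \o f) x /\ forall v, 'd (h \o f) x v = 'd h (f x) ('d f x v).
Proof.
move=> fd hd; split; first exact: differentiable_comp.
by move=> v; exact: (congr1 (fun k => k v) (diff_comp fd hd)).
Qed.

Section FlowDerivative.
Context {R : realType} {n : nat}.
Local Notation E := 'rV[R]_n.
Context (X : E -> E) (U : set E) (y0 : E) (r d : R) (Phi : E -> R -> E) (d0 : 0 < d)
  (Phi0 : forall y, Phi y 0 = y)
  (PhiD : forall y (t : R), ball y0 r y -> `|t| < d ->
     U (Phi y t) /\ is_derive t 1 (Phi y) (X (Phi y t)))
  (PhiC : C_on 1 [set z : E * R | ball y0 r z.1 /\ `|z.2| < d]
     (fun z => Phi z.1 z.2))
  (PhiX : forall y (t : R), ball y0 r y -> `|t| < d ->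
     'd (fun z : E * R => Phi z.1 z.2) (y, t) (X y, 0) = X (Phi y t)).
Local Notation F := (fun z : E * R => Phi z.1 z.2).

Lemma flow_diff y (t : R) : ball y0 r y -> `|t| < d -> differentiable F (y, t).
Proof. by move=> yr td; have [H _] := PhiC; exact: H. Qed.

Lemma flow_diff_time y (t : R) : ball y0 r y -> `|t| < d ->
  'd F (y, t) (0, 1) = X (Phi y t).
Proof.
move=> yr td; have [hd hE] := diff_pairr (flow_diff yr td).
apply: (etrans (esym (hE 1))).
by have [_ H] := derive_at1 (PhiD yr td).2.
Qed.

Lemma flow_diff_split y (t : R) k (s : R) : ball y0 r y -> `|t| < d ->
  'd F (y, t) (k, s) = 'd F (y, t) (k, 0) + s *: X (Phi y t).
Proof.
move=> yr td.
have e : (k, s) = (k, 0) + s *: (0, 1) :> E * R.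
  by congr pair; rewrite /= ?scaler0 ?addr0 ?add0r//; exact/esym/mulr1.
apply: (etrans (congr1 ('d F (y, t)) e)).
apply: (etrans (linearD _ _ _)); congr (_ + _).
apply: (etrans (linearZ_LR _ _ _)); congr (_ *: _).
exact: flow_diff_time.
Qed.

(** The flow carries [X y] to [X (Phi y t)], which is also its time derivative, so a time component
    [s] can be traded for the starting vector [s *: X y]. Invariance of [L], which speaks of vectors
    [(w, 0)] only, then becomes applicable. *)
Lemma flow_diff_shear y (t : R) k (s : R) : ball y0 r y -> `|t| < d ->
  'd F (y, t) (k, s) = 'd F (y, t) (k + s *: X y, 0).
Proof.
move=> yr td.
have e : (k + s *: X y, 0) = (k, 0) + s *: (X y, 0) :> E * R.
  by congr pair; rewrite /= scaler0 addr0.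
apply: (etrans (flow_diff_split k s yr td)).
apply: esym; apply: (etrans (congr1 ('d F (y, t)) e)).
apply: (etrans (linearD _ _ _)); congr (_ + _).
apply: (etrans (linearZ_LR _ _ _)); congr (_ *: _).
exact: PhiX.
Qed.

Lemma flow_diff_time0 y k : ball y0 r y -> 'd F (y, 0) (k, 0) = k.
Proof.
move=> yr; have td : `|0 : R| < d by rewrite normr0.
have [hd hE] := diff_pairl (flow_diff yr td).
apply: (etrans (esym (hE k))).
rewrite (_ : (fun x => _) = id); last by apply/funext => x /=; rewrite Phi0.
by have [_ e] := is_diff_id y; exact: (congr1 (fun f => f k) e).
Qed.

End FlowDerivative.

Section FlowBox.
Context {R : realType} {m : nat}.
Local Notation E := 'rV[R]_m.+1.
Local Notation P := ('rV[R]_m * R)%type.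
Context (X : E -> E) (U : set E) (y0 : E) (r d : R) (Phi : E -> R -> E)
  (r0 : 0 < r) (d0 : 0 < d)
  (Phi0 : forall y, Phi y 0 = y)
  (PhiD : forall y (t : R), ball y0 r y -> `|t| < d ->
     U (Phi y t) /\ is_derive t 1 (Phi y) (X (Phi y t)))
  (PhiC : C_on 1 [set z : E * R | ball y0 r z.1 /\ `|z.2| < d]
     (fun z => Phi z.1 z.2))
  (A : 'M[R]_(m, m.+1)) (S : {linear E -> P})
  (SA : forall x (t : R), S (x *m A + t *: X y0) = (x, t))
  (AS : forall w, (S w).1 *m A + (S w).2 *: X y0 = w).

(* [y0 + x *m A] runs over the affine hyperplane through [y0] directed by the
   kernel of the form Q at [y0]. *)
Definition flow_box (z : P) : E := Phi (y0 + z.1 *m A) z.2.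
Local Notation Psi := flow_box.

Let aL0 (z : P) : E * R := (z.1 *m A, z.2).

Let aL0_linear : linear aL0.
Proof. by move=> k u v; congr pair; rewrite /= mulmxDl -scalemxAl. Qed.

Let aL : {linear P -> (E * R)%type} :=
  HB.pack aL0 (GRing.isLinear.Build _ _ _ _ aL0 aL0_linear).

Let aL_continuous : continuous aL.
Proof.
move=> z; apply: (@continuous_pair _ _ _ (fun z : P => z.1 *m A) snd); last exact: cvg_snd.
pose f : {linear 'rV[R]_m -> E} := mulmxr A.
have fc : continuous f by exact: linear_row_continuous.
exact: (@continuous_comp _ _ _ fst f z cvg_fst (fc z.1)).
Qed.

Let dom := [set z : E * R | ball y0 r z.1 /\ `|z.2| < d].

Let dom_open : open dom.
Proof.
rewrite openE => z [zr zd].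
have n1 : \forall y \near z.1, ball y0 r y by apply: open_near => //; exact: ball_open.
have n2 : \forall s \near z.2, `|s| < d by exact: (@near_norm_lt R R).
by exists (ball y0 r, [set s | `|s| < d]) => //= -[].
Qed.

Definition box_domain := [set z : P | ball y0 r (y0 + z.1 *m A) /\ `|z.2| < d].

Let aff z := (y0, 0) + aL z.

Let affE z : aff z = (y0 + z.1 *m A, z.2).
Proof. by rewrite /aff; congr pair; rewrite /= ?add0r. Qed.

Let PsiE : Psi = (fun z : E * R => Phi z.1 z.2) \o aff.
Proof.
apply/funext => z.
by change (Psi z = (fun z : E * R => Phi z.1 z.2) (aff z)); rewrite affE.
Qed.

Let box_domainE : box_domain = aff @^-1` dom.
Proof.
apply/seteqP; split => z zP; first by change (dom (aff z)); rewrite affE.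
by move: zP; change (dom (aff z) -> box_domain z); rewrite affE.
Qed.

Let aff_C1 : C_on 1 [set: P] aff.
Proof. exact: C1_translate. Qed.

Lemma box_domain_open : open box_domain.
Proof.
rewrite box_domainE; apply: open_comp; last exact: dom_open.
by move=> z _; exact: C1_continuous aff_C1 I.
Qed.

Lemma flow_box_C1 : C_on 1 box_domain Psi.
Proof.
rewrite PsiE box_domainE.
have := C1_comp (fin_basis_prod (fin_basis_row m.+1) (@fin_basis_scalar R)) openT dom_open aff_C1 PhiC.
by rewrite setTI.
Qed.

Lemma flow_box_diff z : box_domain z -> differentiable Psi z /\
  forall v, 'd Psi z v =
    'd (fun z : E * R => Phi z.1 z.2) (y0 + z.1 *m A, z.2) (v.1 *m A, v.2).
Proof.
move=> [z1 z2]; have [ad aE] := is_diff_translate (y0, 0) z aL_continuous.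
have Fd : differentiable (fun z : E * R => Phi z.1 z.2) (aff z).
  by rewrite affE; exact: (flow_diff PhiC).
have [cd cE] := diff_compE ad Fd.
rewrite PsiE; split; first exact: cd.
move=> v; apply: (etrans (cE v)).
apply: (etrans (congr1 ('d _ (aff z)) (congr1 (fun f => f v) aE))).
exact: (congr1 (fun u => 'd (fun z : E * R => Phi z.1 z.2) u (v.1 *m A, v.2)) (affE z)).
Qed.

Lemma box_domain0 : box_domain 0.
Proof. by split; rewrite /= ?mul0mx ?addr0 ?normr0//; exact: ballxx. Qed.

Lemma flow_box0 : Psi 0 = y0.
Proof. by rewrite /Psi /= mul0mx addr0. Qed.

Lemma S_continuous : continuous S.
Proof. exact: linear_row_continuous. Qed.

(** [S] inverts the differential of [Psi] at 0, so [G] has the identity as differential there and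
    the near-identity inverse function theorem applies to it. *)
Let G := Psi \o S.

Let GO := S @^-1` box_domain.

Let GO_open : open GO.
Proof.
by apply: open_comp; [move=> z _; exact: S_continuous|exact: box_domain_open].
Qed.

Let G_C1 : C_on 1 GO G.
Proof.
have SC : C_on 1 [set: E] S by apply: C1_linear; exact: S_continuous.
have := C1_comp (fin_basis_prod (fin_basis_row m) (@fin_basis_scalar R)) openT
  box_domain_open SC flow_box_C1.
by rewrite setTI.
Qed.

Let S0 : S 0 = 0. Proof. exact: linear0. Qed.

Let dG0 w : 'd G 0 w = w.
Proof.
have Sd : differentiable S 0 by apply: linear_differentiable; exact: S_continuous.
have Bd : box_domain (S 0) by rewrite S0; exact: box_domain0.
have [Pd PE] := flow_box_diff Bd.
have [_ cE] := diff_compE Sd Pd.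
apply: (etrans (cE w)); apply: (etrans (PE _)).
have SE : 'd S 0 w = S w.
  exact: (congr1 (fun f => f w) (diff_lin 0 S_continuous)).
have yE : y0 + (S 0).1 *m A = y0 by rewrite S0 mul0mx addr0.
have tE : (S 0).2 = 0 by rewrite S0.
have yr : ball y0 r y0 by exact: ballxx.
have td : `|0 : R| < d by rewrite normr0.
have E1 := flow_diff_split PhiD PhiC ((S w).1 *m A) (S w).2 yr td.
have E2 := flow_diff_time0 d0 Phi0 PhiC ((S w).1 *m A) yr.
have E3 : 'd (fun z : E * R => Phi z.1 z.2) (y0, 0) ((S w).1 *m A, (S w).2) = w.
  apply: (etrans E1); rewrite Phi0.
  by apply: (etrans (congr1 (fun u => u + _) E2)); exact: AS.
rewrite SE yE tE; exact: E3.
Qed.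

(** The box is shrunk until its slice satisfies [Pr] and its image stays within [r2] of [y0]; these
    will supply the local estimates on the slice and the precompactness of the image. *)
Lemma flow_box_inverse (Pr : set E) (r2 : R) : 0 < r2 -> (\forall y \near y0, Pr y) ->
  exists (rho : R) (inv : E -> P),
  let box := [set z : P | `|z.1| < rho /\ `|z.2| < rho] in
  [/\ 0 < rho,
      forall z, box z -> [/\ box_domain z, Pr (y0 + z.1 *m A) & `|Psi z - y0| <= r2],
      open (Psi @` box),
      forall z, box z -> inv (Psi z) = z
    & C_on 1 (Psi @` box) inv].
Proof.
move=> r20 Pn.
have h0 : 0 < 2^-1 :> R by rewrite invr_gt0.
have GO0 : GO 0 by rewrite /GO /= S0; exact: box_domain0.
have [r1 r10 [r1O _ r1G]] := C1_strict GO_open G_C1 GO0 h0.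
(* The inverse of [S]; it carries a small box into the ball where [G] is close to the identity. *)
pose T (z : P) : E := z.1 *m A + z.2 *: X y0.
have fAc : continuous (fun z : P => z.1 *m A).
  move=> z; pose f : {linear 'rV[R]_m -> E} := mulmxr A.
  have fc : continuous f by exact: linear_row_continuous.
  exact: (@continuous_comp _ _ _ fst f z cvg_fst (fc z.1)).
have Tc : continuous T.
  move=> z; apply: (@continuousD _ _ _ (fun z : P => z.1 *m A) (fun z : P => z.2 *: X y0)).
    exact: fAc.
  by apply: continuousZr_tmp; exact: cvg_snd.
have n1 : \forall z \near (0 : P), ball 0 r1 (T z).
  apply: near_preimage; [exact: Tc|exact: ball_open|].
  by rewrite /T /= mul0mx scale0r addr0; exact: ballxx.
have n2 : \forall z \near (0 : P), Pr (y0 + z.1 *m A).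
  have hc : {for (0 : P), continuous (fun z : P => y0 + z.1 *m A)}.
    apply: (@continuousD _ _ _ (fun=> y0) (fun z : P => z.1 *m A)); last exact: fAc.
    exact: cst_continuous.
  apply: hc; rewrite /= mul0mx addr0; exact: Pn.
have n3 : \forall z \near (0 : P), `|Psi z - y0| <= r2.
  have Pc := C1_continuous flow_box_C1 box_domain0.
  apply: filterS ((continuous_distP _ _).1 Pc _ r20) => z.
  by rewrite flow_box0 distrC.
have [rho /= rho0 rhoP] := (nbhs_ballP _ _).1 (filterI n1 (filterI n2 n3)).
pose box := [set z : P | `|z.1| < rho /\ `|z.2| < rho].
have boxP z : box z -> [/\ ball 0 r1 (T z), Pr (y0 + z.1 *m A) & `|Psi z - y0| <= r2].
  move=> [z1 z2]; have [|b1 [b2 b3]] := rhoP z; last by split.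
  by rewrite -ball_normE /= sub0r normrN prod_normE gt_max z1.
have ST z : S (T z) = z by rewrite /T SA; case: z.
have TS w : T (S w) = w by rewrite /T AS.
pose O := S @^-1` box.
have Oball u : O u -> ball 0 r1 u.
  by move=> Ou; rewrite -(TS u); have [] := boxP (S u) Ou.
have oO : open O.
  apply: open_comp; first by move=> z _; exact: S_continuous.
  rewrite (_ : box = ball (0 : P) rho); first exact: ball_open.
  apply/seteqP; split => z; rewrite -ball_normE /= sub0r normrN prod_normE gt_max.
    by move=> [-> ->].
  by move=> /andP[].
have GOb a b : O a -> O b -> `|G b - G a - (b - a)| <= 2^-1 * `|b - a|.
  move=> Oa Ob.
  exact: (eq_ind _ (fun v => `|G b - G a - v| <= _) (r1G a b (Oball a Oa) (Oball b Ob)) _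
    (dG0 (b - a))).
have GCO : C_on 1 O G.
  by apply: C_on_sub G_C1 => u Ou; apply: r1O; exact: Oball.
have [th [oG thG thC]] := inverse_function oO GOb GCO.
have imE : G @` O = Psi @` box.
  apply/seteqP; split => _ [z Oz <-]; first by exists (S z).
  by exists (T z); rewrite /G /O /= ST.
exists rho, (S \o th) => /=; rewrite -/box -imE; split => //.
- move=> z bz; have [b1 b2 b3] := boxP z bz; split => //.
  by have := r1O _ b1; rewrite /GO /= ST.
- move=> z bz; have thz : th (Psi z) = T z.
    by have := thG (T z); rewrite /G /O /= ST; apply.
  by rewrite /= thz ST.
- have SC : C_on 1 [set: E] S by apply: C1_linear; exact: S_continuous.
  have sub : G @` O `<=` G @` O `&` th @^-1` setT by move=> y.
  have := C_on_sub sub (C1_comp (fin_basis_row m.+1) oG openT thC SC).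
  by rewrite imE.
Qed.

End FlowBox.

Lemma norm_lt_open (R : realType) (V : normedModType R) (rho : R) :
  open [set x : V | `|x| < rho].
Proof.
rewrite (_ : [set x | _] = ball (0 : V) rho); first exact: ball_open.
by apply/seteqP; split => z; rewrite -ball_normE /= sub0r normrN.
Qed.

(** * The flow box as a C^1 diffeomorphism onto an open subset of the manifold *)

Section Box.
Context {R : realType} {m : nat} {M : manifold R m.+1} (c : chart R m.+1 M)
  (ac : atlas c) (y0 : 'rV[R]_m.+1) (r d : R)
  (Phi : 'rV[R]_m.+1 -> R -> 'rV[R]_m.+1) (A : 'M[R]_(m, m.+1))
  (rho : R) (inv : 'rV[R]_m.+1 -> 'rV[R]_m * R).
Local Notation E := 'rV[R]_m.+1.
Local Notation P := ('rV[R]_m * R)%type.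
Local Notation Psi := (flow_box y0 Phi A).
Local Notation B := [set x : 'rV[R]_m | `|x| < rho].
Local Notation box := [set z : P | `|z.1| < rho /\ `|z.2| < rho].
Local Notation W := (Psi @` box).
Context (rho0 : 0 < rho)
  (PsiC : C_on 1 (box_domain y0 r d A) Psi)
  (box_sub : box `<=` box_domain y0 r d A)
  (Psi_cod : forall z, box z -> ccod c (Psi z))
  (W_open : open W)
  (PsiK : forall z, box z -> inv (Psi z) = z)
  (invC : C_on 1 W inv).

Let B0 : B 0. Proof. by rewrite /= normr0. Qed.

Let B_open : open B. Proof. exact: norm_lt_open. Qed.

Let box_open : open box.
Proof.
rewrite (_ : box = [set z : P | `|z| < rho]); first exact: norm_lt_open.
apply/seteqP; split => z; rewrite /= prod_normE gt_max; first by move=> [-> ->].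
by move=> /andP[].
Qed.

Definition box_slice : manifold R m := open_subset_manifold B_open B0.
Local Notation Sm := box_slice.
Local Notation pt := (row_point B0).

Definition box_map (z : Sm * R) : M := cinv c (Psi (set_val z.1, z.2)).
Local Notation phi := box_map.

Definition box_image : set M := [set x | cdom c x /\ W (cmap c x)].
Local Notation U := box_image.

Let theta (x : M) : Sm * R := let z := inv (cmap c x) in (pt z.1, z.2).

Let ptK y : B y -> set_val (pt y) = y. Proof. exact: row_pointK. Qed.

Let slice_box (x : Sm) (t : R) : `|t| < rho -> box (set_val x, t).
Proof. by move=> tr; split => //; exact: (@set_valP _ B x). Qed.

Let Psi_cts z : box z -> {for z, continuous Psi}.
Proof. by move=> bz; apply: C1_continuous PsiC _; exact: box_sub. Qed.

Lemma box_image_open : open U.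
Proof.
exact: (open_preimage_on (@cdom_open _ _ _ c) (@cmap_cts _ _ _ c) W_open).
Qed.

Lemma box_map_image z : `|z.2| < rho -> U (phi z).
Proof.
move=> zr; have bz := slice_box z.1 zr.
split; first exact/cinv_dom/Psi_cod.
by rewrite cinvK; [exists (set_val z.1, z.2)|exact: Psi_cod].
Qed.

Let box_mapK z : `|z.2| < rho -> theta (phi z) = z.
Proof.
move=> zr; have bz := slice_box z.1 zr.
rewrite /theta /box_map cinvK; last exact: Psi_cod.
rewrite PsiK// /= set_val_point; exact/esym/surjective_pairing.
Qed.

Let box_mapV y : U y -> `|(theta y).2| < rho /\ phi (theta y) = y.
Proof.
move=> [cy [z bz zy]]; rewrite /theta -zy PsiK//; split; first by case: bz.
by rewrite /box_map /= ptK; [rewrite -surjective_pairing zy cmapK|case: bz].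
Qed.

Lemma box_map_continuous z : `|z.2| < rho -> {for z, continuous phi}.
Proof.
move=> zr; have bz := slice_box z.1 zr.
have h : {for z, continuous (fun z : Sm * R => (set_val z.1, z.2) : P)}.
  apply: (@continuous_pair _ _ _ (fun z : Sm * R => set_val z.1) snd); last exact: cvg_snd.
  apply: (@continuous_comp _ _ _ fst (set_val : Sm -> 'rV[R]_m)); first exact: cvg_fst.
  exact: initial_continuous.
exact: (continuous_comp (continuous_comp h (Psi_cts bz)) (cinv_cts (Psi_cod bz))).
Qed.

Let theta_continuous y : U y -> {for y, continuous theta}.
Proof.
move=> [cy [z bz zy]].
have ic : {for cmap c y, continuous inv} by apply: C1_continuous invC _; exists z.
have h := continuous_comp (cmap_cts cy) ic.
have iz : inv (cmap c y) = z by rewrite -zy PsiK.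
apply: (@continuous_pair _ _ _ (fun y => pt (inv (cmap c y)).1 : Sm) (fun y => (inv (cmap c y)).2)).
  apply: (@continuous_comp _ _ _ (fun y => (inv (cmap c y)).1) (pt : _ -> Sm)).
    exact: (@continuous_comp _ _ _ (inv \o cmap c) fst y h cvg_fst).
  apply: (within_open_continuous B_open); first exact: row_point_continuous.
  by rewrite iz; case: bz.
exact: (@continuous_comp _ _ _ (inv \o cmap c) snd y h cvg_snd).
Qed.

(** In any chart the map is [Psi] followed by a transition from [c], hence C^1. *)
Let map_C1 c' : atlas c' ->
  C_on 1 [set z : P | [/\ B z.1, z.2 \in `]- rho, rho[ & cdom c' (phi (pt z.1, z.2))]]
    (fun z => cmap c' (phi (pt z.1, z.2))).
Proof.
move=> ac'; pose T := ccod c `&` cinv c @^-1` cdom c'.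
have oT : open T by exact: transition_dom_open.
have oD : open (box `&` Psi @^-1` T).
  by apply: open_preimage_on => //; exact: Psi_cts.
apply: (@C_on_sub _ _ _ _ (box `&` Psi @^-1` T)).
  move=> z [z1 z2 z3]; have bz : box z by split => //; move: z2; rewrite in_itv/= -ltr_norml.
  split => //; split; first exact: Psi_cod.
  by move: z3; rewrite /box_map /= ptK// -surjective_pairing.
apply: (@C_on_congr _ _ _ _ _ ((cmap c' \o cinv c) \o Psi)) => //.
  by move=> z [[z1 z2] _]; rewrite /= /box_map /= ptK// -surjective_pairing.
apply: (@C_on_sub _ _ _ _ (box_domain y0 r d A `&` Psi @^-1` T)).
  by move=> z [bz zT]; split => //; exact: box_sub.
apply: (C1_comp (fin_basis_row m.+1) _ oT PsiC (transition_smooth ac ac' 1)).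
exact: box_domain_open.
Qed.

Let inv_C1 c' : atlas c' ->
  C_on 1 [set y : E | ccod c' y /\ U (cinv c' y)]
    (fun y => (set_val (theta (cinv c' y)).1, (theta (cinv c' y)).2) : P).
Proof.
move=> ac'; pose T := ccod c' `&` cinv c' @^-1` cdom c.
have oT : open T by exact: transition_dom_open.
have tC := transition_smooth ac' ac 1.
have oD : open (T `&` (cmap c \o cinv c') @^-1` W).
  by apply: open_preimage_on => // y Ty; exact: C1_continuous tC Ty.
apply: (@C_on_sub _ _ _ _ (T `&` (cmap c \o cinv c') @^-1` W)).
  by move=> y [cy [dy wy]].
apply: (@C_on_congr _ _ _ _ _ (inv \o (cmap c \o cinv c'))) => //.
  move=> y [[cy dy] [z bz zy]].
  rewrite /= /theta /=; move: zy => /= <-; rewrite PsiK// ptK; last by case: bz.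
  exact: surjective_pairing.
exact: (C1_comp (fin_basis_row m.+1) oT W_open tC invC).
Qed.

Lemma box_map_diffeo : C1_diffeo_onto `]- rho, rho[ U phi.
Proof.
exists theta; split.
- move=> z; rewrite /= in_itv/= -ltr_norml => zr.
  by split; [exact: box_map_image|exact: box_mapK].
- by move=> y /box_mapV[yr ye]; rewrite /= in_itv/= -ltr_norml.
- split; apply: continuous_in_subspaceT => z /set_mem.
    by rewrite /= in_itv/= -ltr_norml; exact: box_map_continuous.
  exact: theta_continuous.
- move=> s c' -> ac'; split; first exact: map_C1.
  by apply: C_on_sub (inv_C1 ac') => y [].
Qed.

Lemma box_map_tangent x (t : R) nu (tau : R) : `|t| < rho ->
  product_tangent_map phi x t nu tau =
  of_chart c (Psi (set_val x, t)) ('d Psi (set_val x, t) (nu, tau)).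
Proof.
move=> tr; have bz := slice_box x tr.
(* [phi] read in the unique chart of the slice, which is how [product_tangent_map] reads it. *)
pose f (z : P) : M := phi (pt z.1, z.2).
have fE z : box z -> f z = cinv c (Psi z).
  by move=> [z1 z2]; rewrite /f /box_map /= ptK// -surjective_pairing.
have fx : f (set_val x, t) = phi (x, t) by rewrite /f /= set_val_point.
have cf : cdom c (f (set_val x, t)) by rewrite fE//; exact/cinv_dom/Psi_cod.
have fc : {for (set_val x, t), continuous f}.
  apply: (@near_eq_continuous _ _ (cinv c \o Psi)).
    by apply: (open_near_sub box_open bz) => z bz'; rewrite fE.
  exact: (continuous_comp (Psi_cts bz) (cinv_cts (Psi_cod bz))).
have Pd : differentiable Psi (set_val x, t) by case: PsiC => H _; apply: H; exact: box_sub.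
have fn : \forall z \near (set_val x, t), Psi z = (cmap c \o f) z.
  apply: (open_near_sub box_open bz) => z bz'; rewrite /= fE// cinvK//.
  exact: Psi_cod.
have [fd dfE] := near_eq_differentiable fn Pd.
have [_ hE] := diff_into_chart_at ac cf fc fd.
have E1 : product_tangent_map phi x t nu tau =
    'd (cmap (chart_at (f (set_val x, t))) \o f) (set_val x, t) (nu, tau).
  by rewrite fx.
have cE : cmap c (f (set_val x, t)) = Psi (set_val x, t).
  exact: (etrans (congr1 (cmap c) (fE _ bz)) (cinvK (Psi_cod bz))).
apply: (etrans E1); apply: (etrans (hE _)).
exact: (f_equal2 (of_chart c) cE (congr1 (fun k => k (nu, tau)) dfE)).
Qed.

End Box.

(** * The Lagrangian on the slice *)

Section SliceLagrangian.
Context {R : realType} {m : nat} {M : manifold R m.+1} (c : chart R m.+1 M)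
  (ac : atlas c) (g : riemannian_metric M)
  (L : M -> 'rV[R]_m.+1 -> R) (K : M -> 'rV[R]_m.+1)
  (Q : M -> {scalar 'rV[R]_m.+1}) (dd : M -> R) (hS : condition_S L K Q dd)
  (y0 : 'rV[R]_m.+1) (A : 'M[R]_(m, m.+1)) (rho : R) (rho0 : 0 < rho).
Local Notation E := 'rV[R]_m.+1.
Local Notation F := 'rV[R]_m.
Local Notation B := [set x : F | `|x| < rho].
Local Notation Lc := (in_natural_coord L c).
Local Notation q := (form_in_chart c Q).
Local Notation k := (charge_in_chart c K Q).
Local Notation N := (norm_in_chart c g).
Local Notation Sm := (box_slice (m := m) rho0).
Context (slice_cod : forall y, B y -> ccod c (y0 + y *m A)).

Definition slice_point (x : Sm) : E := y0 + set_val x *m A.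
Local Notation Y := slice_point.

(* On the hyperplane [t = 0], L0 is L itself, omega = Q / 2 and beta = - Q(K) / 2. *)
Definition slice_lagrangian (x : Sm) (nu : F) : R := Lc (Y x, nu *m A).
Local Notation L0 := slice_lagrangian.

Definition slice_drift (x : Sm) : R := dd (cinv c (Y x)).

Definition slice_charge (x : Sm) : R := - 2^-1 * k (Y x).

Let slice_form0 (x : Sm) (nu : F) : R := 2^-1 * q (Y x) (nu *m A).

Let slice_form_linear x : scalar (slice_form0 x).
Proof.
move=> a u v; rewrite /slice_form0 mulmxDl -scalemxAl form_in_chart_linear.
by rewrite mulrDr mulrCA.
Qed.

Definition slice_form (x : Sm) : {scalar F} :=
  HB.pack (slice_form0 x) (GRing.isLinear.Build _ _ _ _ (slice_form0 x) (slice_form_linear x)).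

Let B_open : open B. Proof. exact: norm_lt_open. Qed.

Let val_cinv s y : atlas s -> B y -> set_val (cinv s y : Sm) = y.
Proof. by move=> -> By; exact: row_pointK. Qed.

Let slice_cinv s y : atlas s -> B y -> Y (cinv s y) = y0 + y *m A.
Proof. by move=> sa By; rewrite /slice_point val_cinv. Qed.

Let slice_of_chart (s : chart R m Sm) y nu : atlas s -> B y -> of_chart s y nu = nu.
Proof. by move=> -> By; exact: (@transition_id _ _ Sm). Qed.

Let slice_ccod (s : chart R m Sm) : atlas s -> ccod s = B.
Proof. by move=> ->. Qed.

Let slice_C1 (s : chart R m Sm) (f : E -> R) : atlas s -> C_on 1 (ccod c) f ->
  C_on 1 (ccod s) (fun y => f (Y (cinv s y))).
Proof.
move=> sa fC; rewrite slice_ccod//.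
apply: (@C_on_congr _ _ _ _ _ (f \o (fun y => y0 + y *m A))) => //.
  by move=> y By /=; rewrite slice_cinv.
have := C1_comp (fin_basis_row m.+1) B_open (@ccod_open _ _ _ c) (C1_affine y0 A B) fC.
by apply: C_on_sub => y By; split => //; exact: slice_cod.
Qed.

Lemma slice_drift_C1 : C1_function slice_drift.
Proof.
move=> s sa; apply: (slice_C1 (f := dd \o cinv c) sa).
by case: hS => _ _ [_ dC _] _; exact: dC.
Qed.

Lemma slice_charge_C1 : C1_function slice_charge.
Proof.
move=> s sa; apply: (slice_C1 (f := fun y => - 2^-1 * k y) sa).
exact: C1M (@ccod_open _ _ _ c) (C_on_cst _ _ _) (charge_C1 ac hS).
Qed.

Lemma slice_charge_gt0 x : 0 < slice_charge x.
Proof. by rewrite /slice_charge nmulr_rgt0 ?oppr_lt0 ?invr_gt0// (charge_lt0 c hS). Qed.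

Lemma slice_form_C1 : C1_one_form slice_form.
Proof.
move=> s sa nu.
apply: (@C_on_congr _ _ _ _ _ (fun y => 2^-1 * q (Y (cinv s y)) (nu *m A))).
- exact: ccod_open.
- by move=> y; rewrite slice_ccod// => By; rewrite slice_of_chart.
apply: (slice_C1 (f := fun y => 2^-1 * q y (nu *m A)) sa).
exact: C1M (@ccod_open _ _ _ c) (C_on_cst _ _ _) (form_C1 ac hS (nu *m A)).
Qed.

Let bl0 (z : F * F) : E * E := (z.1 *m A, z.2 *m A).

Let bl0_linear : linear bl0.
Proof. by move=> a u v; congr pair; rewrite /= mulmxDl -scalemxAl. Qed.

Let bl : {linear (F * F)%type -> (E * E)%type} :=
  HB.pack bl0 (GRing.isLinear.Build _ _ _ _ bl0 bl0_linear).

Let bl_continuous : continuous bl.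
Proof.
pose f : {linear F -> E} := mulmxr A.
have fc : continuous f by exact: linear_row_continuous.
move=> z; apply: (@continuous_pair _ _ _ (fun z : F * F => z.1 *m A) (fun z : F * F => z.2 *m A)).
  exact: (@continuous_comp _ _ _ fst f z cvg_fst (fc z.1)).
exact: (@continuous_comp _ _ _ snd f z cvg_snd (fc z.2)).
Qed.

Let aff z := (y0, 0) + bl z.

Let affE z : aff z = (y0 + z.1 *m A, z.2 *m A).
Proof. by rewrite /aff; congr pair; rewrite /= ?add0r. Qed.

Let slice_coord s z : atlas s -> B z.1 -> (Lc \o aff) z = in_natural_coord L0 s z.
Proof.
move=> sa Bz; rewrite /= affE /in_natural_coord /slice_lagrangian.
by rewrite slice_cinv// slice_of_chart.
Qed.

Let slice_phase_open : open (B `*` [set: F]).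
Proof.
rewrite openE => -[y v] [By _].
have n1 : \forall y' \near y, B y' by exact: open_near B_open By.
by exists (B, setT) => //; split => //; exact: filterT.
Qed.

Lemma slice_lagrangian_C1 : C1_TM L0.
Proof.
move=> s sa; rewrite slice_ccod//.
apply: (@C_on_congr _ _ _ _ _ (Lc \o aff)); first exact: slice_phase_open.
  by move=> z [Bz _]; exact: slice_coord.
have aC : C_on 1 (B `*` [set: F]) aff by exact: C1_translate.
have := C1_comp (fin_basis_prod (fin_basis_row m.+1) (fin_basis_row m.+1))
  slice_phase_open (@phase_open _ _ _ c) aC (lagrangian_C1 ac hS).
apply: C_on_sub => z [Bz _]; split => //.
by change ((ccod c `*` [set: E]) (aff z)); rewrite affE; split => //; exact: slice_cod.
Qed.

Let slice_diff s y v : atlas s -> B y ->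
  differentiable (in_natural_coord L0 s) (y, v) /\
  forall w, 'd (in_natural_coord L0 s) (y, v) w =
    'd Lc (y0 + y *m A, v *m A) (w.1 *m A, w.2 *m A).
Proof.
move=> sa By; have [ad aE] := is_diff_translate (y0, 0) (y, v) bl_continuous.
have yc := slice_cod By.
have Ld : differentiable Lc (aff (y, v)) by rewrite affE; exact: (lagrangian_diff ac hS).
have [cd cE] := diff_compE ad Ld.
have n : \forall z \near (y, v), (Lc \o aff) z = in_natural_coord L0 s z.
  apply: (open_near_sub (x := (y, v)) slice_phase_open (conj By I)) => z [Bz _].
  exact: slice_coord.
have [hd hE] := near_eq_differentiable n cd.
split; first exact: hd.
move=> w; apply: (etrans (congr1 (fun f => f w) hE)); apply: (etrans (cE w)).
apply: (etrans (congr1 ('d _ (aff (y, v))) (congr1 (fun f => f w) aE))).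
exact: (congr1 (fun u => 'd Lc u (w.1 *m A, w.2 *m A)) (affE (y, v))).
Qed.

Context (nrm : Sm -> F -> R) (C lam : R) (C0 : 0 < C) (lam0 : 0 < lam)
  (nrmE : forall x nu, nrm x nu = N (Y x) (nu *m A))
  (qA : forall nu, q y0 (nu *m A) = 0)
  (est : forall z, B z -> let y := y0 + z *m A in
  [/\ forall w, Lc (y, w) <= C * (N y w ^+ 2 + 1),
      forall a w, N y a <= 1 -> `|'d Lc (y, w) (a, 0)| <= C * (N y w ^+ 2 + 1),
      forall b w, N y b <= 1 -> `|'d Lc (y, w) (0, b)| <= C * (N y w + 1)
    & forall w1 w2, q y0 (w2 - w1) = 0 ->
        lam * N y (w2 - w1) ^+ 2 <=
        'd Lc (y, w2) (0, w2 - w1) - 'd Lc (y, w1) (0, w2 - w1)]).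

Let nrm_ge0 x nu : 0 <= nrm x nu.
Proof. by rewrite nrmE; exact: sqrtr_ge0. Qed.

Let valB (x : Sm) : B (set_val x). Proof. exact: (@set_valP _ B x). Qed.

Let slice_partial_v x nu w :
  partial_v L0 x nu w = 'd Lc (Y x, nu *m A) (0, w *m A).
Proof.
pose s := chart_at x; have sa : atlas s by exact: chart_at_atlas.
have [hd hE] := slice_diff nu sa (valB x).
have cs : ccod s (set_val x) by rewrite slice_ccod//; exact: valB.
have := partial_v_in_chart sa w cs hd.
have -> : cinv s (set_val x) = x by exact: set_val_point.
rewrite (slice_of_chart nu sa (valB x)) (slice_of_chart w sa (valB x)).
move=> ->; apply: (etrans (hE _)).
exact: (congr1 (fun a => 'd Lc (Y x, nu *m A) (a, w *m A)) (mul0mx _ A)).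
Qed.

Let slice_partial_x (s : chart R m Sm) x nu w : atlas s ->
  partial_x L0 s x nu w = 'd Lc (Y x, nu *m A) (w *m A, 0).
Proof.
move=> sa; have [hd hE] := slice_diff nu sa (valB x).
have cs : ccod s (set_val x) by rewrite slice_ccod//; exact: valB.
have := partial_x_in_chart sa w cs hd.
have -> : cinv s (set_val x) = x by rewrite sa; exact: set_val_point.
rewrite (slice_of_chart nu sa (valB x)) (slice_of_chart w sa (valB x)).
move=> ->; apply: (etrans (hE _)).
exact: (congr1 (fun a => 'd Lc (Y x, nu *m A) (w *m A, a)) (mul0mx _ A)).
Qed.

(** The estimates are uniform over the slice, so constant bounding functions suffice, also for the
    chart-dependent one. Unit vectors of the slice are ambient unit vectors of the form [w *m A],
    and these lie in the kernel of [q y0], as the convexity estimate requires. *)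
Lemma slice_growth : growth_condition nrm L0.
Proof.
exists (cst C), (cst lam); split.
- by split=> [x|x]; [exact: cst_continuous|exact: C0].
- by split=> [x|x]; [exact: cst_continuous|exact: lam0].
split.
- move=> x v; rewrite nrmE; have [H _ _ _] := est (valB x); exact: H.
- move=> s sa; exists (cst C); split.
  + by apply: continuous_subspaceT => x; exact: cst_continuous.
  + by move=> x _; exact: C0.
  + move=> x v _; apply: form_norm_le.
      apply: mulr_ge0; first exact: ltW.
      by apply: addr_ge0; [exact: exprn_ge0|exact: ler01].
    move=> w; rewrite slice_partial_x// !nrmE => Nw.
    by have [_ H _ _] := est (valB x); exact: H.
- move=> x v; apply: form_norm_le.
    apply: mulr_ge0; first exact: ltW.
    by apply: addr_ge0; [exact: nrm_ge0|exact: ler01].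
  move=> w; rewrite slice_partial_v !nrmE => Nw.
  by have [_ _ H _] := est (valB x); exact: H.
- move=> x v1 v2; rewrite !slice_partial_v nrmE.
  have [_ _ _ H] := est (valB x).
  have qw : q y0 (v2 *m A - v1 *m A) = 0 by rewrite -mulmxBl; exact: qA.
  have := H _ _ qw; rewrite -mulmxBl; exact.
Qed.

End SliceLagrangian.

(** * Precompactness, and assembly of the local structure *)

Lemma closed_ball_row_compact (R : realType) (n : nat) (y : 'rV[R]_n) (r : R) : 0 < r ->
  compact (closed_ball y r).
Proof.
move=> r0; apply: bounded_closed_compact; last exact: closed_ball_closed.
exists (`|y| + r); split; first exact: num_real.
move=> C /ltW Cr z; rewrite closed_ballE// /closed_ball_ /= => yz.
apply: le_trans Cr; rewrite -[X in `|X|](subKr y).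
by apply: (le_trans (ler_normB _ _)); rewrite lerD2l.
Qed.

(** [U] lies in the image by [cinv c] of a closed ball, which is compact; the radius is half that of
    an open ball inside [ccod c], so that the closed ball stays in [ccod c]. *)
Lemma chart_ball_precompact (R : realType) (n : nat) (M : manifold R n) (c : chart R n M)
    (y : 'rV[R]_n) : ccod c y -> exists2 r : R, 0 < r &
  forall U : set M, (forall x, U x -> cdom c x /\ `|cmap c x - y| <= r) -> precompact U.
Proof.
move=> cy; have [r0 /= r00 rC] := (nbhs_ballP _ _).1 (open_near (@ccod_open _ _ _ c) cy).
have h0 : 0 < r0 / 2 by exact: divr_gt0.
have bC z : closed_ball y (r0 / 2) z -> ccod c z.
  rewrite closed_ballE// /closed_ball_ /= => yz; apply: rC.
  by rewrite -ball_normE /=; apply: (le_lt_trans yz); rewrite ltr_pdivrMr// ltr_pMr// ltr1n.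
exists (r0 / 2) => // U UP.
apply: (@precompact_subset _ U (cinv c @` closed_ball y (r0 / 2))).
  move=> x /UP[cx xy]; exists (cmap c x); last exact: cmapK.
  by rewrite closed_ballE// /closed_ball_ /= distrC.
apply: compact_precompact; first exact: carrier_hausdorff.
apply: continuous_compact; last exact: closed_ball_row_compact.
by apply: continuous_in_subspaceT => z /set_mem /bC; exact: cinv_cts.
Qed.

Lemma stationary_form (R : realType) (l w dr k tau : R) :
  l + tau * (w + dr) + tau ^+ 2 / 2 * k =
  l + 2 * (2^-1 * w + dr / 2) * tau - (- 2^-1 * k) * tau ^+ 2.
Proof. by field. Qed.

Theorem proposition7p4 (R : realType) (m : nat) (hm : (1 <= m)%N)
    (M : manifold R m.+1) (hM : connected [set: M])
    (g : riemannian_metric M) (hg : complete_metric g)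
    (L : M -> 'rV[R]_m.+1 -> R) (K : M -> 'rV[R]_m.+1)
    (Q : M -> {scalar 'rV[R]_m.+1}) (d : M -> R)
    (hS : condition_S L K Q d) (hG : condition_G g L K Q) :
  stationary_product_type_local_structure g K L.
Proof.
move=> p; pose c := chart_at p; have ac : atlas c by exact: chart_at_atlas.
have cp : cdom c p by exact: chart_at_dom.
pose y0 := cmap c p; have cy0 : ccod c y0 by exact: cmap_cod.
pose X := field_in_chart K c.
have [r [td [Phi [[r0 td0] Phi0 PhiD PhiC PhiX]]]] :=
  local_flow (@ccod_open _ _ _ c) cy0 (field_C1 ac hS).
(* Transversality of the kernel of Q to the field at [p], from Q(K) < 0. *)
have qX : form_in_chart_map c Q y0 (X y0) != 0.
  by apply: ltr0_neq0; have := charge_lt0 c hS y0; rewrite chargeE.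
have [A [S [qA SA AS]]] := kernel_splitting qX.
have [C [lam [C0 lam0 est]]] := local_estimates ac hS hG cy0.
have [r2 r20 pre] := chart_ball_precompact cy0.
(* The estimates themselves are the property imposed on the slice, and [r2] keeps the box inside a
   compact coordinate ball. *)
have [rho [inv [rho0 boxP W_open PsiK invC]]] :=
  flow_box_inverse r0 td0 Phi0 PhiD PhiC SA AS r20 est.
pose Psi := flow_box y0 Phi A.
pose box := [set z : 'rV[R]_m * R | `|z.1| < rho /\ `|z.2| < rho].
have box_sub : box `<=` box_domain y0 r td A by move=> z /boxP[].
have PsiC := flow_box_C1 PhiC A.
have Psi_cod z : box z -> ccod c (Psi z).
  by move=> /box_sub[z1 z2]; have [] := PhiD _ _ z1 z2.
have B_box (x : 'rV[R]_m) : `|x| < rho -> box (x, 0) by move=> xr; split; rewrite //= normr0.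
have slice_cod (x : 'rV[R]_m) : `|x| < rho -> ccod c (y0 + x *m A).
  by move=> /B_box/box_sub[x1 _]; exact: (flow_ball_cod td0 Phi0 PhiD x1).
pose U := box_image c y0 Phi A rho.
pose phi := box_map c y0 Phi A (rho0 := rho0).
have ttd (x : box_slice (m := m) rho0) (t : R) : - rho < t < rho ->
    [/\ `|t| < rho, box (set_val x, t), ball y0 r (slice_point y0 A x) & `|t| < td].
  rewrite -ltr_norml => tr; have bz : box (set_val x, t).
    by split => //; exact: (@set_valP _ [set x : 'rV[R]_m | `|x| < rho] x).
  by split => //; have [] := box_sub _ bz.
have tangent x t nu tau : - rho < t < rho -> product_tangent_map phi x t nu tau =
    of_chart c (Psi (set_val x, t))
      ('d (fun z : 'rV[R]_m.+1 * R => Phi z.1 z.2) (slice_point y0 A x, t) (nu *m A, tau)).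
  move=> tr; have [tr' bz _ _] := ttd x t tr.
  have E1 := box_map_tangent ac PsiC box_sub Psi_cod x nu tau tr'.
  apply: (etrans E1).
  exact: (congr1 (of_chart c _) ((flow_box_diff PhiC (box_sub _ bz)).2 (nu, tau))).
have U_pre : precompact U.
  apply: pre => x [cx [z bz zx]]; split => //.
  by rewrite -zx; have [] := boxP z bz.
exists U, (box_slice rho0), rho, phi; split.
- split; [exact: box_image_open|exact: U_pre|split => //].
  by exists 0; [split; rewrite normr0|exact: flow_box0].
- split => //; exact: (box_map_diffeo ac rho0 PsiC box_sub Psi_cod W_open PsiK invC).
- move=> x t tr; have [_ bz Yr ttd'] := ttd x t tr.
  apply: (etrans (tangent x t 0 1 tr)); rewrite mul0mx.
  apply: (etrans (congr1 (of_chart c _) (flow_diff_time PhiD PhiC Yr ttd'))).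
  exact: (of_chart_field ac K (Psi_cod _ bz)).
- exists (slice_lagrangian c L y0 A (rho0 := rho0)), (slice_form c Q y0 A (rho0 := rho0)),
    (slice_drift c d y0 A (rho0 := rho0)), (slice_charge c K Q y0 A (rho0 := rho0)).
  split.
  + split; first exact: (slice_lagrangian_C1 ac hS slice_cod).
    apply: (slice_growth ac hS slice_cod C0 lam0 _ qA).
    (* At time 0 the flow differentiates to the identity in the starting point, so the induced norm
       of [nu] is the ambient norm of [nu *m A]. *)
    * move=> x nu; have tr : - rho < 0 < rho by rewrite oppr_lt0 rho0.
      have [_ bz Yr _] := ttd x 0 tr.
      have E1 := tangent x 0 nu 0 tr.
      have E2 := flow_diff_time0 td0 Phi0 PhiC (nu *m A) Yr.
      have E3 : Psi (set_val x, 0) = slice_point y0 A x by exact: Phi0.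
      apply: (etrans (congr1 (Defs.gnorm g _) (etrans E1 (congr1 (of_chart c _) E2)))).
      exact: (congr1 (fun y => norm_in_chart c g y (nu *m A)) E3).
    * by move=> x /B_box/boxP[_ H _].
  + exact: (slice_form_C1 ac hS slice_cod).
  + exact: (slice_drift_C1 ac hS slice_cod).
  + split; first exact: (slice_charge_C1 ac hS slice_cod).
    exact: (slice_charge_gt0 c hS).
  + move=> x t nu tau tr; have [tr' bz Yr ttd'] := ttd x t tr.
    have inv_L : flow_invariant_lagrangian K L by case: hS => _ [].
    have cY : ccod c (slice_point y0 A x) by exact: (flow_ball_cod td0 Phi0 PhiD Yr).
    (* The component [tau] is traded for [tau *: X] at the starting point, invariance removes [t],
       and the quadratic expansion along [X] is applied on the slice. *)
    apply: (etrans (congr1 (L _) (tangent x t nu tau tr))).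
    have E1 := flow_diff_shear PhiD PhiC PhiX (nu *m A) tau Yr ttd'.
    apply: (etrans (congr1 (fun w => L _ (of_chart c _ w)) E1)).
    have E2 := invariance_in_chart ac (field_C1 ac hS) td0 Phi0 PhiD PhiC (nu *m A + tau *: X (slice_point y0 A x)) inv_L Yr ttd'.
    apply: (etrans E2); apply: (etrans (lagrangian_expansion ac hS (nu *m A) tau cY)).
    exact: stationary_form.
Qed.
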